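(* For every integer $n\ge0$, the numbers of $(2n+1)\times(2n+1)$ diagonally and antidiagonally symmetric alternating sign matrices with central entry $1$ and $-1$ are given respectively by $$|\mathrm{DASASM}_+(2n+1)|=\frac{n+1}{2n+1}\prod_{i=0}^n\frac{(3i)!}{(n+i)!}\qquad\text{and}\qquad|\mathrm{DASASM}_-(2n+1)|=\frac{n}{2n+1}\prod_{i=0}^n\frac{(3i)!}{(n+i)!},$$ and hence satisfy $$\frac{|\mathrm{DASASM}_-(2n+1)|}{|\mathrm{DASASM}_+(2n+1)|}=\frac{n}{n+1}.$$
   Context: An alternating sign matrix (ASM) is a square matrix in which each entry is $0$, $1$ or $-1$, and along each row and each column the nonzero entries alternate in sign and have sum $1$. $\mathrm{DASASM}(m)$ is the set of $m\times m$ ASMs $A$ with $A_{ij}=A_{ji}=A_{m+1-j,m+1-i}$ for all $1\le i,j\le m$. $\mathrm{DASASM}_\pm(2n+1)$ is the set of $A\in\mathrm{DASASM}(2n+1)$ whose central entry is $A_{n+1,n+1}=\pm1$. *)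

(* Defs.v *)
From HB Require Import structures.
From mathcomp Require Import all_boot all_order all_algebra.
Set Implicit Arguments.
Unset Strict Implicit.
Unset Printing Implicit Defensive.
Import Order.TTheory GRing.Theory Num.Theory.
Local Open Scope ring_scope.

Definition alternating (s : seq int) : bool :=
  sorted [rel x y | x * y < 0] [seq x <- s | x != 0].

Definition asm_line (s : seq int) : bool :=
  alternating s && (\sum_(x <- s) x == 1).

Definition asm_values : seq int := [:: 0; 1; -1].

Definition is_ASM (m : nat) (A : 'M[int]_m) : bool :=
  [&& [forall i, forall j, A i j \in asm_values],
      [forall i, asm_line [seq A i j | j : 'I_m]] &
      [forall j, asm_line [seq A i j | i : 'I_m]]].

(* With 0-based indices, the index m + 1 - i becomes m - 1 - i, which is
   [rev_ord i]. *)
Definition is_DASASM (m : nat) (A : 'M[int]_m) : bool :=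
  is_ASM A &&
  [forall i, forall j,
     (A i j == A j i) && (A j i == A (rev_ord j) (rev_ord i))].

(* ['M[int]_m] is not a finType, so the sets below live in the finite type of
   matrices with entries in {0, 1, -1}; [DASASM_int] shows that nothing is lost. *)
Definition asm_entry : finType := seq_sub asm_values.

Definition int_mx (m : nat) (A : 'M[asm_entry]_m) : 'M[int]_m := map_mx val A.

Definition DASASM (m : nat) : {set 'M[asm_entry]_m} :=
  [set A | is_DASASM (int_mx A)].

(* [inord n] is the central index of 'I_(2n+1). *)
Definition DASASM_plus (n : nat) : {set 'M[asm_entry]_((2 * n).+1)} :=
  [set A in DASASM ((2 * n).+1) | int_mx A (inord n) (inord n) == 1].

Definition DASASM_minus (n : nat) : {set 'M[asm_entry]_((2 * n).+1)} :=
  [set A in DASASM ((2 * n).+1) | int_mx A (inord n) (inord n) == -1].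

Lemma int_mx_inj (m : nat) : injective (@int_mx m).
Proof.
move=> A B eqAB; apply/matrixP=> i j; apply: val_inj.
by move/matrixP/(_ i j): eqAB; rewrite !mxE.
Qed.

Lemma DASASM_int (m : nat) (A : 'M[int]_m) :
  is_DASASM A <-> exists2 B, B \in DASASM m & int_mx B = A.
Proof.
split=> [dA | [B]]; last by rewrite inE => dB <-.
have vA i j : A i j \in asm_values.
  by case/andP: dA => /and3P[/forallP/(_ i)/forallP/(_ j)].
pose B : 'M[asm_entry]_m := \matrix_(i, j) SeqSub (vA i j).
have BA : int_mx B = A by apply/matrixP=> i j; rewrite !mxE.
by exists B => //; rewrite inE BA.
Qed.

(* Main.v *)
Require Import Defs.
From mathcomp Require Import all_boot all_order all_algebra all_fingroup.
From mathcomp Require Import all_field ring lra zify.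
From Stdlib Require Import FunctionalExtensionality.
Set Implicit Arguments.
Unset Strict Implicit.
Unset Printing Implicit Defensive.
Import Order.TTheory GRing.Theory Num.Theory.
Local Open Scope ring_scope.

(* A DASASM is determined by a triangle of entries, that is, by a configuration
   of a six-vertex model with one line per row, which carries a parameter u_i,
   and a central column with a parameter w. By the Yang-Baxter and reflection
   equations its partition function Z(u_1, .., u_n; w) is symmetric in the u_i.
   When q is a primitive 12th root of unity, so that all configurations have
   weight +1 or -1 at u_i = 1 and w = +1 or -1, Z is up to explicit factors
   w S(w^2) + w^(2n) S(w^-2), where S(z) is the Schur function of the partition
   (n, n-1, n-1, .., 1, 1) at u_1^2, u_1^-2, .., u_n^2, u_n^-2, z. Indeed,
   both sides are Laurent polynomials in u_1^2 that satisfy the same recurrences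
   at sufficiently many values of u_1^2. For u_i = r^(2i-1) and
   w = eps r^(2n+1) the Schur functions are products, and r -> 1 yields Z. The
   value eps = 1 counts all DASASMs, and eps = -1 counts them with the sign of
   the central entry. *)

(** * Vertex weights and their local relations *)

(** The 12th root of unity has a second effect: the shifts by q^4 at which the model degenerates
    become multiplications by cube roots of unity. The exponents 0, 1, 3, 4, 6, .. in the numerator
    of S advance by 3 every two steps, so S factors when two of its arguments differ by such a root.
    This is why the recurrences of both sides match. In u_1^2 each side has 2n + 1 coefficients.
    Freezing the first row gives 2 recurrences, freezing it with another row gives 2(n - 1), and the
    missing one comes from moving the central line, which replaces w by q^2 / w. The ratio of the
    two numbers comes from the limit. At the special parameters the two Schur functions agree up to
    a power of r, so their sum is a multiple of 1 + eps r, whereas Z carries the factor 1 + eps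
    r^(2n+1). For eps = 1 both tend to 2; for eps = -1 both tend to 0 and their quotient to 2n + 1.
    Hence the total count is 2n + 1 times the signed count. *)

Section LocalRelations.
Variables (F : fieldType) (q : F).

(* A state is a vector indexed by the words of bits on the edges of a cut. The
   operators below act on the leftmost edges of the cut, and [lft] shifts an
   operator by one edge to the right. [vertex_op] is the vertex of the
   six-vertex model in which two lines cross, [turn_op] and [corner_op] are the
   boundary vertices at the two ends of a line. *)
Definition state := seq bool -> F.
Definition op := state -> state.

Definition sg (x : F) : F := x - x^-1.
(** Normalized so that a vertex is the identity at [y = 1] (a = 1, b = 0) and has rank one on its
    two edges at [y = q ^+ 4] (a = 0, b = 1); the recurrences use these two values. The third weight
    is 1. *)
Definition weight_a (y : F) : F := sg (q ^+ 4 / y) / sg (q ^+ 4).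
Definition weight_b (y : F) : F := sg y / sg (q ^+ 4).
Definition boundary_weight (u : F) : F := sg (q * u) / sg q.

Definition vertex_op (y : F) : op := fun f s =>
  match s with
  | a :: b :: t =>
      if a == b then weight_a y * f [:: a, b & t]
      else f [:: a, b & t] + weight_b y * f [:: b, a & t]
  | _ => 0
  end.

Definition turn_op (u : F) : op := fun f s =>
  match s with
  | c :: t => f (c :: t) + boundary_weight u^-1 * f (~~ c :: t)
  | _ => 0
  end.

Definition corner_op (u : F) : op := fun f s =>
  match s with
  | a :: b :: t => (if a == b then boundary_weight u else 1) * f t
  | _ => 0
  end.

Definition lft (A : op) : op := fun f s =>
  match s with
  | a :: t => A (fun t' => f (a :: t')) t
  | _ => f [::]
  end.

Hypotheses (q0 : q != 0) (q21 : q ^+ 2 != 1) (q81 : q ^+ 8 != 1).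

Lemma sgq4_neq0 : sg (q ^+ 4) != 0.
Proof.
rewrite /sg subr_eq0; apply/eqP=> h; move/eqP: q81; apply.
by rewrite (exprD q 4 4) {1}h mulVf // expf_neq0.
Qed.

Lemma sgq_neq0 : sg q != 0.
Proof.
rewrite /sg subr_eq0; apply/eqP=> h; move/eqP: q21; apply.
by rewrite expr2 {1}h mulVf.
Qed.

Lemma yang_baxter (y1 y2 : F) (f : state) : y1 != 0 -> y2 != 0 ->
  vertex_op y1 (lft (vertex_op (y1 * y2)) (vertex_op y2 f)) =
  lft (vertex_op y2) (vertex_op (y1 * y2) (lft (vertex_op y1) f)).
Proof.
move=> h1 h2; apply: functional_extensionality => -[|a [|b [|c s]]] //=.
- by case: (a == b); rewrite !mulr0 ?addr0.
have h4 : q ^+ 4 != 0 by rewrite expf_neq0.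
move: sgq4_neq0; rewrite /weight_a /weight_b /sg; move: h4; move: (q ^+ 4) => z z0.
rewrite /sg => hs; have hs' : z ^+ 2 - 1 != 0.
  have -> : z ^+ 2 - 1 = z * (z - z^-1) by field.
  by rewrite mulf_neq0.
by case: a; case: b; case: c => //=; field; rewrite ?h1 ?h2 ?z0 ?hs'.
Qed.

Lemma reflection_right (x y : F) (f : state) : x != 0 -> y != 0 ->
  lft (turn_op x) (vertex_op (q ^+ 2 / (x * y)) (lft (turn_op y) (vertex_op (x / y) f))) =
  vertex_op (x / y) (lft (turn_op y) (vertex_op (q ^+ 2 / (x * y)) (lft (turn_op x) f))).
Proof.
move=> h1 h2; apply: functional_extensionality => -[|a [|b s]] //=.
have e1 : q ^+ 2 - 1 != 0 by rewrite subr_eq0.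
have e2 : q ^+ 8 - 1 != 0 by rewrite subr_eq0.
rewrite /weight_a /weight_b /boundary_weight /sg; case: a; case: b => //=; field;
  by rewrite h1 h2 q0 -expr2 -exprM e1 e2.
Qed.

Lemma reflection_left (x y : F) (f : state) : x != 0 -> y != 0 ->
  vertex_op (x / y) (lft (vertex_op (q ^+ 2 / (x * y))) (corner_op x (corner_op y f))) =
  lft (lft (vertex_op (x / y))) (lft (vertex_op (q ^+ 2 / (x * y))) (corner_op y (corner_op x f))).
Proof.
move=> h1 h2; apply: functional_extensionality => -[|a [|b [|c [|d s]]]] //=.
- by case: ifP; rewrite ?(mulr0, addr0).
- by case: a; case: b; case: c; rewrite /= !(mulr0, addr0).
have e1 : q ^+ 2 - 1 != 0 by rewrite subr_eq0.
have e2 : q ^+ 8 - 1 != 0 by rewrite subr_eq0.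
rewrite /weight_a /weight_b /boundary_weight /sg; case: a; case: b; case: c; case: d => //=; field;
  by rewrite h1 h2 q0 -expr2 -exprM e1 e2.
Qed.

End LocalRelations.

Arguments lft {F} A f s.

(** * Exchange of lines in the triangle *)

Section Operators.
Variables (F : fieldType) (q : F).

Local Notation op := (op F).
Local Notation state := (state F).
Local Notation R0 := (vertex_op q).
Local Notation K0 := (turn_op q).
Local Notation cup := (corner_op q).

(** An [op] is an arbitrary map of states. Linearity is what makes it commute with a vertex or
    corner on other edges, since these form linear combinations of values of the state. *)
Definition linop (A : op) := forall (c d : F) f g,
  A (fun s => c * f s + d * g s) = fun s => c * A f s + d * A g s.

Lemma lin_R0 y : linop (R0 y).
Proof.
move=> c d f g; apply: functional_extensionality => -[|a [|b s]] /=;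
  rewrite ?mulr0 ?addr0 //.
by case: ifP => _; ring.
Qed.

Lemma lin_K0 u : linop (K0 u).
Proof.
move=> c d f g; apply: functional_extensionality => -[|a s] /=;
  by [rewrite ?mulr0 ?addr0 | ring].
Qed.

Lemma lin_cup u : linop (cup u).
Proof.
move=> c d f g; apply: functional_extensionality => -[|a [|b s]] /=;
  by [rewrite ?mulr0 ?addr0 | ring].
Qed.

Lemma lin_lft A : linop A -> linop (lft A).
Proof.
move=> lA c d f g; apply: functional_extensionality => -[|a s] //=.
by rewrite (lA c d (fun t => f (a :: t)) (fun t => g (a :: t))).
Qed.

Lemma lin_comp A B : linop A -> linop B -> linop (A \o B).
Proof. by move=> lA lB c d f g /=; rewrite lB lA. Qed.

Lemma linZ A c f : linop A -> A (fun s => c * f s) = fun s => c * A f s.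
Proof.
move=> lA; have := lA c 0 f f.
have -> : (fun s => c * f s + 0 * f s) = (fun s => c * f s).
  by apply: functional_extensionality => s; rewrite mul0r addr0.
by move=> ->; apply: functional_extensionality => s; rewrite mul0r addr0.
Qed.

Lemma lft_comp (A B : op) f : lft (A \o B) f = lft A (lft B f).
Proof. by apply: functional_extensionality => -[]. Qed.

Lemma lft_lft_R0 A y f :
  lft (lft A \o R0 y) f = lft (lft A) (lft (R0 y) f).
Proof. exact: lft_comp. Qed.

Lemma lft_id f : lft (@id state) f = f.
Proof. by apply: functional_extensionality => -[]. Qed.

Lemma iter_lft_comp n (A B : op) f :
  iter n lft (A \o B) f = iter n lft A (iter n lft B f).
Proof.
elim: n f => [|n IHn] f //=; rewrite -lft_comp; congr (lft _ f).
by apply: functional_extensionality => g; apply: IHn.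
Qed.

Lemma lin_iter n A : linop A -> linop (iter n lft A).
Proof. by move=> lA; elim: n => //= n; apply: lin_lft. Qed.

Lemma R0_far y A f : linop A -> R0 y (lft (lft A) f) = lft (lft A) (R0 y f).
Proof.
move=> lA; apply: functional_extensionality => -[|a [|b s]] //=.
case: ifP => _; first by rewrite (linZ _ _ lA).
have := lA 1 (weight_b q y) (fun t => f [:: a, b & t]) (fun t => f [:: b, a & t]).
move/(congr1 (@^~ s)) => /=; rewrite mul1r => <-; congr (A _ _).
by apply: functional_extensionality => t; rewrite mul1r.
Qed.

Lemma cup_far u A f : linop A -> lft (lft A) (cup u f) = cup u (A f).
Proof.
move=> lA; apply: functional_extensionality => -[|a [|b s]] //=.
by rewrite (linZ _ _ lA).
Qed.

Definition vertex_param (u v : F) := q ^+ 2 / (u * v).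

Lemma vtxC u v : vertex_param u v = vertex_param v u.
Proof. by rewrite /vertex_param [u * v]mulrC. Qed.

(* In the triangular fundamental domain of a DASASM, the line of [u] starts at a
   corner on the diagonal, crosses the lines [vs] from left to right, and turns
   at the antidiagonal. *)
Fixpoint pass (u : F) (vs : seq F) : op :=
  if vs is v :: vs' then lft (pass u vs') \o R0 (vertex_param u v) else id.

Fixpoint turn (u : F) (vs : seq F) : op :=
  if vs is v :: vs' then lft (turn u vs') \o R0 (vertex_param u v) else K0 u.

Definition row u vs : op := lft (turn u vs) \o cup u.

(* [w] is the parameter of the central column: the other columns belong in pairs
   to the lines that have turned. *)
Fixpoint part (us : seq F) (w : F) : state :=
  if us is u :: us' then row u (us' ++ w :: rev us') (part us' w)
  else fun s => (s != [::])%:R.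

Definition partition_fun us w := part us w (nseq (size us).*2.+1 false).

Lemma lin_pass u vs : linop (pass u vs).
Proof.
elim: vs => // v vs IH; apply: lin_comp; last exact: lin_R0.
exact: lin_lft.
Qed.

Lemma lin_turn u vs : linop (turn u vs).
Proof.
elim: vs => [|v vs IH]; first exact: lin_K0.
by apply: lin_comp; [apply: lin_lft | apply: lin_R0].
Qed.

Lemma turn_cat u l r f :
  turn u (l ++ r) f = iter (size l) lft (turn u r) (pass u l f).
Proof.
elim: l f => [|v l IH] f //=; rewrite -lft_comp; congr (lft _ _).
by apply: functional_extensionality => g; apply: IH.
Qed.

Lemma pass_far u l n A f : linop A -> (size l < n)%N ->
  pass u l (iter n lft A f) = iter n lft A (pass u l f).
Proof.
move=> lA; elim: l n f => [|v l IH] [|n] f //; rewrite ltnS => ln.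
case: n => [|n] // in ln *.
rewrite [pass _ _]/= /comp !iterS (R0_far _ _ (lin_iter n lA)).
rewrite -[in LHS]lft_comp -[in RHS]lft_comp; congr (lft _ _).
by apply: functional_extensionality => g; apply: (IH n.+1).
Qed.

Hypotheses (q0 : q != 0) (q21 : q ^+ 2 != 1) (q81 : q ^+ 8 != 1).

Lemma vtx_neq0 u v : u != 0 -> v != 0 -> vertex_param u v != 0.
Proof.
by move=> u0 v0; rewrite !mulf_neq0 ?invr_neq0 ?expf_neq0 // mulf_neq0.
Qed.

Lemma vert_cross u v1 v2 f : u != 0 -> v1 != 0 -> v2 != 0 ->
  R0 (v1 / v2) (lft (R0 (vertex_param u v2)) (R0 (vertex_param u v1) f)) =
  lft (R0 (vertex_param u v1)) (R0 (vertex_param u v2) (lft (R0 (v1 / v2)) f)).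
Proof.
move=> u0 v10 v20; have -> : vertex_param u v2 = v1 / v2 * vertex_param u v1.
  by rewrite /vertex_param; field; rewrite u0 v10 v20.
by rewrite yang_baxter ?vtx_neq0 // mulf_neq0 ?invr_neq0.
Qed.

Lemma horiz_cross x y v f : x != 0 -> y != 0 -> v != 0 ->
  R0 (vertex_param x v) (lft (R0 (vertex_param y v)) (R0 (x / y) f)) =
  lft (R0 (x / y)) (R0 (vertex_param y v) (lft (R0 (vertex_param x v)) f)).
Proof.
move=> x0 y0 v0; have -> : vertex_param y v = vertex_param x v * (x / y).
  by rewrite /vertex_param; field; rewrite x0 y0 v0.
by rewrite yang_baxter ?vtx_neq0 // mulf_neq0 ?invr_neq0.
Qed.

(** The Yang-Baxter equation pulls a crossing of two adjacent columns through the row; the rest of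
    the row acts on other edges. *)
Lemma turn_vert_cross u l v1 v2 r f :
  u != 0 -> v1 != 0 -> v2 != 0 ->
  iter (size l) lft (R0 (v1 / v2)) (turn u (l ++ [:: v1, v2 & r]) f) =
  turn u (l ++ [:: v2, v1 & r]) (iter (size l).+1 lft (R0 (v1 / v2)) f).
Proof.
move=> u0 v10 v20; elim: l f => [|v l IH] f.
  rewrite /= !lft_lft_R0 R0_far; last exact: lin_turn.
  by rewrite vert_cross.
rewrite !iterS /= R0_far; last exact/lin_iter/lin_R0.
rewrite -!lft_comp; congr (lft _ _).
by apply: functional_extensionality => g; apply: IH.
Qed.

Lemma row_vert_cross u l v1 v2 r f :
  u != 0 -> v1 != 0 -> v2 != 0 ->
  iter (size l).+1 lft (R0 (v1 / v2)) (row u (l ++ [:: v1, v2 & r]) f) =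
  row u (l ++ [:: v2, v1 & r]) (iter (size l) lft (R0 (v1 / v2)) f).
Proof.
move=> u0 v10 v20; rewrite /row /= -cup_far; last exact/lin_iter/lin_R0.
rewrite -!lft_comp; congr (lft _ _).
by apply: functional_extensionality => g; apply: turn_vert_cross.
Qed.

(** A crossing of two rows passes each column by the Yang-Baxter equation, and the reflection
    equation at the turns makes it a crossing of columns. *)
Lemma turn_horiz_cross x y vs f : x != 0 -> y != 0 -> all (predC1 0) vs ->
  turn x (rcons vs y) (lft (turn y vs) (R0 (x / y) f)) =
  iter (size vs) lft (R0 (x / y))
    (turn y (rcons vs x) (lft (turn x vs) f)).
Proof.
move=> x0 y0; elim: vs f => [|v vs IH] f /=.
  by move=> _; rewrite reflection_right // [vertex_param y x]vtxC.
case/andP=> v0 vs0; rewrite !lft_lft_R0.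
rewrite R0_far; last exact: lin_turn.
rewrite horiz_cross // R0_far; last exact: lin_turn.
rewrite -!lft_comp; congr (lft _ _).
by apply: functional_extensionality => g /=; rewrite IH.
Qed.

(** The crossing enters between the two leftmost columns, becomes a crossing of the two rows by the
    reflection equation at the corners, and leaves between the two rightmost columns. *)
Lemma rows_exchange x y vs f : x != 0 -> y != 0 -> all (predC1 0) vs ->
  R0 (x / y) (row x (y :: rcons vs y) (row y vs f)) =
  iter (size vs).+2 lft (R0 (x / y))
    (row y (x :: rcons vs x) (row x vs f)).
Proof.
move=> x0 y0 vs0; 
have lx z us : linop (turn z us) by apply: lin_turn.
have step u v g : lft (R0 (vertex_param u v)) (cup u (lft (turn v vs) g)) =
    lft (lft (lft (turn v vs))) (lft (R0 (vertex_param u v)) (cup u g)).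
  rewrite -(cup_far _ _ (lin_lft (lx v vs))) -!lft_comp; congr (lft _ _).
  by apply: functional_extensionality => h /=; rewrite R0_far.
rewrite /row /= !lft_lft_R0 !step R0_far // R0_far; last exact: lin_lft.
rewrite reflection_left // [vertex_param y x]vtxC; move: (lft _ (cup y _)) => g.
rewrite -!lft_comp; congr (lft _ _).
apply: functional_extensionality => h; rewrite /= -!lft_comp; congr (lft _ _).
by apply: functional_extensionality => h'; apply: turn_horiz_cross.
Qed.

(** The rows of [l] lie above those of [x] and [y] and meet the columns of this pair twice, at
    mirrored places. Both crossings are pulled through these rows; the iteration counts are their
    positions in the word. *)
Lemma part_exchange (l : seq F) (x y : F) (r : seq F) (w : F) :
  all (predC1 0) (w :: x :: y :: l ++ r) ->
  iter (size l) lft (R0 (x / y)) (part (l ++ [:: x, y & r]) w) =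
  iter (size l + (size r).*2 + 3)%N lft (R0 (x / y))
    (part (l ++ [:: y, x & r]) w).
Proof.
rewrite /= all_cat; case/and5P=> w0 x0 y0 + r0.
elim: l => [|u l IH] /= => [_|].
  rewrite !rev_cons -!rcons_cons -!rcons_cat rows_exchange //; last first.
    by rewrite all_cat /= w0 all_rev r0.
  by rewrite size_cat /= size_rev !addnS addnn add0n addn0.
case/andP=> u0 l0.
have E z1 z2 : rev (l ++ [:: z1, z2 & r]) = rev r ++ [:: z2, z1 & rev l].
  by rewrite rev_cat !rev_cons -!cats1 -!catA.
rewrite !E -!catA /= -iterS row_vert_cross // IH //.
pose l2 := l ++ [:: y, x & r ++ w :: rev r].
have El z1 z2 : l ++ [:: y, x & r ++ w :: rev r ++ [:: z1, z2 & rev l]] =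
    l2 ++ [:: z1, z2 & rev l] by rewrite /l2 -!catA /= -!catA.
have -> : (size l + (size r).*2 + 3 = size l2)%N.
  by rewrite size_cat /= size_cat /= size_rev -addnn; lia.
by rewrite -iterS !El -row_vert_cross.
Qed.

Lemma iter_lft_R0_false i y f n : (i + 2 <= n)%N ->
  iter i lft (R0 y) f (nseq n false) = weight_a q y * f (nseq n false).
Proof.
elim: i n f => [|i IH] [|n] f //=; first by case: n.
by rewrite addSn ltnS => ?; rewrite IH.
Qed.

(** On the all-zero boundary word the crossing is the same scalar [weight_a q (x / y)] at either
    position. *)
Lemma Z_swap (l : seq F) (x y : F) (r : seq F) (w : F) :
  all (predC1 0) (w :: x :: y :: l ++ r) ->
  weight_a q (x / y) != 0 ->
  partition_fun (l ++ [:: x, y & r]) w = partition_fun (l ++ [:: y, x & r]) w.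
Proof.
move=> nz wa0; apply: (mulfI wa0); rewrite /partition_fun.
have E z1 z2 : (size (l ++ [:: z1, z2 & r])).*2.+1 = ((size l + size r).*2 + 5)%N.
  by rewrite size_cat /= -addnn; lia.
rewrite !E -(@iter_lft_R0_false (size l)); last lia.
rewrite part_exchange // iter_lft_R0_false //; lia.
Qed.

Fixpoint cross (u : F) (vs : seq F) : op :=
  if vs is v :: vs' then lft (cross u vs') \o R0 (u / v) else id.

Lemma lin_cross u vs : linop (cross u vs).
Proof.
elim: vs => // v vs IH; apply: lin_comp; last exact: lin_R0.
exact: lin_lft.
Qed.

Lemma cross_rcons u vs x f :
  cross u (rcons vs x) f = iter (size vs) lft (R0 (u / x)) (cross u vs f).
Proof.
elim: vs f => [|v vs IH] f /=; first by rewrite lft_id.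
rewrite -lft_comp; congr (lft _ _).
by apply: functional_extensionality => g; apply: IH.
Qed.

Lemma turn_cross x u rs f : x != 0 -> u != 0 -> all (predC1 0) rs ->
  turn x (rcons rs u) (lft (cross u rs) f) = cross u rs (turn x (u :: rs) f).
Proof.
move=> x0 u0; elim: rs f => [|v rs IH] f; first by rewrite /= lft_id.
case/andP=> v0 rs0 /=; rewrite lft_lft_R0 R0_far; last exact: lin_cross.
rewrite -(lft_comp (turn x (rcons rs u))).
have -> : (turn x (rcons rs u) \o lft (cross u rs)) =
          cross u rs \o turn x (u :: rs).
  by apply: functional_extensionality => g; apply: IH.
rewrite (lft_comp (cross u rs)) /= !lft_lft_R0 -vert_cross // R0_far //.
exact: lin_turn.
Qed.

Lemma row_split x l r f : row x (l ++ r) f =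
  iter (size l).+1 lft (turn x r) (lft (pass x l) (cup x f)).
Proof.
rewrite /row /= -lft_comp; congr (lft _ _).
by apply: functional_extensionality => g; apply: turn_cat.
Qed.

Lemma pass_cup_far x l A f : linop A ->
  lft (pass x l) (cup x (iter (size l) lft A f)) =
  iter (size l).+2 lft A (lft (pass x l) (cup x f)).
Proof.
move=> lA; rewrite -cup_far; last exact: lin_iter.
move: (cup x f) => g.
rewrite -[lft (lft _) g]/(lft (iter (size l).+1 lft A) g) -lft_comp.
rewrite [in RHS]iterS -lft_comp; congr (lft _ _).
by apply: functional_extensionality => h; apply: pass_far.
Qed.

(* At this value of [w] the line of [u] can be moved across all the rows. *)
Lemma drag_central u us : u != 0 -> all (predC1 0) us ->
  iter (size us) lft (turn u (rev us)) (part us (q ^+ 2 / u)) =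
  fun s => (1 + boundary_weight q u^-1) *
    iter (size us) lft (cross u (rev us)) (part us u) s.
Proof.
move=> u0; elim: us => [_|x us IH] /=.
  by apply: functional_extensionality => -[|b s] /=; ring.
case/andP=> x0 us0; have rs0 : all (predC1 0) (rev us) by rewrite all_rev.
rewrite rev_cons !row_split.
(* At this [w] the central column meets the row of [x] with the parameter of a crossing of two rows,
   so [turn_horiz_cross] exchanges the turns of [x] and [u]. *)
have Evtx : vertex_param x (q ^+ 2 / u) = u / x.
  by rewrite /vertex_param; field; rewrite ?x0 ?u0 ?q0 ?expf_neq0.
set rs := rev us in rs0 IH *; set m := size us in IH *.
have mE : size rs = m by rewrite size_rev.
have -> : lft (iter m lft (turn u (rcons rs x))) = iter m.+1 lft (turn u (rcons rs x)) by [].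
rewrite -iter_lft_comp.
have -> : turn u (rcons rs x) \o turn x (q ^+ 2 / u :: rs) =
   (iter m lft (R0 (u / x)) \o turn x (rcons rs u)) \o lft (turn u rs).
  by apply: functional_extensionality => g; rewrite /= Evtx turn_horiz_cross // mE.
rewrite iter_lft_comp -iterSr -pass_cup_far; last exact: lin_turn.
rewrite IH //.
rewrite (linZ _ _ (lin_cup x)) (linZ _ _ (lin_lft (@lin_pass x us))).
rewrite (linZ _ _ (lin_iter _ _)); last first.
  by apply: lin_comp; [apply/lin_iter/lin_R0 | apply: lin_turn].
apply: functional_extensionality => s; congr (_ * _); move: s; apply: equal_f.
rewrite pass_cup_far; last exact: lin_cross.
rewrite -/m (iterSr m.+1) -iter_lft_comp.
have -> : lft (iter m lft (cross u (rcons rs x))) = iter m.+1 lft (cross u (rcons rs x)) by [].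
rewrite -iter_lft_comp; congr (iter _ _ _ _).
apply: functional_extensionality => g.
by rewrite /= turn_cross // cross_rcons mE.
Qed.

End Operators.

(** * Evaluations of the partition function *)

Section TopRow.
Variables (F : fieldType) (q : F).
Local Notation wa := (weight_a q).
Local Notation wb := (weight_b q).
Local Notation kb := (boundary_weight q).
Local Notation vtx := (vertex_param q).
Local Notation Z := (partition_fun q).
Local Notation part := (part q).
Local Notation state := (state F).
Local Notation zeros n := (nseq n false).

Definition prod_a u vs := \prod_(v <- vs) wa (vtx u v).
Definition prod_b u vs := \prod_(v <- vs) wb (vtx u v).

(* The contributions to a horizontal pass below an empty row of edges in which
   the path leaves the line strictly before its left end. *)
Fixpoint drop_sum (u : F) (vs : seq F) (f : state) : F :=
  if vs is v :: vs' then
    prod_b u vs' * f (true :: zeros (size vs')) +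
    wa (vtx u v) * drop_sum u vs' (fun t => f (false :: t))
  else 0.

Lemma drop_sumZ u vs c f :
  drop_sum u vs (fun t => c * f t) = c * drop_sum u vs f.
Proof.
elim: vs f => [|v vs IH] f /=; first by rewrite mulr0.
by rewrite (IH (fun t => f (false :: t))); ring.
Qed.

Lemma pass_false u vs f :
  pass q u vs f (zeros (size vs).+1) = prod_a u vs * f (zeros (size vs).+1).
Proof.
elim: vs f => [|v vs IH] f /=; first by rewrite /prod_a big_nil mul1r.
by rewrite /= IH /prod_a big_cons /=; ring.
Qed.

Lemma pass_true u vs f :
  pass q u vs f (rcons (zeros (size vs)) true) =
  prod_b u vs * f (true :: zeros (size vs)) +
  drop_sum u vs (fun t => f (false :: t)).
Proof.
elim: vs f => [|v vs IH] f /=; first by rewrite /prod_b big_nil mul1r addr0.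
rewrite /= IH /= drop_sumZ /prod_b big_cons; ring.
Qed.

Lemma turnE u vs f : turn q u vs f = iter (size vs) lft (turn_op q u) (pass q u vs f).
Proof. by have := turn_cat q u vs [::] f; rewrite cats0. Qed.

Lemma iter_lft_catl n A (f : state) s : size s = n ->
  forall t, iter n lft A f (s ++ t) = A (fun t' => f (s ++ t')) t.
Proof. by elim: s n f => [|a s IH] [|n] f //= [sn] t; rewrite IH. Qed.

Lemma turn_false u vs f : turn q u vs f (zeros (size vs).+1) =
  prod_a u vs * f (zeros (size vs).+1) +
  kb u^-1 * (prod_b u vs * f (true :: zeros (size vs)) +
             drop_sum u vs (fun t => f (false :: t))).
Proof.
rewrite turnE -pass_true -pass_false.
have -> : zeros (size vs).+1 = zeros (size vs) ++ [:: false].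
  by rewrite cats1 -nseqS_rcons || rewrite -addn1 nseqD.
by rewrite -cats1 iter_lft_catl ?size_nseq.
Qed.

(** If the bit is kept at the turn, all vertices have weight a and the corner weighs [kb u]. If it
    is flipped, the path either follows the line to the corner, with weights b, or drops out in a
    column, and then both boundary weights occur. *)
Lemma Z_cons u us w : let vs := us ++ w :: rev us in
  Z (u :: us) w = (kb u * prod_a u vs + kb u^-1 * prod_b u vs) * Z us w +
     kb u * kb u^-1 * drop_sum u vs (part us w).
Proof.
move=> vs; have sz : size vs = (size us).*2.+1.
  by rewrite size_cat /= size_rev addnS addnn.
rewrite /Z [part _ _]/= [size (u :: us)]/= doubleS -/vs -sz.
rewrite /row /= (turn_false u vs) /= drop_sumZ; ring.
Qed.

Hypotheses (q0 : q != 0) (q21 : q ^+ 2 != 1) (q81 : q ^+ 8 != 1).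

Lemma wa1 : wa 1 = 1.
Proof. by rewrite /wa divr1 divff // sgq4_neq0. Qed.
Lemma wb1 : wb 1 = 0.
Proof. by rewrite /wb /sg invr1 subrr mul0r. Qed.
Lemma waq4 : wa (q ^+ 4) = 0.
Proof. by rewrite /wa divff ?expf_neq0 // /sg invr1 subrr mul0r. Qed.
Lemma wbq4 : wb (q ^+ 4) = 1.
Proof. by rewrite /wb divff // sgq4_neq0. Qed.

Lemma pa_cons u v vs : prod_a u (v :: vs) = wa (vtx u v) * prod_a u vs.
Proof. exact: big_cons. Qed.
Lemma pb_cons u v vs : prod_b u (v :: vs) = wb (vtx u v) * prod_b u vs.
Proof. exact: big_cons. Qed.
Lemma pa_rcons u v vs : prod_a u (rcons vs v) = wa (vtx u v) * prod_a u vs.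
Proof. by rewrite /prod_a -cats1 big_cat big_seq1 mulrC. Qed.
Lemma pb_rcons u v vs : prod_b u (rcons vs v) = wb (vtx u v) * prod_b u vs.
Proof. by rewrite /prod_b -cats1 big_cat big_seq1 mulrC. Qed.
Lemma pa_cat u l r : prod_a u (l ++ r) = prod_a u l * prod_a u r.
Proof. exact: big_cat. Qed.
Lemma pb_cat u l r : prod_b u (l ++ r) = prod_b u l * prod_b u r.
Proof. exact: big_cat. Qed.
Lemma pa_rev u l : prod_a u (rev l) = prod_a u l.
Proof. by apply: perm_big; rewrite perm_rev. Qed.

Lemma Z_kb0 u us w : kb u = 0 ->
  Z (u :: us) w = kb u^-1 * prod_b u (us ++ w :: rev us) * Z us w.
Proof. by move=> k0; rewrite Z_cons k0; ring. Qed.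

Lemma Z_kbV0 u us w : kb u^-1 = 0 ->
  Z (u :: us) w = kb u * prod_a u (us ++ w :: rev us) * Z us w.
Proof. by move=> k0; rewrite Z_cons k0; ring. Qed.

Lemma drop_sum_rcons u vs v f : wb (vtx u v) = 0 ->
  drop_sum u (rcons vs v) f = prod_a u vs * f (rcons (zeros (size vs)) true).
Proof.
move=> v0; elim: vs f => [|v' vs IH] f /=.
  by rewrite /prod_b /prod_a !big_nil; ring.
by rewrite IH pa_cons pb_rcons v0; ring.
Qed.

Lemma drop_sum_cat u l r f : prod_b u r = 0 ->
  drop_sum u (l ++ r) f =
  prod_a u l * drop_sum u r (fun t => f (zeros (size l) ++ t)).
Proof.
move=> r0; elim: l f => [|v l IH] f /=; first by rewrite /prod_a big_nil mul1r.
by rewrite IH pb_cat r0 pa_cons; ring.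
Qed.

Lemma kb_q2 u : u != 0 -> kb (q ^+ 2 / u)^-1 = - kb u^-1.
Proof. move=> u0; rewrite /kb /sg; field; by rewrite u0 q0 -expr2 subr_eq0 q21. Qed.

Lemma kb_q2V u : u != 0 -> kb (u * q ^+ 2)^-1 = - kb u.
Proof. move=> u0; rewrite /kb /sg; field; by rewrite u0 q0 -expr2 subr_eq0 q21 oner_eq0. Qed.

(** The vertices of [u] and [v] are identities, so a path of the first row can drop only in the last
    column. Hence the row of [v] is needed for both bits at its turn. Since [kb v^-1 = - kb u^-1],
    the terms in which a path enters that row cancel, and the one with weights a remains. *)
Lemma Z_pair u us w : u != 0 ->
  let v := q ^+ 2 / u in let vs := us ++ w :: rev us in
  Z [:: u, v & us] w =
  kb u * kb v * (1 - kb u^-1 ^+ 2) * prod_a u vs * prod_a v vs * Z us w.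
Proof.
move=> u0 v vs; have vtx1 : vtx u v = 1.
  by rewrite /vtx /v; field; rewrite u0 q0.
rewrite Z_cons; cbv zeta; rewrite rev_cons -rcons_cons -rcons_cat -/vs [(v :: us) ++ _]/=.
rewrite -/vs pa_rcons pb_rcons pa_cons pb_cons vtx1 wa1 wb1.
rewrite drop_sum_rcons ?vtx1 ?wb1 // pa_cons vtx1 wa1.
set f := part _ _.
have sz : size vs = (size us).*2.+1.
  by rewrite size_cat /= size_rev addnS addnn.
have fE c : f (rcons (zeros (size vs).+1) c) =
    (if c then kb v^-1 else 1) *
      pass q v vs (fun t => corner_op q v (part us w) (false :: t)) (zeros (size vs).+1) +
    (if c then 1 else kb v^-1) *
      pass q v vs (fun t => corner_op q v (part us w) (false :: t)) (rcons (zeros (size vs)) true).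
  rewrite /f /= /row -/vs /= turnE -!cats1 iter_lft_catl ?size_nseq //=.
  have -> : false :: zeros (size vs) = zeros (size vs) ++ [:: false].
    by rewrite -[[:: false]]/(zeros 1) -nseqD addn1.
  by case: c => /=; ring.
rewrite [Z _ _](_ : _ = f (rcons (zeros (size vs).+1) false)); last first.
  rewrite /Z -/f; congr (f _); rewrite [size _]/= doubleS -sz.
  by rewrite -cats1 -[[:: false]]/(zeros 1) -nseqD addn1.
rewrite /= -![false :: rcons _ _]/(rcons (zeros (size vs).+1) _) !fE kb_q2 // pass_false /=.
by rewrite /Z -sz; ring.
Qed.

(** Counterpart of [Z_pair]: weight a now vanishes at the vertices of [u] and [v], so a path must
    reach the first column, and [kb v = - kb u] cancels all terms but the one with weights b. *)
Lemma Z_pairV u us w : u != 0 ->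
  let v := (u * q ^+ 2)^-1 in let vs := us ++ w :: rev us in
  Z [:: u, v & us] w =
  kb u^-1 * kb v^-1 * (1 - kb u ^+ 2) * prod_b u vs * prod_b v vs * Z us w.
Proof.
move=> u0 v vs; have vtx1 : vtx u v = q ^+ 4.
  by rewrite /vtx /v; field; rewrite u0 q0 oner_eq0.
rewrite Z_cons; cbv zeta; rewrite rev_cons -rcons_cons -rcons_cat -/vs [(v :: us) ++ _]/=.
rewrite -/vs pa_rcons pb_rcons pa_cons pb_cons vtx1 waq4 wbq4.
set f := part (v :: us) w.
rewrite [drop_sum _ _ _]/= vtx1 waq4 pb_rcons vtx1 wbq4.
have sz : size vs = (size us).*2.+1.
  by rewrite size_cat /= size_rev addnS addnn.
have kv : kb v = - kb u by exact: kb_q2V.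
have fE c : f (c :: zeros (size vs).+1) =
   turn q v vs (fun t => corner_op q v (part us w) (c :: t)) (zeros (size vs).+1).
  by [].
rewrite [Z _ _](_ : _ = f (false :: zeros (size vs).+1)); last first.
  by rewrite /Z -/f; congr (f _); rewrite [size _]/= doubleS -sz.
rewrite size_rcons !fE !turn_false /= !drop_sumZ kv mul1r.
by rewrite /Z -sz; ring.
Qed.

Lemma cross_false (u : F) us (f : state) :
  cross q u us f (zeros (size us).+1) =
  \prod_(v <- us) wa (u / v) * f (zeros (size us).+1).
Proof.
elim: us f => [|v us IH] f /=; first by rewrite big_nil mul1r.
by rewrite /= IH big_cons /=; ring.
Qed.

(** The central vertex of the first row is the identity, so no path continues along the row past the
    center. The right half of the row is then the turn in [drag_central], and the line of [u] takes
    over the role of the central column. *)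
Lemma Z_drag u us : u != 0 -> all (predC1 0) us ->
  Z (u :: us) (q ^+ 2 / u) =
  kb u * (1 + kb u^-1) * prod_a u us * \prod_(v <- us) wa (u / v) * Z us u.
Proof.
move=> u0 us0; set w := q ^+ 2 / u; have vtx1 : vtx u w = 1.
  by rewrite /vtx /w; field; rewrite u0 q0.
have pw0 : prod_b u (w :: rev us) = 0 by rewrite pb_cons vtx1 wb1 mul0r.
rewrite Z_cons; cbv zeta; rewrite pb_cat pw0 pa_cat pa_cons vtx1 wa1 pa_rev drop_sum_cat //=.
rewrite vtx1 wa1 size_rev.
have /(congr1 (@^~ (zeros (size us).*2.+1))) := drag_central q0 q21 q81 u0 us0.
rewrite /Z; have -> : zeros (size us).*2.+1 = zeros (size us) ++ zeros (size us).+1.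
  by rewrite -nseqD addnS addnn.
rewrite !iter_lft_catl ?size_nseq //.
have -> : zeros (size us).+1 = zeros (size (rev us)).+1 by rewrite size_rev.
rewrite cross_false turn_false size_rev pa_rev.
have -> : \prod_(v <- rev us) wa (u / v) = \prod_(v <- us) wa (u / v).
  by apply: perm_big; rewrite perm_rev.
rewrite -/w; set L := (X in X = _) => H.
transitivity (kb u * prod_a u us * L); first by rewrite /L; ring.
by rewrite H; ring.
Qed.
End TopRow.

(** * Alternants and Schur functions *)

Section Alternants.
Variable F : fieldType.

Definition alternant_mx (e : nat -> nat) (y : seq F) n : 'M[F]_n :=
  \matrix_(i, j) y`_i ^+ e j.
Definition alternant e y : F := \det (alternant_mx e y (size y)).

(** One sign serves all exponents [e], so it cancels in the quotient [schur]. *)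
Lemma alternant_perm (y y' : seq F) : perm_eq y y' ->
  exists b : bool, forall e, alternant e y = (-1) ^+ b * alternant e y'.
Proof.
move=> pyy; have sz := perm_size pyy.
have /tuple_permP[p def_y] : perm_eq y (in_tuple y') by [].
exists (odd_perm p) => e; rewrite /alternant sz -det_perm -det_mulmx -row_permE.
congr (\det _); apply/matrixP => i j; rewrite !mxE; congr (_ ^+ _).
by rewrite [in LHS]def_y (nth_map i) ?size_enum_ord // nth_ord_enum (tnth_nth 0).
Qed.

(* Subtract [b] times column [j] from column [k + j]. *)
Lemma alternant_head (k c : nat) (b : F) e (h r : seq F) :
  (0 < k)%N -> size h = k ->
  (forall j, e (k + j)%N = (e j + c)%N) -> all (fun x => x ^+ c == b) h ->
  alternant e (h ++ r) =
  alternant e h * (\prod_(x <- r) (x ^+ c - b)) * alternant e r.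
Proof.
move=> k0 szh ek hb; rewrite /alternant size_cat szh.
set n := size r; set M := alternant_mx e (h ++ r) (k + n).
pose U : 'M[F]_(k + n) := \matrix_(i, j) ((i == j)%:R - b * (i + k == j)%N%:R).
have detU : \det U = 1.
  rewrite -det_tr det_trig; last first.
    apply/is_trig_mxP => i j lt_ij; rewrite !mxE.
    rewrite -val_eqE /= gtn_eqF // sub0r; case: eqP => [E|]; last by rewrite mulr0 oppr0.
    by move: lt_ij; rewrite -E; lia.
  by rewrite big1 // => i _; rewrite !mxE eqxx; case: eqP => [|_]; [lia | rewrite mulr0 subr0].
have MUE i j : (M *m U) i j =
    M i j - b * \sum_(l < k + n) M i l * (l + k == j)%N%:R.
  rewrite mxE mulr_sumr -[M i j](_ : \sum_l M i l * (l == j)%:R = _); last first.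
    by rewrite (bigD1 j) //= eqxx mulr1 big1 ?addr0 // => l /negPf->; rewrite mulr0.
  by rewrite -sumrB; apply: eq_bigr => l _; rewrite [U _ _]mxE mulrBr [b * (_ * _)]mulrCA.
transitivity (\det (M *m U)); first by rewrite det_mulmx detU mulr1.
have -> : M *m U = block_mx (alternant_mx e h k) 0
    (\matrix_(i, j) r`_i ^+ e j)
    (diag_mx (\row_i (r`_i ^+ c - b)) *m alternant_mx e r n).
  apply/matrixP => i j; rewrite MUE.
  have -> : \sum_(l < k + n) M i l * (l + k == j)%N%:R =
      if (k <= j)%N then (h ++ r)`_i ^+ e (j - k)%N else 0.
    case: leqP => kj; last first.
      by apply: big1 => l _; case: eqP => [|_]; [lia | rewrite mulr0].
    have lj : (j - k < k + n)%N by have := ltn_ord j; lia.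
    rewrite (bigD1 (Ordinal lj)) //= subnK // eqxx mulr1 mxE big1 ?addr0 // => l.
    rewrite -val_eqE /= => /eqP nl; case: eqP => [|_]; [lia | by rewrite mulr0].
  rewrite mxE; case: (splitP j) => j' Ej.
    have -> : j = lshift n j' by apply: val_inj.
    rewrite /= leqNgt ltn_ord mulr0 subr0.
    case: (splitP i) => i' Ei.
      have -> : i = lshift n i' by apply: val_inj.
      by rewrite block_mxEul mxE /= nth_cat szh ltn_ord.
    have -> : i = rshift k i' by apply: val_inj.
    by rewrite block_mxEdl mxE /= nth_cat szh ltnNge leq_addr /= addKn.
  have -> : j = rshift k j' by apply: val_inj.
  rewrite /= leq_addr addKn ek exprD.
  case: (splitP i) => i' Ei.
    have -> : i = lshift n i' by apply: val_inj.
    rewrite block_mxEur mxE /= nth_cat szh ltn_ord.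
    have /(allP hb)/eqP -> : h`_i' \in h by rewrite mem_nth ?szh.
    by rewrite mulrC subrr.
  have -> : i = rshift k i' by apply: val_inj.
  rewrite block_mxEdr mul_diag_mx !mxE /= nth_cat szh ltnNge leq_addr /= addKn.
  by ring.
rewrite det_lblock det_mulmx det_diag mulrA; congr (_ * _ * _).
rewrite [RHS](big_nth 0) big_mkord; apply: eq_bigr => i _; by rewrite mxE.
Qed.
End Alternants.

(** * Schur functions: the wheel relation and a degree bound *)

Section Schur.
Variable F : fieldType.
Implicit Types (y r : seq F).

(* The exponents 0, 1, 3, 4, 6, ...: for [2 n + 1] variables, [schur] is the Schur
   function of the partition (n, n - 1, n - 1, ..., 1, 1). *)
Definition expo j := ((3 * j)./2)%N.
Definition vander y := alternant id y.
Definition schur y := alternant expo y / vander y.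

Lemma alternant1 e (a : F) : e 0%N = 0%N -> alternant e [:: a] = 1.
Proof. by move=> e0; rewrite /alternant det_mx11 mxE /= e0. Qed.

Lemma vander_cons a r : vander (a :: r) = \prod_(x <- r) (x - a) * vander r.
Proof.
rewrite /vander -cat1s (@alternant_head _ 1 1 a) ?alternant1 ?mul1r //.
- by move=> j; rewrite addn1 add1n.
- by rewrite /= expr1 eqxx.
Qed.

Lemma vander_neq0 y : uniq y -> vander y != 0.
Proof.
elim: y => [|a r IH]; first by rewrite /vander /alternant det_mx00 oner_eq0.
case/andP=> ar /IH ur; rewrite vander_cons mulf_neq0 // prodf_seq_neq0.
by apply/allP=> x xr /=; rewrite subr_eq0; apply: contraNneq ar => <-.
Qed.

Lemma schur_perm y y' : perm_eq y y' -> schur y = schur y'.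
Proof.
move=> /alternant_perm[b E]; rewrite /schur /vander !E.
by rewrite invfM mulrACA divff ?mul1r // signr_eq0.
Qed.

Lemma schur1 (a : F) : schur [:: a] = 1.
Proof. by rewrite /schur /vander !alternant1 // divr1. Qed.

(** Since [expo (j + 2) = expo j + 3] and the two arguments have equal cubes, [alternant_head]
    splits the numerator with the factors [x ^+ 3 - a ^+ 3]; the Vandermonde determinant cancels two
    of the three linear factors of each. *)
Lemma schur_wheel (om a : F) r : om ^+ 2 + om + 1 = 0 ->
  uniq [:: a, om * a & r] ->
  schur [:: a, om * a & r] = \prod_(x <- r) (x - om ^+ 2 * a) * schur r.
Proof.
move=> hom u; have := vander_neq0 u.
rewrite /schur /vander -[[:: a, om * a & r]]/([:: a; om * a] ++ r).
have om3 : om ^+ 3 = 1.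
  by have -> : om ^+ 3 = (om - 1) * (om ^+ 2 + om + 1) + 1; [ring | rewrite hom mulr0 add0r].
rewrite (@alternant_head _ 2 3 (a ^+ 3) expo) //; last 2 first.
- by move=> j; rewrite /expo; lia.
- by rewrite /= exprMn om3 mul1r eqxx.
rewrite -/(vander _) /= !vander_cons.
have -> : alternant expo [:: a; om * a] = vander [:: a; om * a].
  rewrite /vander /alternant /=; congr (\det _); apply/matrixP => i j.
  by rewrite !mxE; congr (_ ^+ _); case: j => -[|[]].
rewrite !vander_cons !big_cons big_nil [vander [::]](_ : _ = 1); last first.
  by rewrite /vander /alternant det_mx00.
have -> : \prod_(x <- r) (x ^+ 3 - a ^+ 3) = \prod_(x <- r) (x - a) *
    \prod_(x <- r) (x - om * a) * \prod_(x <- r) (x - om ^+ 2 * a).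
  rewrite -!big_split /=; apply: eq_bigr => x _.
  have -> : (x - a) * (x - om * a) * (x - om ^+ 2 * a) =
    x ^+ 3 - om ^+ 3 * a ^+ 3 - (om ^+ 2 + om + 1) * (a * x^+2 - om * a ^+ 2 * x).
    by ring.
  by rewrite hom om3; ring.
rewrite !big_nil -/(vander r) !mulf_eq0 !negb_or => /and3P[/andP[n1 n2] n3 n4].
by field; rewrite n1 n2 n3 n4.
Qed.

Lemma alternant_cons e x r : alternant e (x :: r) =
  \sum_(j < (size r).+1) x ^+ e j * ((-1) ^+ j * alternant (e \o bump j) r).
Proof.
rewrite /alternant (expand_det_row _ ord0); apply: eq_bigr => j _.
rewrite mxE; congr (_ * (_ * \det _)).
by apply/matrixP => i k; rewrite !mxE lift0.
Qed.

Lemma alternant_poly e r M : (forall j, (j <= size r)%N -> (e j < M)%N) ->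
  exists2 p : {poly F}, (size p <= M)%N &
    forall x, alternant e (x :: r) = p.[x].
Proof.
move=> eM; exists (\sum_(j < (size r).+1)
    ((-1) ^+ j * alternant (e \o bump j) r) *: 'X^(e j)).
  apply: (leq_trans (size_sum _ _ _)); apply/bigmax_leqP => j _.
  by rewrite (leq_trans (size_scale_leq _ _)) // size_polyXn eM // -ltnS.
move=> x; rewrite alternant_cons horner_sum; apply: eq_bigr => j _.
by rewrite hornerZ hornerXn mulrC.
Qed.

Lemma alternant_mem e x r : x \in r -> alternant e (x :: r) = 0.
Proof.
move=> xr; have ir : ((index x r).+1 < (size r).+1)%N by rewrite ltnS index_mem.
rewrite /alternant (@determinant_alternate _ _ _ ord0 (Ordinal ir)) //.
by move=> j; rewrite !mxE /= nth_index.
Qed.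

Lemma divp_sum (I : finType) (c : I -> F) (p : I -> {poly F}) (d : {poly F}) :
  (\sum_i c i *: p i) %/ d = \sum_i c i *: (p i %/ d).
Proof.
rewrite (big_morph (fun p => p %/ d) (divpD d) (div0p d)).
by apply: eq_bigr => i _; rewrite divpZl.
Qed.

Lemma roots_div (p : {poly F}) r : uniq r -> all (root p) r ->
  p = (p %/ \prod_(t <- r) ('X - t%:P)) * \prod_(t <- r) ('X - t%:P).
Proof.
move=> ur rp; rewrite divpK //; apply: uniq_roots_dvdp => //.
by rewrite uniq_rootsE.
Qed.

Lemma horner_prodX r x :
  (\prod_(t <- r) ('X - t%:P)).[x] = \prod_(t <- r) (x - t).
Proof. by rewrite horner_prod; apply: eq_bigr => t _; rewrite hornerXsubC. Qed.

(* The alternant vanishes when [x] or [y] is in [r], so both Vandermonde factors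
   can be divided out while the degrees in [x] and [y] are kept under control. *)
Lemma alternant_factor2 e r M : uniq r ->
  (forall j, (j < (size r).+2)%N -> (e j < M)%N) ->
  exists d g : 'I_(size r).+2 -> {poly F},
  [/\ forall j, (size (d j) <= M - size r)%N,
      forall j, (size (g j) <= M - size r)%N
    & forall (x y : F), x \notin r -> alternant e [:: x, y & r] =
     \prod_(t <- r) (x - t) * \prod_(t <- r) (y - t) *
     \sum_j (d j).[x] * (g j).[y]].
Proof.
move=> ur eM; set n := size r; set R := \prod_(t <- r) ('X - t%:P).
have szR : size R = n.+1 by rewrite size_prod_XsubC.
have R0 : R != 0 by rewrite -size_poly_gt0 szR.
have szdiv (p : {poly F}) : (size p <= M)%N -> (size (p %/ R)%R <= M - n)%N.
  by move=> sp; rewrite size_divp // szR leq_sub2r.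
have H (j : 'I_n.+2) : exists p : {poly F}, (size p <= M)%N /\
    forall y : F, (-1) ^+ j * alternant (e \o bump j) (y :: r) = p.[y].
  have [|p sp pE] := @alternant_poly (e \o bump j) r M.
    by move=> k kn; apply: eM; rewrite /= /bump; case: leqP => /=; lia.
  exists ((-1) ^+ j *: p); split=> [|y].
    by rewrite (leq_trans (size_scale_leq _ _)).
  by rewrite hornerZ -pE.
have [p pE] := fin_all_exists H.
have AE (x y : F) : alternant e [:: x, y & r] = \sum_(j < n.+2) x ^+ e j * (p j).[y].
  by rewrite alternant_cons; apply: eq_bigr => j _; rewrite (pE j).2.
have AE1 (x y : F) : alternant e [:: x, y & r] =
    R.[x] * \sum_(j < n.+2) ('X^(e j) %/ R).[x] * (p j).[y].
  pose P := \sum_(j < n.+2) (p j).[y] *: 'X^(e j).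
  have PE z : P.[z] = alternant e [:: z, y & r].
    rewrite AE horner_sum; apply: eq_bigr => j _.
    by rewrite hornerZ hornerXn mulrC.
  have /(roots_div ur) : all (root P) r.
    by apply/allP=> t tr; rewrite rootE PE alternant_mem // inE tr orbT.
  rewrite -/R divp_sum -PE => /(congr1 (fun p => p.[x])) ->.
  rewrite hornerM mulrC horner_sum; congr (_ * _).
  by apply: eq_bigr => j _; rewrite hornerZ mulrC.
exists (fun j => 'X^(e j) %/ R), (fun j => p j %/ R); split=> [j|j|x y xr].
- by apply: szdiv; rewrite size_polyXn eM.
- by apply: szdiv; case: (pE j).
have Rx : R.[x] != 0 by rewrite -rootE root_prod_XsubC.
pose B := \sum_(j < n.+2) ('X^(e j) %/ R).[x] *: p j.
have BE z : R.[x] * B.[z] = alternant e [:: x, z & r].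
  rewrite AE1 horner_sum; congr (_ * _).
  by apply: eq_bigr => j _; rewrite hornerZ.
have /(roots_div ur) : all (root B) r.
  apply/allP=> t tr; rewrite rootE -(inj_eq (mulfI Rx)) mulr0 BE.
  have [b E] := @alternant_perm _ [:: x, t & r] [:: t, x & r] (permEl (perm_catCA [:: x] [:: t] r)).
  by rewrite E alternant_mem ?mulr0 // inE tr orbT.
rewrite -/R divp_sum -BE => /(congr1 (fun p => p.[y])) ->.
rewrite hornerM -!horner_prodX -/R -mulrA [_ * R.[y]]mulrC; congr (_ * (_ * _)).
by rewrite horner_sum; apply: eq_bigr => j _; rewrite hornerZ.
Qed.

Lemma reciprocal_poly (g : {poly F}) k : (size g <= k.+1)%N ->
  exists2 h : {poly F}, (size h <= k.+1)%N &
    forall x, x != 0 -> h.[x] = x ^+ k * g.[x^-1].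
Proof.
move=> sg; exists (\poly_(i < k.+1) g`_(k - i)); first exact: size_poly.
move=> x x0; rewrite horner_poly (horner_coef_wide _ sg) mulr_sumr.
rewrite (reindex_inj rev_ord_inj); apply: eq_bigr => i _ /=.
have ik : (i <= k)%N by rewrite -ltnS.
rewrite subSS subKn // mulrCA; congr (_ * _).
by rewrite -[in X in _ = X * _](subnK ik) exprD exprVn mulfK ?expf_neq0.
Qed.

(** The numerator has degree at most 3 m + 3 in each variable, of which the factors for [r] take 2 m
    + 1. At [x] and [x^-1], exponents from - (m + 2) to m + 2 remain. The cofactor vanishes at 1 and
    -1, because the alternant does and these are not in [r]; dividing by the Vandermonde factor of
    the pair leaves m + 1. *)
Lemma schur_laurent r m : uniq r -> size r = m.*2.+1 -> 1 \notin r ->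
  -1 \notin r -> 2%:R != 0 :> F ->
  exists2 Q : {poly F}, (size Q <= m.+1.*2.+1)%N &
    forall x, x != 0 -> uniq [:: x, x^-1 & r] ->
    schur [:: x, x^-1 & r] * x ^+ m.+1 = Q.[x].
Proof.
move=> ur sr r1 rN1 two0.
have [|d [g [sd sgj AE]]] := @alternant_factor2 expo r (3 * m + 4) ur.
  by rewrite sr /expo => j; lia.
have E3 : (3 * m + 4 - size r = m.+2.+1)%N by rewrite sr -addnn; lia.
rewrite {}E3 in sd sgj.
have [h hE] : exists h : 'I_(size r).+2 -> {poly F}, forall j,
    (size (h j) <= m.+3)%N /\ forall x, x != 0 -> (h j).[x] = x ^+ m.+2 * (g j).[x^-1].
  by apply: (fin_all_exists (P := fun j (h : {poly F}) => (size h <= m.+3)%N /\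
    forall x, x != 0 -> h.[x] = x ^+ m.+2 * (g j).[x^-1])) => j;
    have [h] := reciprocal_poly (sgj j); exists h.
pose P := \sum_j d j * h j.
have sP : (size P <= m.+1.*2.+3)%N.
  apply: (leq_trans (size_sum _ _ _)); apply/bigmax_leqP => j _.
  rewrite (leq_trans (size_polyMleq _ _)) //.
  have := sd j; have := (hE j).1; rewrite -addnn; lia.
have PE x : x != 0 -> P.[x] = x ^+ m.+2 * \sum_j (d j).[x] * (g j).[x^-1].
  move=> x0; rewrite horner_sum mulr_sumr; apply: eq_bigr => j _.
  by rewrite hornerM (hE j).2 //; ring.
have Proot x : x \notin r -> x^-1 = x -> x != 0 -> P.[x] = 0.
  move=> xr xx x0; have := AE x x xr; rewrite alternant_mem ?mem_head //.
  move/esym/eqP; rewrite PE // xx mulf_eq0 => /orP[|/eqP->]; last by rewrite mulr0.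
  rewrite -horner_prodX mulf_eq0 orbb -rootE root_prod_XsubC.
  by rewrite (negPf xr).
have N1 : (-1 : F) != 1 by rewrite -subr_eq0 -opprD oppr_eq0 -[1 + 1]/(2%:R).
have /(roots_div (r := [:: 1; -1])) PD : all (root P) [:: 1; -1].
  by rewrite /= !rootE !Proot ?eqxx ?invr1 ?invrN1 ?oppr_eq0 ?oner_eq0.
move: PD; rewrite /= !inE eq_sym N1 => /(_ isT).
rewrite !big_cons big_nil mulr1; set D := ('X - 1%:P) * ('X - (-1)%:P).
have sD : size D = 3%N.
  by rewrite /D size_mul ?polyXsubC_eq0 // !size_XsubC.
move=> PD; exists (- (vander r)^-1 *: (P %/ D)).
  rewrite (leq_trans (size_scale_leq _ _)) // size_divp -?size_poly_gt0 sD //.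
  by rewrite leq_subLR.
move=> x x0 ux; move: (@vander_neq0 [:: x, x^-1 & r] ux); rewrite /schur AE; last first.
  by move: ux; rewrite /= inE negb_or => /andP[/andP[]].
rewrite !vander_cons big_cons.
have -> : \prod_(t <- r) (x - t) * \prod_(t <- r) (x^-1 - t) =
    \prod_(t <- r) (t - x) * \prod_(t <- r) (t - x^-1).
  by rewrite -!big_split; apply: eq_bigr => t _ /=; ring.
rewrite hornerZ; set G := \sum_j _; set w := (P %/ _).[x].
have wE : w * ((x - 1) * (x + 1)) = x ^+ m.+2 * G.
  by rewrite -PE // [in RHS]PD /D !hornerM !hornerXsubC opprK.
rewrite !mulf_eq0 !negb_or => /andP[/andP[n1 n2] /andP[n3 n4]].
have x1 : (x - 1) * (x + 1) != 0.
  apply: contraNneq n1 => x1; have -> : x^-1 - x = - ((x - 1) * (x + 1)) / x by field.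
  by rewrite x1 oppr0 mul0r.
have -> : w = x ^+ m.+2 * G / ((x - 1) * (x + 1)).
  by rewrite -wE mulfK.
have n1' : 1 - x ^+ 2 != 0.
  apply: contraNneq x1 => x1.
  by have -> : (x - 1) * (x + 1) = - (1 - x ^+ 2); [ring | rewrite x1 oppr0].
move: x1; rewrite mulf_eq0 negb_or !exprS => /andP[x1 x1']; field.
by rewrite x1 x1' x0 n2 n3 n4 mulNr -expr2 n1'.
Qed.
End Schur.

(** * The partition function as a sum of two Schur functions *)

Section Degree.
Variables (F : fieldType) (q : F).
Local Notation wa := (weight_a q).
Local Notation wb := (weight_b q).
Local Notation kb := (boundary_weight q).
Local Notation vtx := (vertex_param q).
Local Notation Z := (partition_fun q).

(* [g] is a Laurent polynomial in [u] with exponents [-d, -d + 2, .., d]. *)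
Definition laurent d (g : F -> F) :=
  exists2 P : {poly F}, (size P <= d.+1)%N &
    forall u, u != 0 -> g u * u ^+ d = P.[u ^+ 2].

Lemma laurent1 g (a b : F) : (forall u, u != 0 -> g u = a * u + b * u^-1) ->
  laurent 1 g.
Proof.
move=> gE; exists (a *: 'X + b%:P) => [|u u0].
  rewrite (leq_trans (size_polyD _ _)) // geq_max size_polyC.
  by rewrite (leq_trans (size_scale_leq _ _)) ?size_polyX //=; case: eqP.
by rewrite hornerD hornerZ hornerX hornerC gE //; field.
Qed.

Lemma laurentC c : laurent 0 (fun=> c).
Proof.
by exists c%:P => [|u _]; [rewrite size_polyC; case: eqP | rewrite hornerC mulr1].
Qed.

Lemma laurentM d e g h : laurent d g -> laurent e h ->
  laurent (d + e) (fun u => g u * h u).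
Proof.
move=> [P sP PE] [Q sQ QE]; exists (P * Q) => [|u u0].
  by rewrite (leq_trans (size_polyMleq _ _)) //; lia.
by rewrite hornerM -PE // -QE // exprD; ring.
Qed.

Lemma laurentD d g h : laurent d g -> laurent d h ->
  laurent d (fun u => g u + h u).
Proof.
move=> [P sP PE] [Q sQ QE]; exists (P + Q) => [|u u0].
  by rewrite (leq_trans (size_polyD _ _)) // geq_max sP.
by rewrite hornerD -PE // -QE // mulrDl.
Qed.

Lemma laurent0 d : laurent d (fun=> 0).
Proof. by exists 0 => [|u _]; rewrite ?size_poly0 ?horner0 ?mul0r. Qed.

Lemma eq_laurent d g h : g =1 h -> laurent d g -> laurent d h.
Proof. by move=> gh [P sP PE]; exists P => // u; rewrite -gh; apply: PE. Qed.

Lemma laurent_kb : laurent 1 kb.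
Proof.
apply: (@laurent1 _ (q / sg q) (- q^-1 / sg q)) => u u0.
by rewrite /boundary_weight {1}/sg invfM; ring.
Qed.

Lemma laurent_kbV : laurent 1 (fun u => kb u^-1).
Proof.
apply: (@laurent1 _ (- q^-1 / sg q) (q / sg q)) => u u0.
by rewrite /boundary_weight {1}/sg invfM invrK; ring.
Qed.

Lemma laurent_pa vs : q != 0 -> laurent (size vs) (fun u => prod_a q u vs).
Proof.
move=> q0; elim: vs => [|v vs IH] /=.
  by apply: eq_laurent (laurentC 1) => u; rewrite /prod_a big_nil.
apply: (@eq_laurent _ (fun u => wa (vtx u v) * prod_a q u vs)).
  by move=> u; rewrite pa_cons.
apply: (@laurentM 1 (size vs)) (IH).
apply: (@laurent1 _ (q ^+ 2 * v / sg (q ^+ 4)) (- (q ^+ 2 * v)^-1 / sg (q ^+ 4))).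
move=> u u0; rewrite /weight_a {1}/sg /vertex_param.
have -> : q ^+ 4 / (q ^+ 2 / (u * v)) = q ^+ 2 * v * u.
  by rewrite invf_div (exprD q 2 2); field.
by rewrite invfM; ring.
Qed.

Lemma laurent_pb vs : laurent (size vs) (fun u => prod_b q u vs).
Proof.
elim: vs => [|v vs IH] /=.
  by apply: eq_laurent (laurentC 1) => u; rewrite /prod_b big_nil.
apply: (@eq_laurent _ (fun u => wb (vtx u v) * prod_b q u vs)).
  by move=> u; rewrite pb_cons.
apply: (@laurentM 1 (size vs)) (IH).
apply: (@laurent1 _ (- (v / q ^+ 2) / sg (q ^+ 4)) (q ^+ 2 / v / sg (q ^+ 4))).
move=> u u0; rewrite /weight_b {1}/sg /vertex_param invf_div invfM; ring.
Qed.

Lemma laurent_drop_sum vs f : q != 0 ->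
  laurent (size vs).-1 (fun u => drop_sum q u vs f).
Proof.
move=> q0; elim: vs f => [|v vs IH] f /=; first exact: laurent0.
apply: laurentD.
  rewrite -[size vs]addn0; apply: laurentM; [exact: laurent_pb | exact: laurentC].
have := IH (fun t => f (false :: t)); case: vs {IH} => [_|v' vs IH].
  by apply: eq_laurent (laurent0 _) => u /=; rewrite mulr0.
apply: (@laurentM 1 (size vs)) IH.
have := laurent_pa [:: v] q0; apply: eq_laurent => u.
by rewrite /prod_a big_seq1.
Qed.

(** The row has 2 m + 1 vertices, m the size of [us]. A term without a drop has one more factor from
    the boundary; a drop has two, but one of its vertices has the constant weight 1. So all terms
    have the same degree and parity. *)
Lemma Z_laurent us w : q != 0 ->
  laurent (size us).+1.*2 (fun u => Z (u :: us) w).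
Proof.
move=> q0; set vs := us ++ w :: rev us.
have sz : size vs = (size us).*2.+1 by rewrite size_cat /= size_rev addnS addnn.
apply: (@eq_laurent _ (fun u => (kb u * prod_a q u vs + kb u^-1 * prod_b q u vs) * Z us w
   + kb u * kb u^-1 * drop_sum q u vs (part q us w))).
  by move=> u; rewrite Z_cons.
apply: laurentD.
  rewrite -[_.*2]addn0; apply: laurentM (laurentC _).
  rewrite doubleS -sz; apply: laurentD; apply: (@laurentM 1).
  - exact: laurent_kb.
  - exact: laurent_pa.
  - exact: laurent_kbV.
  - exact: laurent_pb.
rewrite doubleS; apply: (@laurentM 2).
  by apply: (@laurentM 1 1); [exact: laurent_kb | exact: laurent_kbV].
by have := laurent_drop_sum vs (part q us w) q0; rewrite sz.
Qed.
End Degree.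

(** * Recurrences at the interpolation nodes *)

Section Nodes.
Variables (F : fieldType) (q : F).
Local Notation wa := (weight_a q).
Local Notation wb := (weight_b q).
Local Notation kb := (boundary_weight q).
Local Notation vtx := (vertex_param q).
Local Notation Z := (partition_fun q).

Lemma prodrM_seq (c : F) (us : seq F) (g : F -> F) :
  \prod_(v <- us) (c * g v) = c ^+ size us * \prod_(v <- us) g v.
Proof.
by elim: us => [|u us IH]; rewrite ?big_nil ?mul1r // !big_cons IH exprS; ring.
Qed.

Lemma pa_pal u us w : prod_a q u (us ++ w :: rev us) =
  wa (vtx u w) * \prod_(v <- us) wa (vtx u v) ^+ 2.
Proof.
by rewrite pa_cat pa_cons pa_rev mulrCA -expr2 -prodrXl.
Qed.

Lemma pb_pal u us w : prod_b q u (us ++ w :: rev us) =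
  wb (vtx u w) * \prod_(v <- us) wb (vtx u v) ^+ 2.
Proof.
rewrite pb_cat pb_cons mulrCA prodrXl expr2; congr (_ * (_ * _)).
by apply: perm_big; rewrite perm_rev.
Qed.

Definition sqs (us : seq F) := flatten [seq [:: u ^+ 2; u ^- 2] | u <- us].

Lemma big_sqs us (g : F -> F) :
  \prod_(y <- sqs us) g y = \prod_(u <- us) (g (u ^+ 2) * g (u ^- 2)).
Proof.
elim: us => [|u us IH]; first by rewrite !big_nil.
by rewrite /sqs /= !big_cons IH mulrA.
Qed.

(** [hq] says that the 12th cyclotomic polynomial vanishes at [q]; in this form [ring: hq] and
    [field: hq] reduce modulo it. *)
Hypotheses (hq : q ^+ 4 = q ^+ 2 - 1) (three0 : 3%:R != 0 :> F).

Lemma q_neq0 : q != 0.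
Proof.
apply/eqP => q0; move/eqP: hq; rewrite q0 !expr0n /= sub0r eq_sym oppr_eq0.
by rewrite oner_eq0.
Qed.
Let q0 := q_neq0.

Lemma q2_neq1 : q ^+ 2 != 1.
Proof.
apply/eqP => q2; move/eqP: hq; rewrite (exprM q 2 2) q2 expr1n subrr.
by rewrite oner_eq0.
Qed.

Lemma q8_neq1 : q ^+ 8 != 1.
Proof.
apply/eqP => q8; have q2 : q ^+ 2 = -1.
  by rewrite -q8; ring: hq.
move: three0; have -> : 3%:R = (q ^+ 2) ^+ 2 - q ^+ 2 + 1 :> F.
  by rewrite q2; ring.
by rewrite -exprM hq; rewrite [X in X != 0](_ : _ = 0) ?eqxx //; ring.
Qed.
Let q21 := q2_neq1.
Let q81 := q8_neq1.

Lemma omega_eq : (q ^+ 4) ^+ 2 + q ^+ 4 + 1 = 0.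
Proof. by ring: hq. Qed.

Lemma sgq4_sqr : sg (q ^+ 4) ^+ 2 = - 3%:R.
Proof. by rewrite /sg; field: hq. Qed.

Lemma sgq4E : sg (q ^+ 4) = 2%:R * q ^+ 2 - 1.
Proof. by rewrite /sg; field: hq. Qed.

Lemma sgqE : sg q = q ^+ 3.
Proof. by rewrite /sg; field: hq. Qed.

Lemma waE u v : u != 0 -> v != 0 ->
  wa (vtx u v) = (q ^+ 2 * (u * v) - (q ^+ 2 * (u * v))^-1) / sg (q ^+ 4).
Proof.
move=> u0 v0; rewrite /weight_a {1}/sg /vertex_param.
have -> // : q ^+ 4 / (q ^+ 2 / (u * v)) = q ^+ 2 * (u * v).
by field; rewrite u0 v0 q0.
Qed.

Lemma wbE u v : wb (vtx u v) =
  (q ^+ 2 / (u * v) - u * v / q ^+ 2) / sg (q ^+ 4).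
Proof. by rewrite /weight_b {1}/sg /vertex_param invf_div. Qed.

Lemma kbE u : kb u = (q * u - (q * u)^-1) / q ^+ 3.
Proof. by rewrite /boundary_weight sgqE /sg. Qed.

(** Bulk weights are combined in pairs, so that their denominators give [sg (q ^+ 4) ^+ 2 = - 3%:R]:
    the origin of the powers of 3. *)
Lemma sgM3 a b : a / sg (q ^+ 4) * (b / sg (q ^+ 4)) * 3%:R = - (a * b).
Proof.
rewrite mulrACA -invfM -expr2 sgq4_sqr invrN; field.
by rewrite three0.
Qed.

Lemma node1_bulk v : v != 0 ->
  wb (vtx q^-1 v) ^+ 2 * 3%:R = (v ^+ 2 + 1) * (v ^- 2 + 1).
Proof. by move=> v0; rewrite expr2 wbE sgM3; field: hq; rewrite ?v0 ?q0. Qed.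

Lemma node1V_bulk v : v != 0 ->
  wa (vtx q v) ^+ 2 * 3%:R = (v ^+ 2 + 1) * (v ^- 2 + 1).
Proof. by move=> v0; rewrite expr2 waE // sgM3; field: hq; rewrite ?v0 ?q0. Qed.

Lemma div_sg x : x / sg (q ^+ 4) = - x * sg (q ^+ 4) / 3%:R.
Proof.
have s0 := sgq4_neq0 q0 q81; apply: (canLR (mulfK s0)).
rewrite mulrAC -!mulrA [X in _ * X]mulrA -expr2 sgq4_sqr; field.
by rewrite three0.
Qed.

(** The weight in the central column has no partner; here the boundary weight removes its
    denominator. *)
Lemma node1_edge w : w != 0 -> kb q * wb (vtx q^-1 w) = w + w^-1.
Proof.
by move=> w0; rewrite kbE wbE div_sg sgq4E; field: hq; rewrite w0 q0 three0.
Qed.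

Lemma node1V_edge w : w != 0 -> kb q * wa (vtx q w) = w + w^-1.
Proof.
by move=> w0; rewrite kbE waE // div_sg sgq4E; field: hq; rewrite w0 q0 three0.
Qed.

Definition bulk_factor (v y : F) := (y ^+ 2 - q ^+ 4 * v ^+ 2) * (y ^+ 2 - q ^+ 8 * v ^- 2).

Lemma node2_bulk v y : v != 0 -> y != 0 ->
  wa (vtx (q ^+ 2 / v) y) * wa (vtx v y) * 3%:R = bulk_factor v y / y ^+ 2.
Proof.
move=> v0 y0; rewrite !waE ?mulf_neq0 ?invr_eq0 ?expf_neq0 // sgM3 /bulk_factor.
by field: hq; rewrite v0 y0 q0.
Qed.

Lemma node2V_bulk v y : v != 0 -> y != 0 ->
  wb (vtx (q ^+ 2 * v)^-1 y) * wb (vtx v y) * 3%:R = bulk_factor v^-1 y / y ^+ 2.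
Proof.
move=> v0 y0; rewrite !wbE sgM3 /bulk_factor.
by field: hq; rewrite v0 y0 q0 ?oner_eq0.
Qed.

Lemma node2_edge v : v != 0 -> let u := q ^+ 2 / v in
  kb u * kb v * (1 - kb u^-1 ^+ 2) =
  q ^+ 8 * (v ^+ 2 - v ^- 2) * (v ^+ 2 - q ^+ 8 * v ^- 2).
Proof. by move=> v0 u; rewrite /u !kbE; field: hq; rewrite v0 q0. Qed.

Lemma node2V_edge v : v != 0 -> let u := (q ^+ 2 * v)^-1 in
  kb u^-1 * kb v^-1 * (1 - kb u ^+ 2) =
  q ^+ 8 * (v ^- 2 - v ^+ 2) * (v ^- 2 - q ^+ 8 * v ^+ 2).
Proof. by move=> v0 u; rewrite /u !kbE; field: hq; rewrite v0 q0 ?oner_eq0. Qed.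

Lemma node3_bulk w v : w != 0 -> v != 0 -> let u := q ^+ 2 / w in
  wa (vtx u v) * wa (u / v) * 3%:R =
  q ^+ 2 / w ^+ 2 * ((v ^+ 2 - q ^+ 4 * w ^+ 2) * (v ^- 2 - q ^+ 4 * w ^+ 2)).
Proof.
move=> w0 v0 u; have u0 : u != 0 by rewrite mulf_neq0 ?invr_eq0 ?expf_neq0.
rewrite waE // /weight_a {2}/sg sgM3 /u.
by field: hq; rewrite w0 v0 q0.
Qed.

Lemma node3_edge w : w != 0 -> let u := q ^+ 2 / w in
  kb u * (1 + kb u^-1) * (w + 1) =
  q ^+ 2 * (w ^- 2 - w ^+ 2) * w * (u + 1).
Proof. by move=> w0 u; rewrite /u !kbE; field: hq; rewrite w0 q0. Qed.

Definition ys us z : seq F := z :: sqs us.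

Lemma perm_sqs us us' : perm_eq us us' -> perm_eq (sqs us) (sqs us').
Proof. by move=> p; apply: perm_flatten; apply: perm_map. Qed.

Lemma perm_ys us us' z : perm_eq us us' -> perm_eq (ys us z) (ys us' z).
Proof. by move=> p; rewrite perm_cons perm_sqs. Qed.

Lemma ys_cons u us z :
  perm_eq (ys (u :: us) z) [:: u ^+ 2, u ^- 2 & ys us z].
Proof. exact: permEl (perm_catCA [:: z] [:: u ^+ 2; u ^- 2] (sqs us)). Qed.

(** [q ^- 2] and [q ^+ 2] differ by the cube root [q ^+ 4], and the third point of their triple is
    -1. *)
Lemma schur_node1 u us z : u = q \/ u = q^-1 -> uniq (ys (u :: us) z) ->
  schur (ys (u :: us) z) =
  (z + 1) * \prod_(v <- us) ((v ^+ 2 + 1) * (v ^- 2 + 1)) * schur (ys us z).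
Proof.
move=> uq uy.
have pq : perm_eq (ys (u :: us) z) [:: q ^- 2, q ^+ 4 * q ^- 2 & ys us z].
  have -> : q ^+ 4 * q ^- 2 = q ^+ 2 by field.
  rewrite (perm_trans (ys_cons _ _ _)) //; case: uq => ->.
    exact: permEl (perm_catCA [:: _] [:: _] _).
  by rewrite exprVn invrK.
rewrite (perm_uniq pq) in uy; rewrite (schur_perm pq).
have E : (q ^+ 4) ^+ 2 * q ^- 2 = -1 by field: hq.
rewrite (schur_wheel omega_eq uy) big_cons big_sqs E opprK; congr (_ * _ * _).
Qed.

Definition rhs us w :=
  w * schur (ys us (w ^+ 2)) +
  w ^+ (size us).*2 * schur (ys us (w ^- 2)).

(** Without rows both sides are [w + 1]. A new row meets every other line twice, which yields one
    factor 3 per line and hence the exponent ['C(n, 2)]. *)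
Definition schur_formula us w :=
  w ^+ size us * (w + 1) * 3%:R ^+ 'C(size us, 2) * Z us w = rhs us w.

Lemma formula_node1 u us w : u = q \/ u = q^-1 -> all (predC1 0) us -> w != 0 ->
  uniq (ys (u :: us) (w ^+ 2)) -> uniq (ys (u :: us) (w ^- 2)) ->
  schur_formula us w -> schur_formula (u :: us) w.
Proof.
move=> uq us0 w0 uy1 uy2; rewrite /schur_formula /rhs !(schur_node1 uq) //.
have ZE : Z (u :: us) w * 3%:R ^+ size us =
   (w + w^-1) * \prod_(v <- us) ((v ^+ 2 + 1) * (v ^- 2 + 1)) * Z us w.
  have -> : \prod_(v <- us) ((v ^+ 2 + 1) * (v ^- 2 + 1)) =
      3%:R ^+ size us * \prod_(v <- us) (if u == q then wa (vtx u v) else wb (vtx u v)) ^+ 2.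
    rewrite -prodrM_seq; apply: eq_big_seq => v /(allP us0) v0.
    case: eqVneq uq => [-> _ | uq [/eqP|->]]; [|by rewrite (negPf uq)|].
      by rewrite [RHS]mulrC node1V_bulk.
    by rewrite [RHS]mulrC node1_bulk.
  case: eqVneq uq => [-> _ | nq [/eqP|->]]; [|by rewrite (negPf nq)|].
    rewrite Z_kbV0; last by rewrite kbE mulfV // invr1 subrr mul0r.
    by rewrite pa_pal mulrA node1V_edge //; ring.
  rewrite Z_kb0; last by rewrite kbE mulfV // invr1 subrr mul0r.
  by rewrite pb_pal invrK mulrA node1_edge //; ring.
set P := \prod_(v <- us) _ in ZE *; move=> H.
have C2 : 'C((size us).+1, 2) = ('C(size us, 2) + size us)%N by rewrite binS bin1.
rewrite /= C2 exprD.
transitivity ((w ^+ 2 + 1) * P * (w ^+ size us * (w + 1) * 3%:R ^+ 'C(size us, 2) * Z us w)).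
  transitivity (w ^+ (size us).+1 * (w + 1) * 3%:R ^+ 'C(size us, 2) *
    (Z (u :: us) w * 3%:R ^+ size us)); first by ring.
  by rewrite ZE exprS; field.
by rewrite H doubleS !exprS; field.
Qed.

(** The wheel relation applies twice, with third points [q ^+ 8 / a] and [q ^+ 4 * a]. The first
    application also meets the second pair, which gives the prefactor. *)
Lemma schur_node2 L (a : F) us z : a != 0 -> uniq L ->
  perm_eq L [:: a^-1, q ^+ 4 / a, q ^- 4 * a, a & ys us z] ->
  schur L = q ^+ 8 * (a - a^-1) * (a - q ^+ 8 * a^-1) *
    \prod_(y <- ys us z) ((y - q ^+ 8 / a) * (y - q ^+ 4 * a)) * schur (ys us z).
Proof.
move=> a0 uL pL; rewrite (perm_uniq pL) in uL; rewrite (schur_perm pL).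
rewrite (schur_wheel omega_eq uL); move: uL => /andP[_ /andP[_ uL]].
have E : a = q ^+ 4 * (q ^- 4 * a) by field.
have uL' : uniq [:: q ^- 4 * a, q ^+ 4 * (q ^- 4 * a) & ys us z] by rewrite -E.
have -> : [:: q ^- 4 * a, a & ys us z] =
   [:: q ^- 4 * a, q ^+ 4 * (q ^- 4 * a) & ys us z] by rewrite -E.
rewrite (schur_wheel omega_eq uL').
have E8 : (q ^+ 4) ^+ 2 = q ^+ 8 by rewrite -exprM.
rewrite big_cons big_cons -E E8.
have -> : q ^+ 8 * (q ^- 4 * a) = q ^+ 4 * a by field.
have -> : q ^- 4 * a - q ^+ 8 * a^-1 = q ^+ 8 * (a - a^-1).
  by field: hq; rewrite a0 q0.
by rewrite [in RHS]big_split /=; ring.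
Qed.

(** The factors for [y ^+ 2] and [y ^- 2] form a square, as the vertex weights in [pa_pal] and
    [pb_pal] do. *)
Lemma kap_pair a y : a != 0 -> y != 0 ->
  (y ^+ 2 - q ^+ 8 / a) * (y ^+ 2 - q ^+ 4 * a) *
  ((y ^- 2 - q ^+ 8 / a) * (y ^- 2 - q ^+ 4 * a)) =
  ((y ^+ 2 - q ^+ 8 / a) * (y ^+ 2 - q ^+ 4 * a) / y ^+ 2) ^+ 2.
Proof. by move=> a0 y0; field: hq; rewrite a0 y0. Qed.

(** [b] tells whether weights b ([Z_pairV]) or weights a ([Z_pair]) survive. On the Schur side the
    two cases differ by inverting [v ^+ 2], which [a] absorbs. *)
Lemma formula_node2 u v (b : bool) us w :
  v != 0 -> all (predC1 0) us -> w != 0 ->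
  u = (if b then (q ^+ 2 * v)^-1 else q ^+ 2 / v) ->
  uniq (ys [:: u, v & us] (w ^+ 2)) -> uniq (ys [:: u, v & us] (w ^- 2)) ->
  schur_formula us w -> schur_formula [:: u, v & us] w.
Proof.
move=> v0 us0 w0 uE uy1 uy2; pose a := if b then v ^- 2 else v ^+ 2.
have a0 : a != 0 by rewrite /a; case: (b); rewrite ?invr_eq0 expf_neq0.
have pL z : perm_eq (ys [:: u, v & us] z)
    [:: a^-1, q ^+ 4 / a, q ^- 4 * a, a & ys us z].
  rewrite (perm_trans (ys_cons _ _ _)) //.
  have [-> ->] : u ^+ 2 = (if b then q ^- 4 * a else q ^+ 4 / a) /\
                 u ^- 2 = (if b then q ^+ 4 / a else q ^- 4 * a).
    by rewrite uE /a; case: (b); split; field: hq; rewrite ?v0 ?q0 ?oner_eq0.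
  have : perm_eq (ys (v :: us) z) (if b then [:: a^-1, a & ys us z] else [:: a, a^-1 & ys us z]).
    by rewrite (perm_trans (ys_cons _ _ _)) // /a; case: (b); rewrite ?invrK.
  rewrite -(perm_cons (if b then q ^+ 4 / a else q ^- 4 * a)).
  rewrite -(perm_cons (if b then q ^- 4 * a else q ^+ 4 / a)).
  move=> p1; rewrite (perm_trans p1) //.
  by apply/seq.permP => p /=; case: (b) => /=; ring.
pose C := q ^+ 8 * (a - a^-1) * (a - q ^+ 8 * a^-1).
have f2 z (uy : uniq (ys [:: u, v & us] z)) := schur_node2 a0 uy (pL z).
rewrite /schur_formula /rhs !f2 // -/C.
pose f y := (y - q ^+ 8 / a) * (y - q ^+ 4 * a).
set P := \prod_(y <- us) (f (y ^+ 2) / y ^+ 2) ^+ 2.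
have prodE z : \prod_(y <- ys us z) ((y - q ^+ 8 / a) * (y - q ^+ 4 * a)) = f z * P.
  rewrite big_cons big_sqs; congr (_ * _); apply: eq_big_seq => y /(allP us0) y0.
  by rewrite kap_pair.
rewrite !prodE.
have ZE : Z [:: u, v & us] w * 3%:R ^+ (size us).*2.+1 =
   C * (f (w ^+ 2) / w ^+ 2) * P * Z us w.
  have P3 : \prod_(y <- us) (f (y ^+ 2) / y ^+ 2) ^+ 2 = 3%:R ^+ (size us).*2 *
     (if b then \prod_(y <- us) wb (vtx u y) ^+ 2 * \prod_(y <- us) wb (vtx v y) ^+ 2
           else \prod_(y <- us) wa (vtx u y) ^+ 2 * \prod_(y <- us) wa (vtx v y) ^+ 2).
    have -> : 3%:R ^+ (size us).*2 = (3%:R ^+ 2) ^+ size us :> F by rewrite -exprM mul2n.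
    rewrite /f /a uE; case: (b); rewrite -big_split -prodrM_seq;
      apply: eq_big_seq => y /(allP us0) /= y0.
      rewrite -exprMn -exprMn [3%:R * _]mulrC node2V_bulk //.
      by congr (_ ^+ 2); rewrite /bulk_factor; field; rewrite v0 y0 ?oner_eq0.
    rewrite -exprMn -exprMn [3%:R * _]mulrC node2_bulk //.
    by congr (_ ^+ 2); rewrite /bulk_factor; field; rewrite v0 y0.
  have uvE : v = if b then (u * q ^+ 2)^-1 else q ^+ 2 / u.
    by rewrite uE; case: (b); field; rewrite ?v0 ?q0 ?oner_eq0.
  have u0 : u != 0.
    by rewrite uE; case: (b); rewrite ?invr_eq0 ?mulf_neq0 ?invr_eq0 ?expf_neq0.
  rewrite /P P3 exprS /C /f; move: uE uvE; rewrite /a; case: (b) => /= uE uvE.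
    have := @Z_pairV _ _ q0 q21 q81 u us w u0; rewrite -uvE /= => ->.
    rewrite !pb_pal.
    have := node2V_bulk v0 w0; have := node2V_edge v0; rewrite /= -uE => -> H.
    transitivity (q ^+ 8 * (v ^- 2 - v ^+ 2) * (v ^- 2 - q ^+ 8 * v ^+ 2) *
      (wb (vtx u w) * wb (vtx v w) * 3%:R) * (3%:R ^+ (size us).*2 *
      (\prod_(y <- us) wb (vtx u y) ^+ 2 * \prod_(y <- us) wb (vtx v y) ^+ 2)) * Z us w).
      by ring.
    by rewrite H /bulk_factor invrK; congr (_ * _ * _ * _); field; rewrite v0 w0 ?oner_eq0.
  have := @Z_pair _ _ q0 q21 q81 u us w u0; rewrite -uvE /= => ->.
  rewrite !pa_pal.
  have := node2_bulk v0 w0; have := node2_edge v0; rewrite /= -uE => -> H.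
  transitivity (q ^+ 8 * (v ^+ 2 - v ^- 2) * (v ^+ 2 - q ^+ 8 * v ^- 2) *
      (wa (vtx u w) * wa (vtx v w) * 3%:R) * (3%:R ^+ (size us).*2 *
      (\prod_(y <- us) wa (vtx u y) ^+ 2 * \prod_(y <- us) wa (vtx v y) ^+ 2)) * Z us w).
    by ring.
  by rewrite H /bulk_factor; congr (_ * _ * _ * _); field; rewrite v0 w0 ?oner_eq0.
move=> H.
have C2 : 'C((size us).+2, 2) = ('C(size us, 2) + (size us).*2.+1)%N.
  by rewrite !binS !bin1 !bin0 -addnn; lia.
rewrite [size _]/= C2 exprD.
have fw : f (w ^- 2) = f (w ^+ 2) / w ^+ 4.
  by rewrite /f; field: hq; rewrite a0 w0.
transitivity (C * f (w ^+ 2) * P * (w ^+ size us * (w + 1) * 3%:R ^+ 'C(size us, 2) * Z us w)).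
  transitivity (w ^+ (size us).+2 * (w + 1) * 3%:R ^+ 'C(size us, 2) *
    (Z [:: u, v & us] w * 3%:R ^+ (size us).*2.+1)); first by ring.
  by rewrite ZE !exprS; field.
by rewrite H /rhs fw !doubleS !exprS; field.
Qed.

Lemma formula_node3 u us w : all (predC1 0) us -> w != 0 -> u = q ^+ 2 / w ->
  uniq (ys (u :: us) (w ^+ 2)) -> uniq (ys (u :: us) (w ^- 2)) ->
  schur_formula us u -> schur_formula (u :: us) w.
Proof.
move=> us0 w0 uE uy1 uy2.
have u0 : u != 0 by rewrite uE mulf_neq0 ?invr_eq0 ?expf_neq0.
pose g y := (y ^+ 2 - q ^+ 4 * w ^+ 2) * (y ^- 2 - q ^+ 4 * w ^+ 2).
pose P := \prod_(y <- us) g y.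
have E8 : (q ^+ 4) ^+ 2 = q ^+ 8 by rewrite -exprM.
have S1 : schur (ys (u :: us) (w ^+ 2)) =
    q ^+ 4 * (w ^- 2 - w ^+ 2) * P * schur (ys us (u ^+ 2)).
  have pL : perm_eq (ys (u :: us) (w ^+ 2))
      [:: u ^- 2, q ^+ 4 * u ^- 2 & ys us (u ^+ 2)].
    have -> : q ^+ 4 * u ^- 2 = w ^+ 2 by rewrite uE; field: hq; rewrite w0 q0.
    by apply/seq.permP => p /=; ring.
  rewrite (schur_perm pL) (schur_wheel omega_eq); last by rewrite -(perm_uniq pL).
  rewrite E8 big_cons big_sqs.
  have -> : q ^+ 8 * u ^- 2 = q ^+ 4 * w ^+ 2.
    by rewrite uE; field: hq; rewrite w0 q0.
  by rewrite -/P uE; congr (_ * _ * _); field; rewrite w0.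
have S2 : schur (ys (u :: us) (w ^- 2)) =
    q ^+ 8 * (w ^+ 2 - w ^- 2) * ((q ^+ 4 * w ^- 4) ^+ size us * P) *
    schur (ys us (u ^- 2)).
  have pL : perm_eq (ys (u :: us) (w ^- 2))
      [:: w ^- 2, q ^+ 4 * w ^- 2 & ys us (u ^- 2)].
    have -> : q ^+ 4 * w ^- 2 = u ^+ 2 by rewrite uE; field; rewrite w0.
    by apply/seq.permP => p /=; ring.
  rewrite (schur_perm pL) (schur_wheel omega_eq); last by rewrite -(perm_uniq pL).
  rewrite E8 big_cons big_sqs -prodrM_seq; congr (_ * _ * _).
    by rewrite uE; field: hq; rewrite w0 q0.
  apply: eq_big_seq => y /(allP us0) /= y0; rewrite /g.
  by field: hq; rewrite w0 y0.
rewrite /schur_formula /rhs S1 S2 => H.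
have C2 : 'C((size us).+1, 2) = ('C(size us, 2) + size us)%N by rewrite binS bin1.
have ZE : Z (u :: us) w * 3%:R ^+ size us * (w + 1) =
    q ^+ 2 * (w ^- 2 - w ^+ 2) * w * (u + 1) * ((q ^+ 2 / w ^+ 2) ^+ size us * P) * Z us u.
  have wE : w = q ^+ 2 / u by rewrite uE; field; rewrite w0 q0.
  rewrite [in Z _ _]wE (Z_drag q0 q21 q81 u0 us0).
  have := node3_edge w0; rewrite /= -uE => <-.
  rewrite -prodrM_seq.
  have -> : \prod_(y <- us) (q ^+ 2 / w ^+ 2 * g y) =
     3%:R ^+ size us * (prod_a q u us * \prod_(y <- us) wa (u / y)).
    rewrite /prod_a -big_split -prodrM_seq; apply: eq_big_seq => y /(allP us0) /= y0.
    by have := node3_bulk w0 y0; rewrite /= -uE => <-; rewrite mulrC.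
  by ring.
rewrite [size (_ :: _)]/= C2 exprD.
transitivity (q ^+ 2 * (w ^- 2 - w ^+ 2) * w ^+ 2 * P *
   (u ^+ size us * (u + 1) * 3%:R ^+ 'C(size us, 2) * Z us u)).
  transitivity (w ^+ (size us).+1 * 3%:R ^+ 'C(size us, 2) *
     (Z (u :: us) w * 3%:R ^+ size us * (w + 1))); first by ring.
  rewrite ZE; have -> : u ^+ size us = w ^+ size us * (q ^+ 2 / w ^+ 2) ^+ size us.
    by rewrite -exprMn; congr (_ ^+ _); rewrite uE; field; rewrite w0.
  by rewrite exprS; ring.
rewrite H.
have -> : u ^+ (size us).*2 = w ^+ (size us).*2 * (q ^+ 4 * w ^- 4) ^+ size us.
  rewrite -!mul2n !exprM -exprMn; congr (_ ^+ _).
  by rewrite uE; field; rewrite w0.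
rewrite doubleS !exprS uE; move: (_ ^+ size us) => X; move: (_ ^+ _.*2) => Y.
by field: hq; rewrite w0.
Qed.

End Nodes.

(** * Interpolation in the first parameter *)

Section Interpolation.
Variables (F : fieldType) (q : F).
Local Notation wa := (weight_a q).
Local Notation Z := (partition_fun q).
Local Notation formula := (schur_formula q).
Hypotheses (hq : q ^+ 4 = q ^+ 2 - 1) (three0 : 3%:R != 0 :> F)
  (two0 : 2%:R != 0 :> F).
Implicit Types (us : seq F) (u v w x y z : F).
Let q0 : q != 0 := q_neq0 hq.
Let q21 := q2_neq1 hq.
Let q81 := q8_neq1 hq three0.

Definition all_ys us w := [:: w ^+ 2, w ^- 2 & sqs us].
(* The cubes are compared because the interpolation nodes are equal to these points
   up to cube roots of unity. *)
Definition generic us w := uniq [seq y ^+ 3 | y <- all_ys us w].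

Lemma sqs_cons u us : sqs (u :: us) = [:: u ^+ 2, u ^- 2 & sqs us].
Proof. by []. Qed.

Lemma gen_perm us us' w : perm_eq us us' -> generic us w = generic us' w.
Proof.
by move=> p; apply/perm_uniq/perm_map; rewrite !perm_cons perm_sqs.
Qed.

Lemma mem_sqs us y : y \in sqs us ->
  exists2 u, u \in us & y = u ^+ 2 \/ y = u ^- 2.
Proof.
by move=> /flatten_mapP[u uu]; rewrite !inE => /orP[] /eqP->; exists u; auto.
Qed.

Lemma sqs_mem us u : u \in us -> (u ^+ 2 \in sqs us) /\ (u ^- 2 \in sqs us).
Proof.
by move=> uu; split; apply/flatten_mapP; exists u; rewrite // !inE eqxx ?orbT.
Qed.

Lemma yy_inv us w y : y \in all_ys us w -> y^-1 \in all_ys us w.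
Proof.
rewrite !inE => /or3P[/eqP->|/eqP->|/mem_sqs[u /sqs_mem[m1 m2] [] ->]];
  by rewrite ?invrK ?eqxx ?m1 ?m2 ?orbT.
Qed.

Lemma map_uniq_inj (T T' : eqType) (f : T -> T') s : uniq (map f s) ->
  {in s &, injective f}.
Proof.
elim: s => //= a s IH /andP[na us] x y; rewrite !inE.
case/orP=> [/eqP->|xs] /orP[/eqP->|yis] E //; last exact: IH.
- by move: na; rewrite E map_f.
- by move: na; rewrite -E map_f.
Qed.

Lemma gen_cons u us w : generic (u :: us) w ->
  [/\ generic us w, u ^+ 2 \notin all_ys us w,
      (u ^+ 2) ^+ 3 != (u ^- 2) ^+ 3 & forall v, v \in us -> u ^+ 6 != v ^+ 6].
Proof.
have p : perm_eq (all_ys (u :: us) w) [:: u ^+ 2, u ^- 2 & all_ys us w].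
  by apply/seq.permP => a /=; ring.
rewrite /generic (perm_uniq (perm_map _ p)) map_cons map_cons !cons_uniq.
rewrite [in X in X -> _]inE negb_or => /andP[/andP[n1 n2] /andP[n3 n4]].
split=> //; first by apply: contra n2; apply: (map_f (fun y => y ^+ 3)).
move=> v vu; apply: contra n2 => /eqP E; apply/mapP; exists (v ^+ 2).
  by rewrite !inE (sqs_mem vu).1 !orbT.
by rewrite -!exprM.
Qed.

(** The inverse of a member stands at another position of the list. In particular no member is a
    sixth root of unity. *)
Lemma gen_sym us w y : generic us w -> y \in all_ys us w -> y ^+ 3 != y^-1 ^+ 3.
Proof.
move=> g; rewrite !inE => /or3P[/eqP->|/eqP->|/mem_sqs[u uu E]].
- by move: g; rewrite /generic /= inE negb_or => /andP[/andP[]].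
- by rewrite invrK eq_sym; move: g; rewrite /generic /= inE negb_or => /andP[/andP[]].
have p : perm_eq us (u :: rem u us) by apply: perm_to_rem.
move: g; rewrite (gen_perm _ p) => /gen_cons[_ _ n _].
by case: E => ->; rewrite ?invrK // eq_sym.
Qed.

Lemma gen_ys us w u z : generic us w -> u ^+ 2 \notin all_ys us w -> u ^+ 2 != u ^- 2 ->
  z = w ^+ 2 \/ z = w ^- 2 -> uniq (ys (u :: us) z).
Proof.
move=> g uy uu zE; rewrite (perm_uniq (ys_cons _ _ _)).
have sub y : y \in ys us z -> y \in all_ys us w.
  by case: zE => ->; rewrite !inE => /orP[]->; rewrite ?orbT.
rewrite 2!cons_uniq inE negb_or uu /=; apply/and3P; split.
- by apply: contra uy => /sub.
- by apply: contra uy => /sub/yy_inv; rewrite invrK.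
have : uniq (all_ys us w) by apply: map_uniq g.
rewrite /= !inE !negb_or => /and3P[/andP[_ n1] n2 ->].
by case: zE => ->; rewrite ?n1 ?n2.
Qed.

(** A cube root of unity does not change the cube, and genericity separates cubes. So such a node
    could only collide with [c] itself. *)
Lemma gen_twist us w c k u : generic us w -> c \in all_ys us w -> k = 1%N \/ k = 2%N ->
  u ^+ 2 = (q ^+ 4) ^+ k * c -> u ^+ 2 \notin all_ys us w /\ u ^+ 2 != u ^- 2.
Proof.
move=> g cy kE uE; have c3 : (u ^+ 2) ^+ 3 = c ^+ 3.
  rewrite uE exprMn; have -> : ((q ^+ 4) ^+ k) ^+ 3 = 1.
    by rewrite exprAC; have -> : (q ^+ 4) ^+ 3 = 1; [ring: hq | rewrite expr1n].
  by rewrite mul1r.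
split; last first.
  apply: contraNneq (gen_sym g cy) => E.
  by rewrite exprVn -c3 -exprVn -E.
apply/negP => uy; have := map_uniq_inj g uy cy c3; rewrite uE => E.
have c0 : c != 0.
  by apply: contraNneq (gen_sym g cy) => ->; rewrite invr0.
have : (q ^+ 4) ^+ k = 1 by apply: (mulIf c0); rewrite E mul1r.
case: kE => -> /eqP; rewrite -exprM ?(negPf q81) //.
move/eqP => q41; move/eqP: q81; apply.
by rewrite (exprM q 4 2) q41 expr1n.
Qed.

Lemma gen_minus1 us w u : generic us w -> u = q \/ u = q^-1 ->
  u ^+ 2 \notin all_ys us w /\ u ^+ 2 != u ^- 2.
Proof.
move=> g uE; have u6 : (u ^+ 2) ^+ 3 = -1.
  by case: uE => ->; field: hq.
split.
  apply/negP=> /(gen_sym g)/negP; apply; rewrite exprVn u6.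
  by rewrite invrN1.
apply/eqP => E; move/eqP: q81; apply.
have E4 : u ^+ 4 = 1.
  have u0 : u != 0 by case: uE => ->; rewrite ?invr_eq0.
  by rewrite (exprD u 2 2) {1}E mulVf // expf_neq0.
case: uE E4 => -> E4.
  by rewrite (exprM q 4 2) E4 expr1n.
have {}E4 : q ^+ 4 = 1 by apply: invr_inj; rewrite -exprVn E4 invr1.
by rewrite (exprM q 4 2) E4 expr1n.
Qed.

Definition twists us := flatten [seq [:: q ^+ 4 * v ^- 2; q ^+ 8 * v ^- 2] | v <- us].

Lemma mem_twists us y : y \in twists us ->
  exists2 v, v \in us & y = q ^+ 4 * v ^- 2 \/ y = q ^+ 8 * v ^- 2.
Proof.
by move=> /flatten_mapP[v vu]; rewrite !inE => /orP[] /eqP->; exists v; auto.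
Qed.

Lemma twists_cube us y : y \in twists us ->
  exists2 v, v \in us & y ^+ 3 = (v ^- 2) ^+ 3.
Proof.
move=> /mem_twists[v vu yE]; exists v => //.
have q12 : q ^+ 12 = 1 by ring: hq.
by case: yE => ->; rewrite exprMn -exprM ?(exprM q 12 2) q12 ?expr1n mul1r.
Qed.

Lemma q4_neq1 : q ^+ 4 != 1.
Proof.
by apply/eqP => E; move/eqP: q81; apply; rewrite (exprM q 4 2) E expr1n.
Qed.

Lemma gen_nodes us w : generic us w -> all (predC1 0) us -> w != 0 ->
  uniq [:: q ^- 2, q ^+ 2, q ^+ 4 * w ^- 2 & twists us].
Proof.
move=> g us0 w0.
have nm1 c : c \in all_ys us w -> c ^+ 3 != -1.
  by move=> /(gen_sym g); apply: contraNneq => E; rewrite exprVn E invrN1.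
have w2 : w ^- 2 \in all_ys us w by rewrite !inE eqxx orbT.
have v2 v : v \in us -> v ^- 2 \in all_ys us w.
  by case/sqs_mem=> _ h; rewrite !inE h !orbT.
have cw : (q ^+ 4 * w ^- 2) ^+ 3 = (w ^- 2) ^+ 3 by field: hq.
have m1 a : a ^+ 3 = -1 -> a \notin q ^+ 4 * w ^- 2 :: twists us.
  move=> a3; rewrite inE negb_or; apply/andP; split.
    by apply: contraNneq (nm1 _ w2) => E; rewrite -cw -E a3.
  apply/negP => /twists_cube[v vu]; rewrite a3 => /esym E.
  by have := nm1 _ (v2 _ vu); rewrite E eqxx.
rewrite !cons_uniq inE negb_or !m1; [|by field: hq..]; rewrite andbT /=.
apply/and3P; split.
- apply: contra_neq q4_neq1 => E; rewrite (exprD q 2 2) -{1}E mulVf //.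
  by rewrite expf_neq0.
- apply/negP => /twists_cube[v vu]; rewrite cw => E.
  have := map_uniq_inj g w2 (v2 _ vu) E => Ew.
  have : uniq (all_ys us w) by apply: map_uniq g.
  by rewrite /= !inE Ew (sqs_mem vu).2 /= andbF.
elim: us us0 {nm1 w2 v2 m1} g => //= v us IH /andP[v0 us0] /gen_cons[g _ _ nv].
rewrite -/(twists us) IH // andbT inE negb_or.
have nt a : a ^+ 3 = (v ^- 2) ^+ 3 -> a \notin twists us.
  move=> aE; apply/negP => /twists_cube[v' vu']; rewrite aE => E.
  move/eqP: (nv _ vu'); apply; apply: invr_inj.
  by move: E; rewrite !exprVn -!exprM.
rewrite !nt; [|by field: hq..]; rewrite !andbT.
apply: contra_neq q4_neq1 => E.
have : q ^+ 4 * (q ^+ 4 * v ^- 2) = 1 * (q ^+ 4 * v ^- 2).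
  by rewrite mul1r {2}E mulrA -exprD.
by move/mulIf; apply; rewrite mulf_neq0 ?invr_eq0 ?expf_neq0.
Qed.

Lemma Z_move p l x r w : all (predC1 0) (w :: p ++ l ++ x :: r) ->
  (forall y, y \in l -> wa (y / x) != 0) ->
  Z (p ++ l ++ x :: r) w = Z (p ++ x :: l ++ r) w.
Proof.
elim: l p => [|y l IH] p // nz wl.
have := IH (rcons p y); rewrite -cats1 -!catA /= => ->; last 2 first.
- by move: nz.
- by move=> y' yl; apply: wl; rewrite inE yl orbT.
rewrite (Z_swap q0 q21 q81) ?wl ?mem_head //.
move: nz; rewrite /= !all_cat /= all_cat /=.
by case/and5P=> -> -> -> -> /andP[-> ->].
Qed.

(** The recurrence for two frozen rows needs them adjacent, so the row of [v] is moved up. A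
    vanishing scalar on the way would mean [y ^+ 6 = v ^+ 6], against genericity. *)
Lemma formula_move v l r u w : all (predC1 0) (w :: u :: l ++ v :: r) ->
  generic (l ++ v :: r) w -> formula [:: u, v & l ++ r] w ->
  formula (u :: l ++ v :: r) w.
Proof.
move=> nz g; rewrite /schur_formula /rhs.
have p : perm_eq (l ++ v :: r) (v :: l ++ r) by rewrite perm_catC /= perm_cons perm_catC.
have pu : perm_eq (u :: l ++ v :: r) [:: u, v & l ++ r] by rewrite perm_cons.
rewrite !(schur_perm (perm_ys _ pu)) (perm_size pu) => <-; congr (_ * _).
apply: (@Z_move [:: u]) => // y yl; apply/negP => /eqP E.
move: g; rewrite (gen_perm _ p) => /gen_cons[_ _ _ /(_ y)].
rewrite mem_cat yl => /(_ isT)/eqP; apply.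
have y0 : y != 0.
  by move: nz; rewrite /= all_cat => /and4P[_ _ /allP/(_ _ yl)].
have v0 : v != 0.
  by move: nz; rewrite /= all_cat /= => /and4P[_ _ _ /andP[]].
move/eqP: E; rewrite /weight_a mulf_eq0 invr_eq0 (negPf (sgq4_neq0 q0 q81)) orbF.
rewrite /sg subr_eq0 => /eqP E; have t0 : q ^+ 4 / (y / v) != 0.
  by rewrite !mulf_neq0 ?invr_eq0 ?expf_neq0 // mulf_neq0 ?invr_eq0.
have t2 : (q ^+ 4 / (y / v)) ^+ 2 = 1 by rewrite expr2 {1}E mulVf.
have t6 : (q ^+ 4 / (y / v)) ^+ 6 = 1 by rewrite (exprM _ 2 3) t2 expr1n.
transitivity (y ^+ 6 * (q ^+ 4 / (y / v)) ^+ 6); last by rewrite t6 mulr1.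
by field: hq; rewrite y0 v0.
Qed.

Lemma size_sqs us : size (sqs us) = (size us).*2.
Proof. by elim: us => //= u us IH; rewrite -[RHS]/((size us).*2.+2) -IH. Qed.

Lemma size_twists us : size (twists us) = (size us).*2.
Proof. by elim: us => //= u us IH; rewrite -[RHS]/((size us).*2.+2) -IH. Qed.

(** Strong induction on the number of rows, for all [w] at once: two frozen rows disappear together,
    and the central node replaces [w] by [q ^+ 2 / w]. *)
Theorem partition_function us w : all (predC1 0) (w :: us) -> generic us w ->
  formula us w.
Proof.
have [n] := ubnP (size us); elim: n us w => // n IH us w.
case: us => [_ /andP[w0 _] _|u1 us] /=.
  rewrite /schur_formula /rhs /= /sqs /= !schur1 /partition_fun /=; ring.
rewrite ltnS => szn /and3P[w0 u10 us0] g1.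
have [g u1y u1c _] := gen_cons g1.
have u1u : u1 ^+ 2 != u1 ^- 2 by apply: contraNneq u1c => <-.
have [P sP PE] := Z_laurent us w q0; set m := size us in sP PE szn.
have laur z : z = w ^+ 2 \/ z = w ^- 2 ->
  exists2 Q : {poly F}, (size Q <= m.+1.*2.+1)%N &
    forall x, x != 0 -> uniq [:: x, x^-1 & ys us z] ->
    schur [:: x, x^-1 & ys us z] * x ^+ m.+1 = Q.[x].
  move=> zE.
  have sub y : y \in ys us z -> y \in all_ys us w.
    by case: zE => ->; rewrite !inE => /orP[]->; rewrite ?orbT.
  apply: schur_laurent => //.
  - have := gen_ys g u1y u1u zE; rewrite (perm_uniq (ys_cons _ _ _)).
    by case/andP=> _ /andP[].
  - by rewrite /= size_sqs.
  - by apply/negP => /sub/(gen_sym g); rewrite invr1 eqxx.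
  - by apply/negP => /sub/(gen_sym g); rewrite invrN1 eqxx.
have [Q1 sQ1 Q1E] := laur _ (or_introl erefl).
have [Q2 sQ2 Q2E] := laur _ (or_intror erefl).
pose c := w ^+ m.+1 * (w + 1) * 3%:R ^+ 'C(m.+1, 2).
(* At [u ^+ 2], [D] is the difference of the two sides times [u ^+ (2 m + 2)]. It has at most 2 m +
   3 coefficients, as many as there are nodes. *)
pose D := c *: P - (w *: Q1 + w ^+ m.+1.*2 *: Q2).
have DE u : u != 0 -> u ^+ 2 \notin all_ys us w -> u ^+ 2 != u ^- 2 ->
    root D (u ^+ 2) <-> formula (u :: us) w.
  move=> u0 uy uu.
  have uy1 := gen_ys g uy uu (or_introl erefl).
  have uy2 := gen_ys g uy uu (or_intror erefl).
  have x0 : u ^+ 2 != 0 by rewrite expf_neq0.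
  have -> : root D (u ^+ 2) = ((c * Z (u :: us) w - rhs (u :: us) w) * (u ^+ 2) ^+ m.+1 == 0).
    rewrite rootE /D hornerD hornerN hornerD !hornerZ -PE // -Q1E //; last first.
      by rewrite -(perm_uniq (ys_cons _ _ _)).
    rewrite -Q2E //; last by rewrite -(perm_uniq (ys_cons _ _ _)).
    rewrite -!(schur_perm (ys_cons _ _ _)) /rhs -/m [size _]/= -/m.
    have -> : u ^+ m.+1.*2 = (u ^+ 2) ^+ m.+1 by rewrite -exprM mul2n.
    by congr (_ == 0); ring.
  rewrite mulf_eq0 [in X in _ || X]expf_eq0 /= (negPf x0) orbF subr_eq0.
  by rewrite /schur_formula [size _]/= -/m -/c; split=> /eqP.
(* The nodes in [u1 ^+ 2] are the values at which the first row freezes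
   ([q ^- 2] and [q ^+ 2]), at which the central line can be moved
   ([q ^+ 4 * w ^- 2]), or at which two rows freeze ([twists]). *)
suff D0 : D = 0 by apply/DE => //; rewrite D0 root0.
apply: (roots_geq_poly_eq0 _ (gen_nodes g us0 w0)); last first.
  have -> : size [:: q ^- 2, q ^+ 2, q ^+ 4 * w ^- 2 & twists us] = m.+1.*2.+1.
    by rewrite /= size_twists.
  rewrite (leq_trans (size_polyD _ _)) // geq_max size_polyN.
  rewrite (leq_trans (size_scale_leq _ _)) //=.
  rewrite (leq_trans (size_polyD _ _)) // geq_max.
  by rewrite !(leq_trans (size_scale_leq _ _)).
have node u : u != 0 -> u ^+ 2 \notin all_ys us w /\ u ^+ 2 != u ^- 2 ->
    (uniq (ys (u :: us) (w ^+ 2)) -> uniq (ys (u :: us) (w ^- 2)) -> formula (u :: us) w) ->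
    root D (u ^+ 2).
  by move=> u0 [uy uu] H; apply/DE => //; apply: H; apply: (gen_ys g) => //; auto.
have qV2 : q^-1 ^+ 2 = q ^- 2 by rewrite exprVn.
have IHus : formula us w by apply: IH; rewrite //= w0.
apply/allP => x; rewrite 3!inE => /or4P[/eqP->|/eqP->|/eqP->|].
- rewrite -qV2; apply: node; rewrite ?invr_eq0 //.
    by apply: gen_minus1 g _; right.
  by move=> *; apply: (formula_node1 hq three0) => //; right.
- apply: node => //; first by apply: gen_minus1 g _; left.
  by move=> *; apply: (formula_node1 hq three0) => //; left.
- have E : q ^+ 4 * w ^- 2 = (q ^+ 2 / w) ^+ 2 by field.
  rewrite E; apply: node.
  + by rewrite mulf_neq0 ?invr_eq0 ?expf_neq0.
  + have w2 : w ^- 2 \in all_ys us w by rewrite !inE eqxx orbT.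
    by apply: (gen_twist g w2 (or_introl erefl)); rewrite expr1.
  move=> uy1 uy2; apply: (formula_node3 hq three0) => //; apply: IH => //=.
    by rewrite us0 !mulf_neq0 ?invr_eq0 ?expf_neq0.
  (* Up to cube roots of unity, the new central value exchanges [w ^+ 2] and [w ^- 2], so genericity
     is inherited. *)
  move: g; rewrite /generic /=.
  have -> : ((q ^+ 2 / w) ^+ 2) ^+ 3 = (w ^- 2) ^+ 3 by field: hq.
  have -> : ((q ^+ 2 / w) ^- 2) ^+ 3 = (w ^+ 2) ^+ 3 by field: hq; rewrite w0 q0.
  rewrite !inE !negb_or => /and3P[/andP[n1 n2] n3 n4].
  by rewrite eq_sym n1 n2 n3 n4.
case/mem_twists=> v vus xE.
have v0 : v != 0 by apply: (allP us0).
have [b [u [uE u0 ux]]] : exists b u, [/\ u = (if b then (q ^+ 2 * v)^-1 else q ^+ 2 / v),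
     u != 0 & x = u ^+ 2].
  case: xE => ->.
    exists false, (q ^+ 2 / v); split=> //; last by field.
    by rewrite mulf_neq0 ?invr_eq0 ?expf_neq0.
  exists true, ((q ^+ 2 * v)^-1); split=> //; last by field: hq; rewrite v0 q0.
  by rewrite invr_eq0 mulf_neq0 ?expf_neq0.
have [l [r usE]] : exists l r, us = l ++ v :: r by case/splitPr: vus => l r; exists l, r.
have p : perm_eq us (v :: l ++ r) by rewrite usE perm_catC /= perm_cons perm_catC.
rewrite ux; apply: node => //.
  have v2 : v ^- 2 \in all_ys us w by rewrite !inE (sqs_mem vus).2 !orbT.
  case: xE => xE.
    by apply: (gen_twist g v2 (or_introl erefl)); rewrite -ux expr1.
  by apply: (gen_twist g v2 (or_intror erefl)); rewrite -ux -exprM.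
move=> uy1 uy2; rewrite usE; apply: formula_move; rewrite -?usE //=.
  by rewrite w0 u0.
have lr0 : all (predC1 0) (l ++ r).
  by move: us0; rewrite usE !all_cat /= => /and3P[-> _ ->].
have pu : perm_eq (u :: us) [:: u, v & l ++ r] by rewrite perm_cons.
apply: (formula_node2 hq three0 v0 lr0 w0 uE).
- by rewrite -(perm_uniq (perm_ys _ pu)).
- by rewrite -(perm_uniq (perm_ys _ pu)).
apply: IH; rewrite /= ?w0 //.
- by apply: leq_trans szn; rewrite /m (perm_size p) /=.
- by move: g; rewrite (gen_perm _ p) => /gen_cons[].
Qed.
End Interpolation.

(** * Specialization to equal parameters *)

Section Regularity.
Variables (F : fieldType) (q : F).

(* Laurent polynomials. *)
Definition regular (f : F -> F) :=
  exists K (p : {poly F}), forall r, r != 0 -> f r * r ^+ K = p.[r].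

Lemma regularC c : regular (fun=> c).
Proof. by exists 0%N, c%:P => r _; rewrite hornerC mulr1. Qed.

Lemma regularX : regular id.
Proof. by exists 0%N, 'X => r _; rewrite hornerX mulr1. Qed.

Lemma regularV : regular (fun r => r^-1).
Proof. by exists 1%N, 1 => r r0; rewrite hornerC mulVf. Qed.

Lemma regularM f g : regular f -> regular g -> regular (fun r => f r * g r).
Proof.
move=> [K [p pE]] [L [s sE]]; exists (K + L)%N, (p * s) => r r0.
by rewrite hornerM -pE // -sE // exprD; ring.
Qed.

Lemma regularD f g : regular f -> regular g -> regular (fun r => f r + g r).
Proof.
move=> [K [p pE]] [L [s sE]]; exists (K + L)%N, (p * 'X^L + s * 'X^K) => r r0.
by rewrite hornerD !hornerM !hornerXn -pE // -sE // exprD; ring.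
Qed.

Lemma eq_regular f g : f =1 g -> regular f -> regular g.
Proof. by move=> fg [K [p pE]]; exists K, p => r; rewrite -fg; apply: pE. Qed.

Lemma regularN f : regular f -> regular (fun r => - f r).
Proof.
move=> rf; apply: eq_regular (regularM (regularC (-1)) rf) => r.
by rewrite mulN1r.
Qed.

Lemma regularXn f k : regular f -> regular (fun r => f r ^+ k).
Proof.
move=> rf; elim: k => [|k IH]; first exact: regularC.
by apply: eq_regular (regularM rf IH) => r; rewrite exprS.
Qed.

(** [sg] inverts its argument, so arguments of weights must have Laurent inverses. *)
Definition birregular (f : F -> F) := regular f /\ regular (fun r => (f r)^-1).

Lemma birregularM f g : birregular f -> birregular g ->
  birregular (fun r => f r * g r).
Proof.
move=> [f1 f2] [g1 g2]; split; first exact: regularM.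
by apply: eq_regular (regularM f2 g2) => r; rewrite invfM.
Qed.

Lemma birregularV f : birregular f -> birregular (fun r => (f r)^-1).
Proof.
by move=> [f1 f2]; split=> //; apply: eq_regular f1 => r; rewrite invrK.
Qed.

Lemma birregularC c : birregular (fun=> c).
Proof. by split; apply: regularC. Qed.

Lemma birregularXn k : birregular (fun r => r ^+ k).
Proof.
split; first exact/regularXn/regularX.
by apply: eq_regular (regularXn k regularV) => r; rewrite exprVn.
Qed.

Lemma regular_sg f : birregular f -> regular (fun r => sg (f r)).
Proof. by move=> [f1 f2]; apply/regularD/regularN. Qed.

Lemma regular_wa y : birregular y -> regular (fun r => weight_a q (y r)).
Proof.
move=> yb; apply: (@regularM _ (fun=> _)); last exact: regularC.
by apply: regular_sg; apply: birregularM (birregularV yb); apply: birregularC.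
Qed.

Lemma regular_wb y : birregular y -> regular (fun r => weight_b q (y r)).
Proof.
move=> yb; apply: (@regularM _ (fun=> _)); last exact: regularC.
exact: regular_sg.
Qed.

Lemma regular_kb u : birregular u -> regular (fun r => boundary_weight q (u r)).
Proof.
move=> yb; apply: (@regularM _ (fun=> _)); last exact: regularC.
by apply: regular_sg; apply: birregularM yb; apply: birregularC.
Qed.

Definition sregular (f : F -> state F) := forall s, regular (fun r => f r s).

Lemma sregular_R0 y f : birregular y -> sregular f ->
  sregular (fun r => vertex_op q (y r) (f r)).
Proof.
move=> yb fr [|a [|b s]] /=; try exact: regularC.
case: (a == b); first by apply: regularM => //; apply: regular_wa.
by apply: regularD => //; apply: regularM => //; apply: regular_wb.
Qed.

Lemma sregular_K0 u f : birregular u -> sregular f ->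
  sregular (fun r => turn_op q (u r) (f r)).
Proof.
move=> yb fr [|a s] /=; try exact: regularC.
apply: regularD => //; apply: regularM => //.
by apply: regular_kb; apply: birregularV.
Qed.

Lemma sregular_cup u f : birregular u -> sregular f ->
  sregular (fun r => corner_op q (u r) (f r)).
Proof.
move=> yb fr [|a [|b s]] /=; try exact: regularC.
apply: regularM => //; case: (a == b); [exact: regular_kb | exact: regularC].
Qed.

Lemma sregular_lft (A : F -> op F) f :
  (forall g, sregular g -> sregular (fun r => A r (g r))) ->
  sregular f -> sregular (fun r => lft (A r) (f r)).
Proof.
move=> Ar fr [|a s] /=; first exact: fr.
by apply: (Ar (fun r t => f r (a :: t))) => t; apply: fr.
Qed.

Definition monomial (ck : F * nat) (r : F) := ck.1 * r ^+ ck.2.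

Lemma birregular_monomial ck : birregular (monomial ck).
Proof. exact: birregularM (birregularC _) (birregularXn _). Qed.

Lemma sregular_turn ck (vs : seq (F * nat)) f : sregular f ->
  sregular (fun r => turn q (monomial ck r) [seq monomial v r | v <- vs] (f r)).
Proof.
have ub := birregular_monomial ck.
elim: vs f => [|v vs IH] f fr; first exact: sregular_K0.
apply: (@sregular_lft (fun r => turn q _ [seq monomial v r | v <- vs])) => //.
apply: sregular_R0 => //; apply: birregularM; first exact: birregularC.
apply/birregularV/birregularM => //; exact: birregular_monomial.
Qed.

Lemma sregular_part (us : seq (F * nat)) w :
  sregular (fun r => part q [seq monomial u r | u <- us] (monomial w r)).
Proof.
elim: us => [|u us IH]; first by move=> s; apply: regularC.
pose vs := us ++ w :: rev us.
have H : sregular (fun r => row q (monomial u r) [seq monomial v r | v <- vs]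
    (part q [seq monomial u r | u <- us] (monomial w r))).
  apply: (@sregular_lft (fun r => turn q (monomial u r) [seq monomial v r | v <- vs])).
    by move=> g gr; apply: sregular_turn.
  by apply: sregular_cup => //; apply: birregular_monomial.
by move=> s; apply: eq_regular (H s) => r /=; rewrite map_cat /= map_rev.
Qed.

(** The formula holds for generic parameters only; this allows its continuation to [r = 1]. *)
Lemma regular_Z (us : seq (F * nat)) w :
  regular (fun r => partition_fun q [seq monomial u r | u <- us] (monomial w r)).
Proof.
by apply: eq_regular (sregular_part us w _) => r; rewrite /partition_fun size_map.
Qed.
End Regularity.

(** * Schur functions at geometric progressions *)

Section Geometric.
Variable F : fieldType.

(** Over a ring, so that it also applies to polynomials in [r], whose zero at 1 is divided out
    before evaluation. *)
Fixpoint diffprod (R : comRingType) (g : nat -> R) (es : seq nat) : R :=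
  if es is a :: s then \prod_(b <- s) (g b - g a) * diffprod g s else 1.

Lemma vander_map (g : nat -> F) es : vander [seq g k | k <- es] = diffprod g es.
Proof.
elim: es => [|a s IH] /=; first by rewrite /vander /alternant det_mx00.
by rewrite vander_cons IH big_map.
Qed.

(** [(t ^+ k) ^+ e j = (t ^+ e j) ^+ k]: transposition turns the alternant into a Vandermonde
    determinant. *)
Lemma alternant_geometric e (c t : F) N :
  alternant e [seq c * t ^+ k | k <- iota 0 N] =
  c ^+ (\sum_(j < N) e j) * vander [seq t ^+ e j | j <- iota 0 N].
Proof.
rewrite /vander /alternant !size_map size_iota.
have -> : alternant_mx e [seq c * t ^+ k | k <- iota 0 N] N =
    (alternant_mx id [seq t ^+ e j | j <- iota 0 N] N)^T *m diag_mx (\row_j c ^+ e j).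
  apply/matrixP => i j; rewrite mul_mx_diag !mxE !(nth_map 0%N) ?size_iota //.
  by rewrite !nth_iota // !add0n exprMn mulrC -!exprM mulnC.
rewrite det_mulmx det_tr det_diag mulrC; congr (_ * _).
by rewrite -prodrXr; apply: eq_bigr => j _; rewrite mxE.
Qed.

Lemma expo_even n : expo n.*2 = (3 * n)%N.
Proof. by rewrite /expo -addnn; lia. Qed.

Lemma expo_odd n : expo n.*2.+1 = (3 * n + 1)%N.
Proof. by rewrite /expo -addnn; lia. Qed.

(** The excess [n ^ 2] is the size of the partition (n, n - 1, n - 1, .., 1, 1), that is, the degree
    of the Schur function. *)
Lemma sum_expo n :
  (\sum_(j < n.*2.+1) expo j = \sum_(j < n.*2.+1) j + n ^ 2)%N.
Proof.
move: expo_even expo_odd; move: expo => e e0 e1.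
elim: n => [|n IH]; first by rewrite !big_ord1 (e0 0%N).
rewrite doubleS big_ord_recr [in RHS]big_ord_recr /=.
rewrite big_ord_recr [in RHS]big_ord_recr /= IH e1.
have := e0 n.+1; rewrite doubleS => ->; rewrite -addnn.
have -> : (n.+1 ^ 2 = n ^ 2 + 2 * n + 1)%N by rewrite -addn1 sqrnD; lia.
by move: (\sum_(j < (n + n).+1) j)%N (n ^ 2)%N => A B; lia.
Qed.

Lemma schur_geometric n (c t : F) : c != 0 ->
  schur [seq c * t ^+ k | k <- iota 0 n.*2.+1] = c ^+ (n ^ 2) *
    (vander [seq t ^+ expo j | j <- iota 0 n.*2.+1] /
     vander [seq t ^+ j | j <- iota 0 n.*2.+1]).
Proof.
move=> c0; rewrite /schur {1}/vander !alternant_geometric sum_expo exprD invfM.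
by rewrite [X in X * _ * _]mulrC -!mulrA; congr (_ * _); rewrite mulrCA mulVKf ?expf_neq0.
Qed.

Lemma diffprod_affine (R : comRingType) (c d : R) g es :
  diffprod (fun e => d + c * g e) es =
  c ^+ 'C(size es, 2) * diffprod g es.
Proof.
elim: es => [|a s IH] /=; first by rewrite mulr1.
rewrite IH binS bin1 exprD.
have -> : \prod_(b <- s) (d + c * g b - (d + c * g a)) =
    c ^+ size s * \prod_(b <- s) (g b - g a).
  elim: s {IH} => [|b s IH]; first by rewrite !big_nil mulr1.
  by rewrite !big_cons IH /= exprS; ring.
by ring.
Qed.

Lemma eq_diffprod (R : comRingType) (g h : nat -> R) es :
  g =1 h -> diffprod g es = diffprod h es.
Proof.
move=> gh; elim: es => //= a s ->; congr (_ * _).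
by apply: eq_bigr => b _; rewrite !gh.
Qed.

Lemma horner_diffprod (g : nat -> {poly F}) es x :
  (diffprod g es).[x] = diffprod (fun e => (g e).[x]) es.
Proof.
elim: es => [|a s IH] /=; first by rewrite hornerC.
rewrite hornerM IH horner_prod; congr (_ * _).
by apply: eq_bigr => b _; rewrite hornerD hornerN.
Qed.

End Geometric.

Lemma map_iota_ends (T : Type) (f : nat -> T) m :
  [seq f k | k <- iota 0 m.+2] =
  f 0%N :: rcons [seq f k.+1 | k <- iota 0 m] (f m.+1).
Proof.
rewrite -[iota 0 m.+2]/(0%N :: iota (1 + 0) m.+1) iotaDl map_cons -map_comp.
by congr (_ :: _); rewrite -[m.+1]addn1 iotaD map_cat cats1 /= addn1.
Qed.

Section Specialization.
Variables (F : numFieldType) (q : F).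
Hypothesis hq : q ^+ 4 = q ^+ 2 - 1.

(* With these parameters and [w = r ^+ (2 n + 1)], the arguments of the Schur
   functions form a geometric progression of ratio [r ^+ 4]. *)
Definition spec_us n (r : F) := [seq r ^+ (2 * i).+1 | i <- iota 0 n].

Lemma perm_sqs_spec n r : r != 0 ->
  perm_eq (sqs (spec_us n r))
    [seq r ^+ 2 / r ^+ (4 * n) * (r ^+ 4) ^+ k | k <- iota 0 n.*2].
Proof.
move=> r0; elim: n => [|n IH] //.
rewrite /spec_us -[n.+1]addn1 iotaD map_cat -/(spec_us n r) /=.
rewrite (perm_trans (perm_sqs (permEl (perm_catC _ _)))) //= sqs_cons.
rewrite add0n addn1 doubleS map_iota_ends.
have -> : r ^+ 2 / r ^+ (4 * n.+1) * (r ^+ 4) ^+ 0 = (r ^+ (2 * n).+1) ^- 2.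
  rewrite mulnS exprD -!exprM muln0.
  have -> : ((2 * n).+1 * 2 = 2 + 4 * n)%N by lia.
  by rewrite exprD; field; rewrite !expf_neq0.
have -> : r ^+ 2 / r ^+ (4 * n.+1) * (r ^+ 4) ^+ n.*2.+1 = (r ^+ (2 * n).+1) ^+ 2.
  rewrite mulnS !exprD -!exprM.
  have -> : ((2 * n).+1 * 2 = 2 + 4 * n)%N by lia.
  have -> : (4 * n.*2.+1 = 4 + (4 * n + 4 * n))%N by rewrite -addnn; lia.
  by rewrite !exprD; field; rewrite !expf_neq0.
have -> : [seq r ^+ 2 / r ^+ (4 * n.+1) * (r ^+ 4) ^+ k.+1 | k <- iota 0 n.*2] =
    [seq r ^+ 2 / r ^+ (4 * n) * (r ^+ 4) ^+ k | k <- iota 0 n.*2].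
  apply: eq_map => k; rewrite mulnS exprD [(r ^+ 4) ^+ k.+1]exprS.
  by field; rewrite !expf_neq0.
rewrite -cats1 -cat_cons perm_sym perm_catC /= perm_cons perm_cons perm_sym.
exact: IH.
Qed.

End Specialization.

Section Specialization.
Variables (F : numFieldType) (q : F).
Hypothesis hq : q ^+ 4 = q ^+ 2 - 1.

Local Notation es n := (iota 0 n.*2.+1).

Section FixedPoint.
Variables (n : nat) (r eps : F).
Hypotheses (r0 : r != 0) (eps2 : eps ^+ 2 = 1).
(** The lowest of the squares [r ^+ (4 i + 2)] and their inverses. [w ^+ 2] prolongs their
    progression at the upper end, [w ^- 2] at the lower end. *)
Let c := r ^+ 2 / r ^+ (4 * n).
Let w := eps * r ^+ (2 * n).+1.

Lemma w2E : w ^+ 2 = c * (r ^+ 4) ^+ n.*2.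
Proof.
rewrite /w /c exprMn eps2 mul1r -!exprM.
have -> : ((2 * n).+1 * 2 = 2 + 4 * n)%N by lia.
have -> : (4 * n.*2 = 4 * n + 4 * n)%N by rewrite -addnn; lia.
by rewrite !exprD; field; rewrite !expf_neq0.
Qed.

Lemma wV2E : w ^- 2 = c / r ^+ 4.
Proof.
rewrite /w /c exprMn eps2 mul1r -!exprM.
have -> : ((2 * n).+1 * 2 = 2 + 4 * n)%N by lia.
by rewrite !exprD; field; rewrite r0 !expf_neq0.
Qed.

Lemma perm_ys_spec : perm_eq (ys (spec_us n r) (w ^+ 2))
  [seq c * (r ^+ 4) ^+ k | k <- es n].
Proof.
rewrite -[n.*2.+1]addn1 iotaD map_cat add0n perm_sym perm_catC /= -w2E perm_cons perm_sym.
exact: perm_sqs_spec.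
Qed.

Lemma perm_ysV_spec : perm_eq (ys (spec_us n r) (w ^- 2))
  [seq c / r ^+ 4 * (r ^+ 4) ^+ k | k <- es n].
Proof.
rewrite -[es n]/(0%N :: iota (1 + 0) n.*2) iotaDl map_cons -map_comp expr0 mulr1.
rewrite /ys wV2E perm_cons; apply: (perm_trans (perm_sqs_spec _ r0)).
rewrite [X in perm_eq _ X](_ : _ = [seq c * (r ^+ 4) ^+ k | k <- iota 0 n.*2]) //.
by apply: eq_map => k /=; rewrite add1n [_ ^+ k.+1]exprS; field.
Qed.

Lemma gen_spec : {in xpredT &, injective (fun k => ((r ^+ 4) ^+ 3) ^+ k)} ->
  generic (spec_us n r) w.
Proof.
move=> inj; rewrite /generic.
have p : perm_eq (all_ys (spec_us n r) w) [seq c / r ^+ 4 * (r ^+ 4) ^+ k | k <- iota 0 n.*2.+2].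
  apply: (@perm_trans _ (w ^- 2 :: ys (spec_us n r) (w ^+ 2))).
    exact: permEl (perm_catCA [:: _] [:: _] _).
  rewrite -[iota 0 n.*2.+2]/(0%N :: iota (1 + 0) n.*2.+1) iotaDl map_cons -map_comp.
  rewrite expr0 mulr1 -wV2E perm_cons; apply: (perm_trans perm_ys_spec).
  rewrite [X in perm_eq _ X](_ : _ = [seq c * (r ^+ 4) ^+ k | k <- es n]) //.
  by apply: eq_map => k /=; rewrite wV2E add1n [_ ^+ k.+1]exprS; field.
rewrite (perm_uniq (perm_map _ p)) -map_comp map_inj_uniq ?iota_uniq //.
have d0 : c / r ^+ 4 != 0 by rewrite !mulf_neq0 ?invr_eq0 ?expf_neq0.
move=> k l /=; move: (r ^+ 4) (c / _) d0 inj => t d d0 inj; rewrite !exprMn => E.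
by apply: inj => //=; rewrite ![(t ^+ 3) ^+ _]exprAC; apply: mulfI E; rewrite expf_neq0.
Qed.

(** Both Schur functions are the same quotient of Vandermonde products up to a power of [r], so
    their sum contributes just [1 + eps * r]. The factor [r ^+ (4 * n ^ 3 + 4 * n ^ 2)] clears
    [c ^+ (n ^ 2)] and [(c / r ^+ 4) ^+ (n ^ 2)] of negative exponents. *)
Lemma Z_spec : {in xpredT &, injective (fun k => ((r ^+ 4) ^+ 3) ^+ k)} ->
  eps ^+ n * r ^+ ((2 * n).+1 * n + 4 * n ^ 3 + 4 * n ^ 2) *
    (1 + eps * r ^+ (2 * n).+1) * 3%:R ^+ 'C(n, 2) *
    partition_fun q (spec_us n r) w * diffprod (fun e => (r ^+ 4) ^+ e) (es n) =
  r ^+ (6 * n ^ 2 + 2 * n) * (1 + eps * r) *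
    diffprod (fun e => (r ^+ 4) ^+ expo e) (es n).
Proof.
move=> inj; have eps0 : eps != 0.
  by apply/eqP => E; move/eqP: eps2; rewrite E expr0n /= eq_sym oner_eq0.
have w0 : w != 0 by rewrite mulf_neq0 ?expf_neq0.
have c0 : c != 0 by rewrite mulf_neq0 ?invr_eq0 ?expf_neq0.
have szu : size (spec_us n r) = n by rewrite size_map size_iota.
have us0 : all (predC1 0) (w :: spec_us n r).
  by rewrite /= w0; apply/allP => _ /mapP[i _ ->] /=; rewrite expf_neq0.
have := @partition_function _ q hq _ _ _ _ us0 (gen_spec inj).
rewrite !pnatr_eq0 => /(_ isT isT); rewrite /schur_formula /rhs szu.
rewrite (schur_perm perm_ys_spec) (schur_perm perm_ysV_spec).
rewrite !schur_geometric ?mulf_neq0 ?invr_eq0 ?expf_neq0 //.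
rewrite !vander_map; set Ve := diffprod (fun e => (r ^+ 4) ^+ expo e) _; set V1 := diffprod _ _.
have V10 : V1 != 0.
  rewrite /V1 -vander_map vander_neq0 // map_inj_uniq ?iota_uniq // => k l E.
  by apply: inj => //=; rewrite ![((r ^+ 4) ^+ 3) ^+ _]exprAC E.
set C3 := 3%:R ^+ _; set Zn := partition_fun _ _ _.
move=> H.
have cE : c ^+ (n ^ 2) * r ^+ (4 * n ^ 3 + 4 * n ^ 2) = r ^+ (6 * n ^ 2).
  rewrite /c exprMn exprVn -!exprM.
  have -> : (4 * n * n ^ 2 = 4 * n ^ 3)%N by rewrite !expnS; lia.
  have -> : (6 * n ^ 2 = 2 * n ^ 2 + 4 * n ^ 2)%N by lia.
  by rewrite !exprD; field; rewrite expf_neq0.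
have cE2 : (c / r ^+ 4) ^+ (n ^ 2) * r ^+ (4 * n ^ 3 + 4 * n ^ 2) = r ^+ (2 * n ^ 2).
  rewrite exprMn exprVn -exprM mulrAC cE.
  have -> : (6 * n ^ 2 = 2 * n ^ 2 + 4 * n ^ 2)%N by lia.
  by rewrite exprD mulfK // expf_neq0.
have wn : w ^+ n = eps ^+ n * r ^+ ((2 * n).+1 * n) by rewrite /w exprMn -exprM.
have w2n : w ^+ n.*2 = r ^+ (4 * n ^ 2 + 2 * n).
  rewrite -mul2n exprM w2E /c -[n.*2]mul2n.
  have -> : r ^+ 2 / r ^+ (4 * n) * r ^+ 4 ^+ (2 * n) = r ^+ (4 * n + 2).
    rewrite -exprM; have -> : (4 * (2 * n) = 4 * n + 4 * n)%N by lia.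
    by rewrite !exprD; field; rewrite expf_neq0.
  by rewrite -exprM; congr (_ ^+ _); rewrite expnS expn1; lia.
transitivity (w ^+ n * (w + 1) * C3 * Zn * V1 * r ^+ (4 * n ^ 3 + 4 * n ^ 2)).
  rewrite wn -addnA exprD /w; ring.
rewrite H.
transitivity ((w * (c ^+ (n ^ 2) * r ^+ (4 * n ^ 3 + 4 * n ^ 2)) + w ^+ n.*2 *
  ((c / r ^+ 4) ^+ (n ^ 2) * r ^+ (4 * n ^ 3 + 4 * n ^ 2))) * Ve).
  by field.
rewrite cE cE2 w2n /w; congr (_ * _).
have -> : (6 * n ^ 2 = 2 * n ^ 2 + 4 * n ^ 2)%N by lia.
by rewrite exprS !exprD; ring.
Qed.
End FixedPoint.

(** 0 and 1 are left out as test points because [Z_spec] requires distinct powers of [r]. *)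
Lemma poly_eq_nat (p1 p2 : {poly F}) :
  (forall k : nat, p1.[k.+2%:R] = p2.[k.+2%:R]) -> p1 = p2.
Proof.
move=> E; apply/eqP; rewrite -subr_eq0; apply/eqP.
apply: (@roots_geq_poly_eq0 _ _ [seq k.+2%:R | k <- iota 0 (size (p1 - p2))]).
- by apply/allP => _ /mapP[k _ ->]; rewrite rootE hornerD hornerN E subrr.
- rewrite map_inj_uniq ?iota_uniq // => k l /eqP.
  by rewrite eqr_nat => /eqP[].
- by rewrite size_map size_iota.
Qed.

Lemma expr_nat_inj (k m : nat) : (0 < m)%N ->
  injective (fun j => (k.+2%:R ^+ m : F) ^+ j).
Proof.
move=> m0 i j /eqP; rewrite -!exprM -!natrX eqr_nat eqn_exp2l //.
by rewrite eqn_pmul2l // => /eqP.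
Qed.

Definition qint (m : nat) : {poly F} := \sum_(i < m) 'X^i.

Lemma qintE m : 'X^m = 1 + ('X - 1) * qint m.
Proof. by rewrite -subrX1 addrC subrK. Qed.

Lemma qint1 m : (qint m).[1] = m%:R.
Proof.
rewrite /qint horner_sum (eq_bigr (fun=> 1)) => [|i _].
  by rewrite sumr_const card_ord.
by rewrite hornerXn expr1n.
Qed.

Definition natdiff (g : nat -> nat) n : F :=
  diffprod (fun e => (g e)%:R) (es n).

Lemma Z_identity n eps : eps ^+ 2 = 1 -> exists p K N,
  p.[1] = partition_fun q (nseq n 1) eps /\
  (eps ^+ n)%:P * 'X^N * (1 + eps *: 'X^((2 * n).+1)) *
    (3%:R ^+ 'C(n, 2))%:P * p * diffprod (fun e => qint (4 * e)) (es n) =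
  'X^K * (1 + eps *: 'X) * diffprod (fun e => qint (4 * expo e)) (es n).
Proof.
move=> eps2; pose us := [seq (1 : F, (2 * i).+1) | i <- iota 0 n].
have usE r : [seq monomial u r | u <- us] = spec_us n r.
  by rewrite -map_comp; apply: eq_map => i; rewrite /monomial /= mul1r.
have [K [p pE]] := regular_Z q us (eps, (2 * n).+1).
exists p, (6 * n ^ 2 + 2 * n + K)%N, ((2 * n).+1 * n + 4 * n ^ 3 + 4 * n ^ 2)%N.
split.
  rewrite -pE ?oner_eq0 // expr1n mulr1 usE /monomial /= expr1n mulr1.
  have E s : [seq (1 : F) ^+ (2 * i).+1 | i <- s] = nseq (size s) 1.
    by elim: s => //= i s ->; rewrite expr1n.
  by rewrite /spec_us E size_iota.
have X1 : ('X - 1) ^+ 'C(size (es n), 2) != 0 :> {poly F}.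
  by rewrite expf_neq0 // polyXsubC_eq0.
apply: (mulIf X1); set LHS := _ * _; set RHS := _ * _.
have dE g : diffprod (fun e => 'X^(4 * g e)) (es n) =
    ('X - 1) ^+ 'C(size (es n), 2) * diffprod (fun e => qint (4 * g e)) (es n).
  by rewrite -(diffprod_affine _ 1); apply: eq_diffprod => e; apply: qintE.
transitivity ((eps ^+ n)%:P * 'X^((2 * n).+1 * n + 4 * n ^ 3 + 4 * n ^ 2) *
    (1 + eps *: 'X^((2 * n).+1)) *
    (3%:R ^+ 'C(n, 2))%:P * p * diffprod (fun e => 'X^(4 * e)) (es n)).
  by rewrite (dE id) /LHS; ring.
transitivity ('X^(6 * n ^ 2 + 2 * n + K) * (1 + eps *: 'X) *
    diffprod (fun e => 'X^(4 * expo e)) (es n)); last first.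
  by rewrite dE /RHS; ring.
apply: poly_eq_nat => k; set r := k.+2%:R.
have r0 : r != 0 by rewrite pnatr_eq0.
have inj : {in xpredT &, injective (fun k => ((r ^+ 4) ^+ 3) ^+ k)}.
  move=> i j _ _ /= E; apply: (@expr_nat_inj k (4 * 3) isT).
  by rewrite (exprM r 4 3).
have := Z_spec n r0 eps2 inj.
have hE g : (diffprod (fun e => 'X^(4 * g e)) (es n)).[r] =
    diffprod (fun e => (r ^+ 4) ^+ g e) (es n).
  by rewrite horner_diffprod; apply: eq_diffprod => e; rewrite hornerXn exprM.
move: (hE id) (hE expo); rewrite /id.
move: (diffprod (fun e => 'X^(4 * e)) _) (diffprod (fun e => 'X^(4 * expo e)) _).
move=> D1 D2 D1E D2E.
rewrite !(hornerM, hornerC, hornerD, hornerZ, hornerXn, hornerX) D1E D2E -pE //.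
rewrite usE -[monomial _ _]/(eps * r ^+ (2 * n).+1) => H; rewrite [r ^+ (_ + K)]exprD.
transitivity (r ^+ K * (r ^+ (6 * n ^ 2 + 2 * n) * (1 + eps * r) *
    diffprod (fun e => (r ^+ 4) ^+ expo e) (es n))); last by ring.
by rewrite -H; ring.
Qed.

Lemma horner1_diffprod (g : nat -> nat) n :
  (diffprod (fun e => qint (4 * g e)) (es n)).[1] =
  4%:R ^+ 'C(size (es n), 2) * natdiff g n.
Proof.
rewrite horner_diffprod -(diffprod_affine _ 0); apply: eq_diffprod => e.
by rewrite qint1 natrM add0r.
Qed.

Lemma Z_one n :
  3%:R ^+ 'C(n, 2) * partition_fun q (nseq n 1) 1 * natdiff id n = natdiff expo n.
Proof.
have [p [K [N [<- E]]]] := @Z_identity n 1 (expr1n _ 2).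
have h1 : (diffprod (fun e => qint (4 * e)) (es n)).[1] =
  4%:R ^+ 'C(size (es n), 2) * natdiff id n := horner1_diffprod id n.
move: h1 (horner1_diffprod expo n) E.
move: (diffprod (fun e => qint (4 * e)) _) (diffprod (fun e => qint (4 * expo e)) _).
move=> D1 D2 D1E D2E.
move/(congr1 (fun p : {poly F} => p.[1])).
rewrite !(hornerM, hornerC, hornerD, hornerZ, hornerXn, hornerX) D1E D2E.
rewrite !expr1n !mul1r -[1 + 1]/(2%:R).
have nz : 2%:R * 4%:R ^+ 'C(size (es n), 2) != 0 :> F.
  by rewrite mulf_neq0 ?expf_neq0 ?pnatr_eq0.
by move=> H; apply: (mulfI nz); rewrite -[RHS]mulrA -H; ring.
Qed.

(** For [eps = -1] one more factor ['X - 1] cancels, from [1 - 'X^(2 n + 1)] against [1 - 'X]; the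
    quotient has value 2 n + 1 at 1. *)
Lemma Z_minus_one n :
  (-1) ^+ n * (2 * n + 1)%:R * 3%:R ^+ 'C(n, 2) * partition_fun q (nseq n 1) (-1) * natdiff id n =
  natdiff expo n.
Proof.
have [p [K [N [<- E]]]] := @Z_identity n (-1) (sqrr_sign _ 1).
have h1 : (diffprod (fun e => qint (4 * e)) (es n)).[1] =
  4%:R ^+ 'C(size (es n), 2) * natdiff id n := horner1_diffprod id n.
move: h1 (horner1_diffprod expo n) E.
move: (diffprod (fun e => qint (4 * e)) _) (diffprod (fun e => qint (4 * expo e)) _).
move=> D1 D2 D1E D2E.
have f1 m : 1 + (-1) *: 'X^m = - ('X - 1) * qint m :> {poly F}.
  by rewrite scaleN1r qintE; ring.
have X1 : - ('X - 1) != 0 :> {poly F} by rewrite oppr_eq0 polyXsubC_eq0.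
rewrite f1 -[X in 1 + _ *: X]expr1 f1 => E.
have {}E : ((-1) ^+ n)%:P * 'X^N * qint (2 * n).+1 *
    (3%:R ^+ 'C(n, 2))%:P * p * D1 = 'X^K * D2.
  apply: (mulfI X1); transitivity ('X^K * (- ('X - 1) * qint 1) * D2).
    by rewrite -E; ring.
  by rewrite /qint big_ord1 expr0; ring.
move: E => /(congr1 (fun p : {poly F} => p.[1])).
rewrite !(hornerM, hornerC, hornerXn) D1E D2E qint1 !expr1n mulr1 mul1r.
have nz : 4%:R ^+ 'C(size (es n), 2) != 0 :> F by rewrite expf_neq0 ?pnatr_eq0.
by move=> H; apply: (mulfI nz); rewrite -H addn1; ring.
Qed.
End Specialization.

(** * The product formula *)

Section Products.
Variable F : numFieldType.

Lemma diffprod_rcons (g : nat -> F) s a :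
  diffprod g (rcons s a) = diffprod g s * \prod_(b <- s) (g a - g b).
Proof.
elim: s => [|b s IH] /=; first by rewrite !big_nil mulr1.
by rewrite IH big_cons -cats1 big_cat big_seq1 /=; ring.
Qed.

Lemma iota_rcons m : iota 0 m.+1 = rcons (iota 0 m) m.
Proof. by rewrite -[m.+1]addn1 iotaD cats1. Qed.

Definition tailprod (g : nat -> nat) m : F :=
  \prod_(0 <= b < m) ((g m)%:R - (g b)%:R).

Lemma natdiffS g n : natdiff F g n.+1 =
  natdiff F g n * tailprod g n.*2.+1 * tailprod g n.*2.+2.
Proof.
rewrite /natdiff doubleS iota_rcons diffprod_rcons iota_rcons diffprod_rcons.
by rewrite -iota_rcons /tailprod /index_iota !subn0.
Qed.

Lemma tailprod_id m : tailprod id m = m`!%:R.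
Proof.
rewrite /tailprod fact_prod natr_prod big_nat_rev add0n.
rewrite [RHS]big_add1 /=; apply: eq_big_nat => i /andP[_ im].
by rewrite -natrB ?leq_subr // subKn.
Qed.

(** Shifting both indices by 2 preserves differences, as [expo] grows by 3; only the factors for the
    exponents 0 and 1 are new. *)
Lemma tailprod_expoSS m :
  tailprod expo m.+2 = (expo m.+2)%:R * ((expo m.+2)%:R - 1) * tailprod expo m.
Proof.
have eS j : expo j.+2 = (expo j + 3)%N by rewrite /expo; lia.
have [e0 e1] : expo 0 = 0%N /\ expo 1 = 1%N by [].
move: expo eS e0 e1 => e eS e0 e1.
rewrite /tailprod big_nat_recl // big_nat_recl //= e0 e1 subr0 mulrA.
congr (_ * _); apply: eq_big_nat => i _.
by rewrite !eS !natrD; ring.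
Qed.

Lemma tailprod_expo n :
  tailprod expo n.*2.+1 * tailprod expo n.*2.+2 =
  ((3 * n + 3)`! * 3 ^ n * n`!)%:R.
Proof.
elim: n => [|n IH].
  have -> : ((3 * 0 + 3)`! * 3 ^ 0 * 0`! = 6)%N by [].
  by rewrite /tailprod !big_nat_recr //= !big_geq // /expo /=; ring.
rewrite !doubleS tailprod_expoSS tailprod_expoSS.
have e1 : expo n.*2.+3 = (3 * n + 4)%N by rewrite /expo -addnn; lia.
have e2 : expo n.*2.+4 = (3 * n + 6)%N by rewrite /expo -addnn; lia.
rewrite e1 e2.
transitivity ((3 * n + 4)%:R * ((3 * n + 4)%:R - 1) * ((3 * n + 6)%:R * ((3 * n + 6)%:R - 1)) *
   ((3 * n + 3)`! * 3 ^ n * n`!)%:R : F); first by rewrite -IH; ring.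
have -> : (3 * n.+1 + 3 = (3 * n + 3).+3)%N by lia.
by rewrite !factS expnS; ring.
Qed.

(** The power of 3 is the one in [Z_one], so the total number is the plain product of
    [(3 * i)! / (n + i)!]. *)
Lemma natdiff_expo n :
  natdiff F expo n * \prod_(0 <= i < n.+1) (n + i)`!%:R =
  3%:R ^+ 'C(n, 2) * \prod_(0 <= i < n.+1) (3 * i)`!%:R * natdiff F id n.
Proof.
elim: n => [|n IH].
  by rewrite !big_nat1 /natdiff /= !big_nil; ring.
(* From [n] to [n + 1] the factorial of [n] leaves the product, and those of 2 n + 1 and 2 n + 2
   enter. *)
have B : n`!%:R * \prod_(0 <= i < n.+2) (n.+1 + i)`!%:R =
   \prod_(0 <= i < n.+1) (n + i)`!%:R * (n.*2.+1)`!%:R * (n.*2.+2)`!%:R :> F.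
  rewrite [in LHS]big_nat_recr //= [in LHS]big_nat_recr //=.
  have -> : (n.+1 + n.+1 = n.*2.+2)%N by rewrite -addnn; lia.
  have -> : (n.+1 + n = n.*2.+1)%N by rewrite -addnn; lia.
  rewrite !mulrA; congr (_ * _ * _).
  by rewrite [in RHS]big_nat_recl // addn0; congr (_ * _);
    apply: eq_big_nat => i _; rewrite addSnnS.
have n0 : n`!%:R != 0 :> F by rewrite pnatr_eq0 -lt0n fact_gt0.
apply: (mulIf n0); rewrite !natdiffS !tailprod_id -[natdiff F expo n * _ * _]mulrA tailprod_expo.
rewrite [in RHS]big_nat_recr //=; have -> : (3 * n.+1 = 3 * n + 3)%N by lia.
rewrite binS bin1 exprD.
transitivity (natdiff F expo n * ((3 * n + 3)`! * 3 ^ n * n`!)%:R *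
  (n`!%:R * \prod_(0 <= i < n.+2) (n.+1 + i)`!%:R)); first by ring.
rewrite B.
transitivity ((natdiff F expo n * \prod_(0 <= i < n.+1) (n + i)`!%:R) *
  ((3 * n + 3)`! * 3 ^ n * n`!)%:R * (n.*2.+1)`!%:R * (n.*2.+2)`!%:R); first by ring.
by rewrite IH !natrM natrX; ring.
Qed.
End Products.

(** * Alternating sign matrices and configurations *)

Section Lines.

Definition isbit (x : int) := (x == 0) || (x == 1).

Fixpoint bits (b : int) (s : seq int) : bool :=
  if s is x :: s' then isbit (b + x) && bits (b + x) s' else true.

Lemma isbitP x : isbit x -> x = 0 \/ x = 1.
Proof. by move=> /orP[] /eqP; auto. Qed.

(** A partial sum [b] reveals the last nonzero entry, [2 * b - 1]; an initial [b = 0] acts as a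
    preceding -1. *)
Lemma bits_path b s : isbit b -> all (mem asm_values) s ->
  bits b s = path [rel x y | x * y < 0] (2 * b - 1) [seq x <- s | x != 0].
Proof.
elim: s b => //= x s IH b /isbitP hb /andP[].
rewrite !inE => /or3P[] /eqP -> vs.
- rewrite addr0 eqxx /=; case: hb => -> /=; exact: IH.
- by rewrite /=; case: hb => -> /=; rewrite ?IH.
- by rewrite /=; case: hb => -> /=; rewrite ?IH.
Qed.

Lemma bits_sum b s : isbit b -> bits b s -> isbit (b + \sum_(x <- s) x).
Proof.
elim: s b => [|x s IH] b hb /=; first by rewrite big_nil addr0.
by case/andP=> hbx /IH; rewrite big_cons addrA; apply.
Qed.

(** Alternation alone allows a first nonzero entry -1, but then the sum is -1 or 0. *)
Lemma asm_lineE s : all (mem asm_values) s ->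
  asm_line s = bits 0 s && (\sum_(x <- s) x == 1).
Proof.
move=> vs; rewrite /asm_line; case: eqP => [E|]; last by rewrite !andbF.
rewrite !andbT /alternating; apply/idP/idP; last first.
  by rewrite bits_path //; apply: path_sorted.
elim: s vs E => //= x s IH /andP[vx vs] E.
move: vx; rewrite !inE => /or3P[] /eqP xE; rewrite xE /= in E *.
- by apply: IH => //; move: E; rewrite big_cons add0r.
- by rewrite bits_path.
rewrite -[-1](_ : 2 * 0 - 1 = _) // -bits_path // => /(@bits_sum 0 s erefl).
by rewrite add0r; move: E; rewrite big_cons; move: (\sum_(_ <- _) _) => y; rewrite /isbit; lia.
Qed.

Lemma bitsP b s : bits b s <->
  forall k, (k < size s)%N -> isbit (b + \sum_(0 <= l < k.+1) s`_l).
Proof.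
elim: s b => [|x s IH] b /=; first by split.
split=> [/andP[bx /IH H] [|k]|H].
- by rewrite big_nat1.
- by rewrite ltnS => /H; rewrite [in X in _ -> X]big_nat_recl // addrA.
apply/andP; split; first by have := H 0%N isT; rewrite big_nat1.
by apply/IH => k ks; have := H k.+1 ks; rewrite big_nat_recl //= addrA.
Qed.

(* The nonzero entries of a line alternate and have sum 1 if and only if all its
   partial sums are 0 or 1 and its total is 1. *)
Definition dasasm_fun m (G : nat -> nat -> int) :=
  [/\ forall i j, (i < m)%N -> (j < m)%N -> G i j \in asm_values,
      forall i j, (i < m)%N -> (j <= m)%N -> isbit (\sum_(0 <= l < j) G i l),
      forall i, (i < m)%N -> \sum_(0 <= l < m) G i l = 1,
      forall i j, (i < m)%N -> (j < m)%N -> G i j = G j i &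
      forall i j, (i < m)%N -> (j < m)%N ->
         G i j = G (m - i.+1)%N (m - j.+1)%N].

Lemma row_mkseq m (f : nat -> int) : [seq f j | j : 'I_m] = mkseq f m.
Proof. by rewrite /mkseq -val_enum_ord -map_comp. Qed.

Lemma asm_line_mkseq m f : (forall j, (j < m)%N -> f j \in asm_values) ->
  asm_line (mkseq f m) <->
  (forall j, (j <= m)%N -> isbit (\sum_(0 <= l < j) f l)) /\
  \sum_(0 <= l < m) f l = 1.
Proof.
move=> vf; rewrite asm_lineE; last first.
  by apply/allP => x /mapP[j]; rewrite mem_iota => /andP[_ jm] ->; apply: vf.
have -> : \sum_(x <- mkseq f m) x = \sum_(0 <= l < m) f l.
  by rewrite big_map /index_iota subn0.
have sumE k : (k <= m)%N ->
    \sum_(0 <= l < k) (mkseq f m)`_l = \sum_(0 <= l < k) f l.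
  by move=> km; apply: eq_big_nat => l /andP[_ lk]; rewrite nth_mkseq // (leq_trans lk).
split=> [/andP[/bitsP H /eqP->]|[H ->]].
  split=> // -[|j] jm; first by rewrite big_geq.
  by have := H j; rewrite size_mkseq add0r sumE //; apply.
rewrite eqxx andbT; apply/bitsP => k; rewrite size_mkseq => km.
by rewrite add0r sumE //; apply: H.
Qed.

(** Columns inherit the row conditions by transposition. The two reflections compose to the
    half-turn, which stands in for the antidiagonal one. *)
Lemma is_DASASM_fun m (G : nat -> nat -> int) :
  is_DASASM (\matrix_(i < m, j < m) G i j) <-> dasasm_fun m G.
Proof.
have rowE (i : 'I_m) : [seq (\matrix_(i < m, j < m) G i j) i j | j : 'I_m] = mkseq (G i) m.
  by rewrite -row_mkseq; apply: eq_map => j; rewrite mxE.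
have colE (j : 'I_m) : [seq (\matrix_(i < m, j < m) G i j) i j | i : 'I_m] = mkseq (G ^~ j) m.
  by rewrite -row_mkseq; apply: eq_map => i; rewrite mxE.
split.
  case/andP=> /and3P[/forallP v /forallP r _] /forallP sy.
  have v' i j : (i < m)%N -> (j < m)%N -> G i j \in asm_values.
    by move=> im jm; have /forallP/(_ (Ordinal jm)) := v (Ordinal im); rewrite mxE.
  have sy' i j (im : (i < m)%N) (jm : (j < m)%N) := forallP (sy (Ordinal im)) (Ordinal jm).
  split=> //.
  - move=> i j im jm; have := r (Ordinal im); rewrite rowE => /asm_line_mkseq[].
      by move=> k km; apply: v'.
    by move=> H _; apply: H.
  - move=> i im; have := r (Ordinal im); rewrite rowE => /asm_line_mkseq[] //.
    by move=> k km; apply: v'.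
  - by move=> i j im jm; have := sy' i j im jm; rewrite !mxE => /andP[/eqP].
  - by move=> i j im jm; have := sy' j i jm im; rewrite !mxE => /andP[_ /eqP].
case=> v r t s1 s2; apply/andP; split; last first.
  apply/forallP => i; apply/forallP => j; rewrite !mxE.
  by apply/andP; split; apply/eqP; [apply: s1 | apply: s2].
apply/and3P; split.
- by apply/forallP => i; apply/forallP => j; rewrite mxE v.
- apply/forallP => i; rewrite rowE; apply/asm_line_mkseq => [j jm|]; first exact: v.
  by split=> [j jm|]; [apply: r | apply: t].
- apply/forallP => j; rewrite colE; apply/asm_line_mkseq => [i im|]; first exact: v.
  have E k : (k <= m)%N -> \sum_(0 <= l < k) G l j = \sum_(0 <= l < k) G j l.
    by move=> km; apply: eq_big_nat => l /andP[_ lk]; rewrite s1 // (leq_trans lk).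
  by split=> [i im|]; rewrite E //; [apply: r | apply: t].
Qed.

End Lines.

(* [valid_row ps h qs] holds if partial row sums that are 0 or 1 can be
   completed in a row with column sums [ps] above and [qs] below and partial sum
   [h] on the left; the last column of [ps] meets the antidiagonal, where any
   value is allowed. In a configuration [h] and [qs] are stored as [h :: qs]. *)
Fixpoint valid_row (ps : seq bool) (h : bool) (qs : seq bool) : bool :=
  match ps, qs with
  | [:: _], [::] => true
  | p :: ps', b :: qs' =>
      if h == b then (p == h) && valid_row ps' h qs' else valid_row ps' (~~ p) qs'
  | _, _ => false
  end.

Fixpoint valid_conf (s : seq bool) (t : seq (seq bool)) : bool :=
  match s, t with
  | [:: _], [::] => true
  | _ :: ps, (h :: qs) :: t' => valid_row ps h qs && valid_conf qs t'
  | _, _ => false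
  end.

(** Rows are generated from the turn leftwards: [x] begins with the bit to the right of the vertex,
    an output with the bit to its left and the column bit below. The cases are those of
    [vertex_op]. *)
Definition vertex_outputs (p : bool) (x : seq bool) : seq (seq bool) :=
  if x is h :: qs then
    if p == h then [:: [:: p, p & qs]] else [:: [:: p, h & qs]; [:: h, p & qs]]
  else [::].

Fixpoint turn_outputs (ps : seq bool) : seq (seq bool) :=
  match ps with
  | [::] => [::]
  | [:: _] => [:: [:: true]; [:: false]]
  | p :: ps' => flatten [seq vertex_outputs p x | x <- turn_outputs ps']
  end.

Fixpoint confs n (s : seq bool) : seq (seq (seq bool)) :=
  if n is m.+1 then
    flatten [seq [seq x :: t | t <- confs m (behead x)] | x <- turn_outputs (behead s)]
  else [:: [::]].

Lemma valid_row_cons p p2 ps h b qs : valid_row [:: p, p2 & ps] h (b :: qs) =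
  if h == b then (p == h) && valid_row (p2 :: ps) h qs
  else valid_row (p2 :: ps) (~~ p) qs.
Proof. by []. Qed.

Lemma mem_turn_outputs ps x :
  x \in turn_outputs ps = if x is h :: qs then valid_row ps h qs else false.
Proof.
elim: ps x => [|p [|p2 ps] IH] x; first by case: x => [|? []].
  by case: x => [|[] [|? ?]] //=; case: ifP; rewrite ?andbF.
rewrite [turn_outputs _]/=; apply/flattenP/idP.
  case=> _ /mapP[y + ->]; rewrite IH; case: y => // h qs hq.
  rewrite /vertex_outputs; case: eqVneq => [ph|ph].
    by rewrite inE => /eqP ->; rewrite valid_row_cons eqxx ph.
  have {}ph : h = ~~ p by move: ph; case: (p); case: (h).
  rewrite !inE ph in hq * => /orP[] /eqP ->; rewrite valid_row_cons.
    by case: (p) hq.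
  by case: (p) hq.
case: x => // h [|b qs]; first by [].
rewrite valid_row_cons; case: eqVneq => [-> /andP[/eqP -> ok]|hb ok].
  exists (vertex_outputs b (b :: qs)); last by rewrite /= eqxx inE.
  by apply/mapP; exists (b :: qs); rewrite // IH.
exists (vertex_outputs p (~~ p :: qs)).
  by apply/mapP; exists (~~ p :: qs); rewrite // IH.
by rewrite /=; move: hb; case: (p); case: (h); case: (b); rewrite //= !inE eqxx ?orbT.
Qed.

Lemma uniq_flatten_map (T T' : eqType) (f : T -> seq T') s : uniq s ->
  (forall x, x \in s -> uniq (f x)) ->
  (forall x y z, x \in s -> y \in s -> z \in f x -> z \in f y -> x = y) ->
  uniq (flatten [seq f x | x <- s]).
Proof.
elim: s => //= x s IH /andP[xs us] uf dis; rewrite cat_uniq uf ?mem_head //=.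
rewrite IH //; first last.
- by move=> y z t ys zs; apply: dis; rewrite inE ?ys ?zs orbT.
- by move=> y ys; apply: uf; rewrite inE ys orbT.
rewrite andbT; apply/hasPn => z /flatten_mapP[y ys zy]; apply/negP => zx.
move/negP: xs; apply; rewrite (dis x y z) ?mem_head // inE ys orbT //.
Qed.

Lemma uniq_turn_outputs ps : uniq (turn_outputs ps).
Proof.
elim: ps => [|p [|p2 ps] IH] //; rewrite [turn_outputs _]/=.
apply: uniq_flatten_map => // [[|h qs] _ //|x y z].
  rewrite /vertex_outputs; case: eqVneq => //= ph.
  by rewrite inE andbT; apply: contra ph => /eqP[->].
case: x y => [|h qs] [|h' qs'] // _ _; rewrite /vertex_outputs.
by case: (p); case: h; case: h'; rewrite /= !inE => H1 H2; move: H1 H2;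
  do ?[case/orP]; move=> /eqP ->; do ?[case/orP]; move=> /eqP // -[->].
Qed.

Lemma valid_row_size ps h qs : valid_row ps h qs -> size ps = (size qs).+1.
Proof.
elim: ps h qs => // p [|p2 ps] IH h [|b qs] //.
  by rewrite /=; case: ifP; rewrite ?andbF.
by rewrite valid_row_cons; case: ifP => _ => [/andP[_]|] /IH /= ->.
Qed.

Lemma mem_confs n s t : size s = n.*2.+1 -> (t \in confs n s) = valid_conf s t.
Proof.
elim: n s t => [|n IH] s t /=.
  by case: s => // a [] // _; case: t => [|[|h qs] t].
case: s => // a ps [szps]; apply/flatten_mapP/idP.
  case=> x; rewrite mem_turn_outputs => xok /mapP[t' t'in ->].
  case: x xok t'in => // h qs ok; rewrite IH => [qt|].
    by case: ps szps ok => //= p ps _ ->.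
  by have := valid_row_size ok; rewrite szps => -[].
case: t => [|[|h qs] t]; rewrite /= ?if_same; case: ps szps => // p ps szps //.
case/andP=> ok qt; exists (h :: qs); first by rewrite mem_turn_outputs.
apply/mapP; exists t; rewrite // IH //.
by have := valid_row_size ok; rewrite szps => -[].
Qed.

Lemma uniq_confs n s : uniq (confs n s).
Proof.
elim: n s => //= n IH s; apply: uniq_flatten_map.
- exact: uniq_turn_outputs.
- by move=> x _; rewrite map_inj_uniq ?IH // => t t' [].
- by move=> x y z _ _ /mapP[t _ ->] /mapP[t' _ []].
Qed.

(** * The partition function as a signed sum over configurations *)

Section Weights.
Variables (F : numFieldType) (q : F).
Hypothesis hq : q ^+ 4 = q ^+ 2 - 1.
Let q0 : q != 0 := q_neq0 hq.

Lemma unit_weights v : v = 1 \/ v = -1 ->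
  weight_a q (vertex_param q 1 v) = v /\ weight_b q (vertex_param q 1 v) = v.
Proof.
have three0 : 3%:R != 0 :> F by rewrite pnatr_eq0.
move=> vE; have v0 : v != 0 by case: vE => ->; rewrite ?oppr_eq0 oner_eq0.
have s0 := sgq4_neq0 q0 (q8_neq1 hq three0).
rewrite (waE hq) ?oner_eq0 // wbE sgq4E // in s0 *.
by split; case: vE => ->; apply: (mulIf s0); rewrite mulfVK //; field: hq.
Qed.

Lemma kb1 : boundary_weight q 1 = 1.
Proof. by rewrite /boundary_weight mulr1 divff // sgq_neq0 // q2_neq1. Qed.

(** By [unit_weights] both a and b equal [v], and these are the vertices that preserve the column
    bit. *)
Fixpoint turn_weight (vs : seq F) (ps qs : seq bool) : F :=
  match vs, ps, qs with
  | v :: vs', p :: ps', b :: qs' =>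
      (if p == b then v else 1) * turn_weight vs' ps' qs'
  | _, _, _ => 1
  end.

Lemma turn_sum vs ps f : (forall v, v \in vs -> v = 1 \/ v = -1) ->
  size ps = (size vs).+1 ->
  turn q 1 vs f ps =
  \sum_(x <- turn_outputs ps) turn_weight vs ps (behead x) * f x.
Proof.
elim: vs ps f => [|v vs IH] [|p ps] f // vE [szp].
  case: ps szp => // _; rewrite /= invr1 kb1 !big_cons big_nil.
  by case: p => /=; ring.
case: ps szp => // p2 ps szp.
have [ea eb] := unit_weights (vE v (mem_head _ _)).
rewrite [turn _ _ _ _ _]/= IH //; last by move=> v' v'in; apply: vE; rewrite inE v'in orbT.
rewrite [turn_outputs (p :: _)]/= big_flatten big_map.
rewrite !big_seq; apply: eq_bigr => x; rewrite mem_turn_outputs.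
case: x => // h qs _; rewrite /= ea eb.
by case: (p); case: (h); rewrite /= ?big_cons big_nil /=; ring.
Qed.

Definition center_bit (s : seq bool) := nth false s (size s)./2.

(** All parameters but the central one are 1, so the bits of the central column decide the
    weight. *)
Fixpoint conf_weight (eps : F) (s : seq bool) (t : seq (seq bool)) : F :=
  if t is x :: t' then
    (if center_bit s == center_bit (behead x) then eps else 1) *
    conf_weight eps (behead x) t'
  else 1.

Lemma turn_weight_center m m' eps ps qs : (m < size ps)%N -> (m < size qs)%N ->
  turn_weight (nseq m 1 ++ eps :: nseq m' 1) ps qs =
  if nth false ps m == nth false qs m then eps else 1.
Proof.
have ones k ps' qs' : turn_weight (nseq k 1) ps' qs' = 1.
  by elim: k ps' qs' => [|k IH] [|? ?] [|? ?] //=; rewrite IH if_same mulr1.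
elim: m ps qs => [|m IH] [|p ps] [|b qs] //= mp mq.
  by rewrite ones mulr1.
by rewrite IH // if_same mul1r.
Qed.

Lemma part_sum n eps s : eps = 1 \/ eps = -1 -> size s = n.*2.+1 ->
  part q (nseq n 1) eps s = \sum_(t <- confs n s) conf_weight eps s t.
Proof.
move=> epsE; elim: n s => [|n IH] s szs.
  by rewrite /= big_seq1 /=; case: s szs.
case: s szs => // a ps [szps]; rewrite [part _ _ _]/= /row /=.
rewrite turn_sum; first last.
- by rewrite size_cat /= size_rev !size_nseq addnS addnn szps.
- move=> v; rewrite mem_cat inE mem_rev !mem_nseq.
  by case/or3P=> [/andP[_ /eqP]|/eqP->//|/andP[_ /eqP]]; auto.
rewrite /= big_flatten big_map !big_seq; apply: eq_bigr => x.
rewrite mem_turn_outputs; case: x => // h qs ok.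
have szq : size qs = n.*2.+1 by have := valid_row_size ok; rewrite szps => -[].
rewrite big_map /= -mulr_sumr -IH //.
have -> : rev (nseq n (1 : F)) = nseq n 1.
  apply: (@eq_from_nth _ 0); rewrite size_rev // size_nseq => i im.
  by rewrite nth_rev ?size_nseq // !nth_nseq im subnS; case: ltnP => //; lia.
rewrite turn_weight_center ?szps ?szq; try by rewrite -addnn; lia.
rewrite /center_bit [size (a :: ps)]/= szps szq.
have -> : (n.+1.*2.+1)./2 = n.+1 by rewrite -addnn; lia.
have -> : (n.*2.+1)./2 = n by rewrite -addnn; lia.
by rewrite kb1 if_same mul1r.
Qed.
End Weights.

Definition b2z (b : bool) : int := b%:R.

Lemma isbit_b2z b : isbit (b2z b). Proof. by case: b. Qed.

Lemma valid_row_bits ps h qs : valid_row ps h qs <->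
  size ps = (size qs).+1 /\
  forall k, (k <= size qs)%N -> isbit (b2z h +
    \sum_(0 <= l < k) (b2z (nth false qs l) - b2z (nth false ps l))).
Proof.
elim: ps h qs => [|p [|p2 ps] IH] h [|b qs].
- by split=> // -[].
- by split=> // -[].
- split=> // _; split=> // -[|k] // _; by rewrite big_geq // addr0 isbit_b2z.
- rewrite /=; case: ifP => _; rewrite ?andbF; split=> // -[]; by case: qs.
- by split=> // -[].
rewrite valid_row_cons; split.
  move=> H; have [h1 [hE /IH[[sz] ok]]] : exists h1 : bool,
     b2z h1 = b2z h + (b2z b - b2z p) /\ valid_row (p2 :: ps) h1 qs.
    move: H; case: eqVneq => [-> /andP[/eqP -> H]|hb H].
      by exists b; split=> //; ring.
    by exists (~~ p); split=> //; move: hb; case: (h); case: (b); case: (p).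
  split; first by rewrite /= -sz.
  case=> [|k] kq; first by rewrite big_geq // addr0 isbit_b2z.
  by rewrite big_nat_recl //= addrA -hE; apply: ok.
case=> -[sz] ok; have H h1 : b2z h1 = b2z h + (b2z b - b2z p) -> valid_row (p2 :: ps) h1 qs.
  move=> hE; apply/IH; split; first by rewrite /= sz.
  by move=> k kq; have := ok k.+1 kq; rewrite big_nat_recl //= addrA -hE.
have := ok 1%N isT; rewrite big_nat1 /=.
by case: h b p {ok IH} H => -[] [] H //= _; apply: H.
Qed.

(* [column_sum s t i j] is the sum of the first [i] entries of column [j]; row [i] of
   [t] stores it for the [i.+1] first entries of the columns [i, i + 1, ..]. *)
Definition column_sum (s : seq bool) (t : seq (seq bool)) (i j : nat) : int :=
  if i is k.+1 then b2z (nth false (nth [::] t k) (j - k)) else b2z (nth false s j).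

Definition row_sum s t i j : int :=
  column_sum s t i i + \sum_(i <= l < j) (column_sum s t i.+1 l - column_sum s t i l).

Lemma isbit_column_sum s t i j : isbit (column_sum s t i j).
Proof. by case: i => [|i]; apply: isbit_b2z. Qed.

Lemma valid_confP n s t : size s = n.*2.+1 -> valid_conf s t <->
  [/\ size t = n,
      forall i, (i < n)%N -> size (nth [::] t i) = (n - i).*2 &
      forall i j, (i < n)%N -> (i < j)%N -> (j <= n.*2 - i)%N -> isbit (row_sum s t i j)].
Proof.
elim: n s t => [|n IH] s t.
  case: s => // a [|//] _; case: t => [|[|h qs] t] /=; split=> // -[] //.
case: s => // a ps [szps].
case: t => [|x t]; first by case: ps szps => //= p ps _; split=> // -[].
case: x => [|h qs].
  by case: ps szps => //= p ps _; split=> // -[_ /(_ 0%N isT)].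
have -> : valid_conf (a :: ps) ((h :: qs) :: t) = valid_row ps h qs && valid_conf qs t.
  by case: ps szps => //=.
have shift i j : column_sum qs t i j = column_sum (a :: ps) ((h :: qs) :: t) i.+1 j.+1.
  by case: i.
have hshift i j : row_sum qs t i j = row_sum (a :: ps) ((h :: qs) :: t) i.+1 j.+1.
  rewrite /row_sum -shift big_add1; congr (_ + _).
  by apply: eq_bigr => l _; rewrite -!shift.
have h0 k : row_sum (a :: ps) ((h :: qs) :: t) 0 k.+1 =
   b2z h + \sum_(0 <= l < k) (b2z (nth false qs l) - b2z (nth false ps l)).
  by rewrite /row_sum big_nat_recl // addrA [X in X + _]addrC subrK.
split.
  case/andP=> /valid_row_bits[]; rewrite szps => -[szq] ok.
  have szq' : size qs = n.*2.+1 by rewrite -szq.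
  case/(IH _ _ szq') => szt szi bt; split=> /=.
  - by rewrite szt.
  - by case=> [|i] ni /=; rewrite ?szq' // szi.
  - case=> [|i] [|j] // ni ij jn.
      by rewrite h0; apply: ok; rewrite szq'; move: jn; lia.
    rewrite -hshift; apply: bt => //; move: jn; rewrite doubleS; lia.
case=> [[szt]] szi bt; have := szi 0%N isT; rewrite /= subn0 => -[szq].
apply/andP; split.
  apply/valid_row_bits; split; first by rewrite szps szq.
  move=> k kq; rewrite -h0; apply: bt => //; move: kq; rewrite szq; lia.
apply/(IH _ _ szq); split=> //.
  by move=> i ni; have := szi i.+1 ni.
by move=> i j ni ij jn; rewrite hshift; apply: bt => //; rewrite doubleS; lia.
Qed.

Arguments column_sum s t i j : simpl never.

(** * Bijection between matrices and configurations *)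

Section Bijection.
Variable n : nat.
Local Notation m := (n.*2.+1).
Local Notation s0 := (nseq m false).
Local Notation pv := (column_sum s0).
Local Notation hv := (row_sum s0).

Lemma column_sum0 t j : pv t 0 j = 0.
Proof. by rewrite /column_sum nth_nseq if_same. Qed.

(* On the antidiagonal the entry is what is missing from the total 1 of the row,
   whose part to the right of it is by symmetry the column above it. *)
Definition triangle t i j : int :=
  if (i + j < n.*2)%N then pv t i.+1 j - pv t i j else 1 - hv t i j - pv t i j.

Definition unfold_triangle t i j : int :=
  let a := minn i j in let b := maxn i j in
  if (a + b <= n.*2)%N then triangle t a b else triangle t (n.*2 - b) (n.*2 - a).

Definition fold_bits (G : nat -> nat -> int) : seq (seq bool) :=
  mkseq (fun i => mkseq (fun k => \sum_(0 <= l < i.+1) G l (i + k)%N == 1) (n - i).*2) n.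

Lemma telescope (f : nat -> int) i j : (i <= j)%N ->
  \sum_(i <= l < j) (f l.+1 - f l) = f j - f i.
Proof. by move=> ij; rewrite telescope_sumr. Qed.

Section OfMatrix.
Variable G : nat -> nat -> int.
Hypothesis HG : dasasm_fun m G.

Lemma col_bits i j : (i <= m)%N -> (j < m)%N -> isbit (\sum_(0 <= l < i) G l j).
Proof.
case: HG => _ r _ sy _ im jm; have := r j i jm im.
rewrite (eq_big_nat _ _ (F2 := fun l => G l j)) // => l /andP[_ li].
by rewrite sy // (leq_trans li).
Qed.

Lemma pv_fold i j : (i <= n)%N -> (i <= j.+1)%N -> (j <= n.*2 - i)%N ->
  pv (fold_bits G) i j = \sum_(0 <= l < i) G l j.
Proof.
case: i => [|i] ni ij jn; first by rewrite column_sum0 big_geq.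
rewrite /column_sum /fold_bits nth_mkseq // nth_mkseq; last by rewrite -addnn in jn *; lia.
rewrite subnKC //.
have /isbitP[] : isbit (\sum_(0 <= l < i.+1) G l j).
  by apply: col_bits; rewrite -addnn in jn *; lia.
- by move=> ->.
- by move=> ->.
Qed.

Lemma hv_fold i j : (i <= n)%N -> (i <= j)%N -> (j <= n.*2 - i)%N ->
  hv (fold_bits G) i j = \sum_(0 <= l < j) G i l.
Proof.
case: HG => _ _ _ sy _ ni ij jn; rewrite /row_sum pv_fold //; last by rewrite -addnn; lia.
rewrite [RHS](big_cat_nat (n := i)) //=; congr (_ + _).
  by apply: eq_big_nat => l /andP[_ li]; rewrite sy // -addnn; lia.
apply: eq_big_nat => l /andP[il lj].
have ni' : (i < n)%N by rewrite -addnn in jn; lia.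
rewrite !pv_fold //; try (by rewrite -addnn in jn *; lia).
by rewrite big_nat_recr //= [X in X - _]addrC addrK.
Qed.

Lemma fold_valid : valid_conf s0 (fold_bits G).
Proof.
apply/(@valid_confP n); first by rewrite size_nseq.
split.
- by rewrite size_mkseq.
- by move=> i ni; rewrite nth_mkseq // size_mkseq.
case: HG => _ r _ _ _ i j ni ij jn; rewrite hv_fold // ?(ltnW ni) ?(ltnW ij) //.
by apply: r; rewrite -addnn in jn *; lia.
Qed.

Lemma triangle_fold i j : (i <= j)%N -> (i + j <= n.*2)%N ->
  triangle (fold_bits G) i j = G i j.
Proof.
case: HG => _ _ tot sy an ij jn; rewrite /triangle; case: ltnP => ijn.
  rewrite !pv_fold //; try (by rewrite -addnn in ijn *; lia).
  by rewrite big_nat_recr //= [X in X - _]addrC addrK.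
have jE : j = (n.*2 - i)%N by lia.
have ni : (i <= n)%N by rewrite -addnn in jn; lia.
rewrite hv_fold // ?jE // -?jE // pv_fold //; try lia.
have im : (i < m)%N by rewrite -addnn; lia.
have jm : (j < m)%N by rewrite -addnn in jE *; lia.
have tot' : \sum_(0 <= l < j) G i l + (G i j + \sum_(j.+1 <= l < m) G i l) = 1.
  by rewrite -[RHS](tot i im) [RHS](big_cat_nat (n := j)) ?(ltnW jm) //= (big_ltn jm).
rewrite -{}tot'.
suff -> : \sum_(j.+1 <= l < m) G i l = \sum_(0 <= l < i) G l j by ring.
rewrite big_nat_rev -{1}[j.+1]add0n big_addn.
have -> : (m - j.+1 = i)%N by rewrite -addnn in jE *; lia.
apply: eq_big_nat => l /andP[_ li].
rewrite an //; try (by rewrite -addnn in jE *; lia).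
rewrite sy; try (by rewrite -addnn in jE *; lia).
by congr (G _ _); rewrite -addnn in jE *; lia.
Qed.

Lemma unfold_fold i j : (i < m)%N -> (j < m)%N ->
  unfold_triangle (fold_bits G) i j = G i j.
Proof.
case: HG => _ _ _ sy an im jm; rewrite /unfold_triangle.
have E : G (minn i j) (maxn i j) = G i j.
  by case: (leqP i j) => ij; rewrite // sy.
have mm : (maxn i j < m)%N by rewrite gtn_max im.
have mi : (minn i j < m)%N by rewrite gtn_min im.
have ab : (minn i j <= maxn i j)%N by lia.
case: ifP => abn; first by rewrite triangle_fold.
rewrite triangle_fold; try lia.
by rewrite -E [RHS]an // [RHS]sy ?subSS //; lia.
Qed.
End OfMatrix.

Section OfConf.
Variable t : seq (seq bool).
Hypothesis Ht : valid_conf s0 t.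
Let G := unfold_triangle t.

Lemma unfold_sym i j : G i j = G j i.
Proof. by rewrite /G /unfold_triangle minnC maxnC. Qed.

Lemma unfold_tri i j : (i <= j)%N -> (i + j <= n.*2)%N -> G i j = triangle t i j.
Proof.
move=> ij ijn; rewrite /G /unfold_triangle.
by rewrite (minn_idPl ij) (maxn_idPr ij) ijn.
Qed.

Lemma unfold_anti i j : (i < m)%N -> (j < m)%N ->
  G i j = G (m - i.+1)%N (m - j.+1)%N.
Proof.
move=> im jm; rewrite /G /unfold_triangle !subSS.
have -> : minn (n.*2 - i) (n.*2 - j) = (n.*2 - maxn i j)%N by lia.
have -> : maxn (n.*2 - i) (n.*2 - j) = (n.*2 - minn i j)%N by lia.
have mm : (maxn i j <= n.*2)%N by lia.
have mi : (minn i j <= n.*2)%N by lia.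
have ab : (minn i j <= maxn i j)%N by lia.
case: ifP => h1; case: ifP => h2.
- have -> : (n.*2 - maxn i j = minn i j)%N by lia.
  by congr triangle; lia.
- by rewrite !subKn.
- by [].
- lia.
Qed.

Lemma col_sum i j : (i <= j.+1)%N -> (i + j <= n.*2)%N ->
  \sum_(0 <= l < i) G l j = pv t i j.
Proof.
move=> ij ijn; transitivity (\sum_(0 <= l < i) (pv t l.+1 j - pv t l j)); last first.
  by rewrite (@telescope (fun l => pv t l j)) // column_sum0 subr0.
apply: eq_big_nat => l /andP[_ li]; rewrite unfold_tri; try lia.
by rewrite /triangle ifT //; lia.
Qed.

Lemma row_sum_left i j : (i <= n)%N -> (j <= i)%N ->
  \sum_(0 <= l < j) G i l = pv t j i.
Proof.
move=> ni ji; rewrite -col_sum; [|lia|rewrite -addnn; lia].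
by apply: eq_big_nat => l _; rewrite unfold_sym.
Qed.

Lemma row_sum_mid i j : (i <= n)%N -> (i <= j)%N -> (i + j <= n.*2)%N ->
  \sum_(0 <= l < j) G i l = hv t i j.
Proof.
move=> ni ij ijn; rewrite (big_cat_nat (n := i)) //= row_sum_left // /row_sum.
congr (_ + _); apply: eq_big_nat => l /andP[il lj].
by rewrite unfold_tri; try lia; rewrite /triangle ifT //; lia.
Qed.

(** Beyond the antidiagonal, row [i] read from the right is column [2 n - i] read from the top, so
    the part missing to 1 is a column sum. *)
Lemma row_sum_right i j : (i <= n)%N -> (n.*2 < i + j)%N -> (j <= m)%N ->
  \sum_(0 <= l < j) G i l = 1 - pv t (m - j) (n.*2 - i).
Proof.
move=> ni ijn jm; rewrite (big_cat_nat (n := (n.*2 - i).+1)) //=; last lia.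
rewrite big_nat_recr //= row_sum_mid //; try (by rewrite -addnn; lia).
rewrite unfold_tri; try (by rewrite -addnn; lia).
rewrite /triangle ifF; last by apply/negP; rewrite -addnn; lia.
have -> : \sum_((n.*2 - i).+1 <= l < j) G i l =
   \sum_((n.*2 - i).+1 <= l < j) (- pv t (m - l.+1) (n.*2 - i) - - pv t (m - l) (n.*2 - i)).
  apply: eq_big_nat => l /andP[il lj]; rewrite /G /unfold_triangle.
  have il' : (i <= l)%N by rewrite -addnn in il; lia.
  rewrite (minn_idPl il') (maxn_idPr il') ifF; last by apply/negP; lia.
  rewrite /triangle ifT; last by rewrite -addnn in il *; lia.
  have -> : (m - l = (n.*2 - l).+1)%N by lia.
  by rewrite subSS opprK addrC.
rewrite (@telescope (fun l => - pv t (m - l) (n.*2 - i))); last lia.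
have -> : (m - (n.*2 - i).+1 = i)%N by rewrite -addnn; lia.
by ring.
Qed.

Lemma row_bits_top i j : (i <= n)%N -> (j <= m)%N -> isbit (\sum_(0 <= l < j) G i l).
Proof.
move=> ni jm; case: (leqP j i) => ji; first by rewrite row_sum_left ?isbit_column_sum.
case: (leqP (i + j) n.*2) => ijn.
  rewrite row_sum_mid ?(ltnW ji) //.
  have /(@valid_confP n) : valid_conf s0 t by [].
  rewrite size_nseq => /(_ erefl)[_ _ H].
  case: (ltnP i n) => ni'; first by apply: H => //; lia.
  by rewrite -addnn in ijn; lia.
rewrite row_sum_right //.
by case/isbitP: (isbit_column_sum s0 t (m - j) (n.*2 - i)) => ->.
Qed.

Lemma row_total_top i : (i <= n)%N -> \sum_(0 <= l < m) G i l = 1.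
Proof.
move=> ni; rewrite row_sum_right //; last by rewrite -addnn; lia.
by rewrite subnn column_sum0 subr0.
Qed.

(** The half-turn makes row [i] the reversal of row [2 n - i]. *)
Lemma row_sum_flip i j : (i < m)%N -> (j <= m)%N -> (n < i)%N ->
  \sum_(0 <= l < j) G i l = 1 - \sum_(0 <= l < m - j) G (n.*2 - i)%N l.
Proof.
move=> im jm ni; rewrite -(@row_total_top (n.*2 - i)); last by rewrite -addnn; lia.
rewrite [X in X - _](big_cat_nat (n := (m - j)%N)) //=; last lia.
rewrite [X in _ = X - _]addrC addrK -{1}[(m - j)%N]add0n big_addn.
have -> : (m - (m - j) = j)%N by lia.
rewrite [RHS]big_nat_rev /=; apply: eq_big_nat => l /andP[_ lj].
rewrite unfold_anti //; try lia.
by congr (G _ _); lia.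
Qed.

Lemma unfold_dasasm : dasasm_fun m G.
Proof.
have bit i j : (i < m)%N -> (j <= m)%N -> isbit (\sum_(0 <= l < j) G i l).
  move=> im jm; case: (leqP i n) => ni; first exact: row_bits_top.
  rewrite row_sum_flip //.
  have := @row_bits_top (n.*2 - i) (m - j).
  have -> : (n.*2 - i <= n)%N by rewrite -addnn; lia.
  have -> : (m - j <= m)%N by lia.
  by move=> /(_ isT isT)/isbitP[] ->.
split=> //.
- move=> i j im jm; have b1 := bit i j im (ltnW jm); have := bit i j.+1 im jm.
  rewrite big_nat_recr //=; move: b1; move: (\sum_(0 <= _ < _) _) => x.
  by rewrite !inE /isbit; lia.
- move=> i im; case: (leqP i n) => ni; first exact: row_total_top.
  by rewrite row_sum_flip // subnn big_geq // subr0.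
- by move=> i j _ _; apply: unfold_sym.
- by move=> i j; apply: unfold_anti.
Qed.

Lemma fold_unfold : fold_bits G = t.
Proof.
have /(@valid_confP n) := Ht; rewrite size_nseq => /(_ erefl)[szt szi _].
apply: (@eq_from_nth _ [::]); rewrite size_mkseq ?szt // => i ni.
rewrite nth_mkseq //; apply: (@eq_from_nth _ false); rewrite size_mkseq ?szi // => k kn.
rewrite nth_mkseq // col_sum; try (by rewrite -addnn in kn *; lia).
by rewrite /column_sum addKn; case: nth.
Qed.

(** The center lies on both diagonals, so the sum to its left equals the sum above it. *)
Lemma center_unfold : G n n = 1 - 2 * pv t n n.
Proof.
rewrite unfold_tri // ?addnn // /triangle addnn ltnn /row_sum big_geq //; ring.
Qed.
End OfConf.
End Bijection.

(** * Counting by the central entry *)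

Section Enumeration.
Variable n : nat.
Local Notation s0 := (nseq n.*2.+1 false).

Lemma conf_weight1 (F : numFieldType) s t : conf_weight (1 : F) s t = 1.
Proof. by elim: t s => //= x t IH s; rewrite if_same IH mulr1. Qed.

(* The central line changes its bit once for every row with weight 1. *)
Lemma conf_weightN1 (F : numFieldType) k s t : size s = k.*2.+1 -> valid_conf s t ->
  conf_weight (-1 : F) s t =
  (-1) ^+ k * (-1) ^+ center_bit s * (1 - 2 * column_sum s t k k)%:~R.
Proof.
elim: k s t => [|k IH] s t.
  case: s => // a [] // _; case: t => [_|[|? ?] ?] //=.
  by rewrite /center_bit /column_sum /=; case: a; rewrite /= ?mulr1 ?mul1r // mulrN1z mulrNN mulr1.
case: s => // a ps [szps]; case: t => [|[|h qs] t].
- by case: ps szps.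
- by case: ps szps.
have -> : valid_conf (a :: ps) ((h :: qs) :: t) = valid_row ps h qs && valid_conf qs t.
  by case: ps szps.
case/andP=> ok qt; have := valid_row_size ok; rewrite szps => -[szq].
have -> : column_sum (a :: ps) ((h :: qs) :: t) k.+1 k.+1 = column_sum qs t k k.
  by rewrite /column_sum /= ; case: k {IH szps szq}.
rewrite /= (IH qs t) // exprS; move: (_%:~R) => X.
by case: (center_bit (a :: ps)); case: (center_bit qs) => /=; ring.
Qed.

Definition nat_mx (B : 'M[asm_entry]_((2 * n).+1)) i j := int_mx B (inord i) (inord j).

Lemma nat_mxK B : \matrix_(i < (2 * n).+1, j < (2 * n).+1) nat_mx B i j = int_mx B.
Proof. by apply/matrixP => i j; rewrite !mxE /nat_mx !inord_val mxE. Qed.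

Lemma mem_DASASM B : (B \in DASASM (2 * n).+1) <-> dasasm_fun n.*2.+1 (nat_mx B).
Proof. by rewrite inE -nat_mxK is_DASASM_fun mul2n. Qed.

Lemma perm_confs :
  perm_eq [seq fold_bits n (nat_mx B) | B <- enum (DASASM (2 * n).+1)] (confs n s0).
Proof.
apply: uniq_perm; last 1 first.
- move=> t; rewrite mem_confs ?size_nseq //; apply/mapP/idP.
    by case=> B; rewrite mem_enum => /mem_DASASM dB ->; apply: fold_valid.
  move=> vt; have := unfold_dasasm vt; set G := unfold_triangle n t => dG.
  have /DASASM_int[B dB BE] : is_DASASM (\matrix_(i < (2 * n).+1, j < (2 * n).+1) G i j).
    by apply/is_DASASM_fun; rewrite mul2n.
  exists B; first by rewrite mem_enum.
  rewrite -[LHS](fold_unfold vt) -/G; apply/eq_in_map => i.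
  rewrite mem_iota => /andP[_ ni]; apply/eq_in_map => k.
  rewrite mem_iota => /andP[_ kn]; congr (_ == _); apply: eq_big_nat => l /andP[_ li].
  rewrite /nat_mx BE mxE !inordK //; rewrite -addnn in kn; lia.
- rewrite map_inj_in_uniq ?enum_uniq // => B B'.
  rewrite !mem_enum => /mem_DASASM dB /mem_DASASM dB' E.
  apply: int_mx_inj; rewrite -!nat_mxK; apply/matrixP => i j; rewrite 2!mxE.
  have im (x : 'I_(2 * n).+1) : (x < n.*2.+1)%N by rewrite -mul2n.
  by rewrite -(unfold_fold dB) // -(unfold_fold dB') // E.
- exact: uniq_confs.
Qed.

Lemma center_fold B : B \in DASASM (2 * n).+1 ->
  nat_mx B n n = 1 - 2 * column_sum s0 (fold_bits n (nat_mx B)) n n.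
Proof.
move=> /mem_DASASM dB; rewrite -center_unfold ?fold_valid //.
by rewrite unfold_fold // -addnn; lia.
Qed.

Section Counts.
Variables (F : numFieldType) (q : F).
Hypothesis hq : q ^+ 4 = q ^+ 2 - 1.

Lemma center_pm1 B : B \in DASASM (2 * n).+1 -> nat_mx B n n = 1 \/ nat_mx B n n = -1.
Proof.
move=> /center_fold ->.
by case/isbitP: (isbit_column_sum s0 (fold_bits n (nat_mx B)) n n) => ->; auto.
Qed.

Lemma card_plus (K : numFieldType) : #|DASASM_plus n|%:R =
  \sum_(B in DASASM (2 * n).+1) (nat_mx B n n == 1)%:R :> K.
Proof.
rewrite -sum1_card natr_sum big_mkcond [RHS]big_mkcond /=; apply: eq_bigr => B _.
by rewrite inE /nat_mx; case: (B \in _); case: (_ == _).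
Qed.

Lemma card_minus (K : numFieldType) : #|DASASM_minus n|%:R =
  \sum_(B in DASASM (2 * n).+1) (nat_mx B n n == -1)%:R :> K.
Proof.
rewrite -sum1_card natr_sum big_mkcond [RHS]big_mkcond /=; apply: eq_bigr => B _.
by rewrite inE /nat_mx; case: (B \in _); case: (_ == _).
Qed.

Lemma sum_confs (f : seq (seq bool) -> F) :
  \sum_(t <- confs n s0) f t = \sum_(B in DASASM (2 * n).+1) f (fold_bits n (nat_mx B)).
Proof. by rewrite -(perm_big _ perm_confs) /= big_map big_enum. Qed.

Lemma Z_one_count : partition_fun q (nseq n 1) 1 = (#|DASASM_plus n| + #|DASASM_minus n|)%:R.
Proof.
rewrite /partition_fun size_nseq part_sum ?size_nseq //; last by left.
rewrite natrD card_plus card_minus -big_split sum_confs; apply: eq_bigr => B dB.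
by rewrite conf_weight1; case: (center_pm1 dB) => -> /=; rewrite ?addr0 ?add0r.
Qed.

(** By [conf_weightN1] and [center_fold] a configuration weighs [(-1) ^+ n] times the central
    entry. *)
Lemma Z_minus_one_count : (-1) ^+ n * partition_fun q (nseq n 1) (-1) =
  #|DASASM_plus n|%:R - #|DASASM_minus n|%:R.
Proof.
rewrite /partition_fun size_nseq part_sum ?size_nseq //; last by right.
rewrite card_plus card_minus -sumrB big_seq mulr_sumr.
under eq_bigr => t tin.
  rewrite (@conf_weightN1 _ n) ?size_nseq //; last by rewrite -(@mem_confs n) ?size_nseq.
  rewrite /center_bit nth_nseq if_same expr0 mulr1 mulrA -expr2 -exprM mulnC exprM.
  rewrite sqrrN !expr1n mul1r.
over.
rewrite -big_seq sum_confs; apply: eq_bigr => B dB.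
by rewrite -center_fold //; case: (center_pm1 dB) => -> /=; rewrite ?subr0 ?sub0r.
Qed.
End Counts.
End Enumeration.

Lemma natdiff_id_neq0 (F : numFieldType) n : natdiff F id n != 0.
Proof.
elim: n => [|n IH]; first by rewrite /natdiff /= big_nil mulr1 oner_eq0.
have f0 m : m`!%:R != 0 :> F by rewrite pnatr_eq0 -lt0n fact_gt0.
by rewrite natdiffS !tailprod_id; do 2?apply: mulf_neq0.
Qed.

Lemma twelfth_root_unity : exists q : algC, q ^+ 4 = q ^+ 2 - 1.
Proof.
have two0 : 2%:R != 0 :> algC by rewrite pnatr_eq0.
(* [q ^+ 2] has to be a root of [X^2 - X + 1]. *)
exists (sqrtC ((1 + sqrtC (- 3%:R)) / 2%:R)).
rewrite (exprM _ 2 2) !sqrtCK expr_div_n sqrrD sqrtCK.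
by field.
Qed.

Section Cardinals.
Variable n : nat.
Let P := #|DASASM_plus n|.
Let M := #|DASASM_minus n|.
Let A := (\prod_(0 <= i < n.+1) (3 * i)`!)%N.
Let B := (\prod_(0 <= i < n.+1) (n + i)`!)%N.

(** The second equation is [(2 n + 1) (P - M) = P + M], written without subtraction in [nat]. *)
Lemma card_total_difference :
  ((P + M) * B = A /\ (2 * n + 1) * P = (2 * n + 1) * M + (P + M))%N.
Proof.
have [q hq] := twelfth_root_unity.
have v0 := natdiff_id_neq0 algC n.
have t0 : 3%:R ^+ 'C(n, 2) != 0 :> algC by rewrite expf_neq0 ?pnatr_eq0.
have e1 := Z_one hq n; have e2 := Z_minus_one hq n; have := natdiff_expo algC n.
have c2 := Z_minus_one_count n hq; rewrite Z_one_count // in e1; rewrite -{}e1 in e2 *.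
move: t0 v0 c2 e2; set X := 3%:R ^+ _; set V := natdiff _ _ _; set Z2 := partition_fun _ _ _.
rewrite -/P -/M -!natr_prod -/A -/B => t0 v0 c2 e2 e3.
split; apply/eqP; rewrite -(eqr_nat algC); apply/eqP; apply: (mulfI (mulf_neq0 t0 v0)).
  by rewrite [RHS]mulrAC -e3 natrM; ring.
have {}e2 : X * V * ((2 * n + 1)%:R * (P%:R - M%:R)) = X * V * (P + M)%:R.
  by rewrite -c2 [RHS]mulrAC -e2; ring.
by rewrite natrD !natrM mulrDr -e2 natrD; ring.
Qed.

Lemma card_plus_minus_total :
  ((P + M) * B = A)%N /\ (n * P = n.+1 * M)%N.
Proof. by have [-> E] := card_total_difference; split; lia. Qed.

End Cardinals.

Theorem corollary9 (n : nat) :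
  [/\ (#|DASASM_plus n|)%:R =
        (n + 1)%:R / (2 * n + 1)%:R
        * \prod_(0 <= i < n.+1) ((3 * i)`!%:R / (n + i)`!%:R) :> rat,
      (#|DASASM_minus n|)%:R =
        n%:R / (2 * n + 1)%:R
        * \prod_(0 <= i < n.+1) ((3 * i)`!%:R / (n + i)`!%:R) :> rat
    & (#|DASASM_minus n|)%:R / (#|DASASM_plus n|)%:R
        = n%:R / (n + 1)%:R :> rat].
Proof.
have [tot ratio] := card_plus_minus_total n.
have prod_gt0 (f : nat -> nat) : (0 < \prod_(0 <= i < n.+1) (f i)`!)%N.
  by apply: prodn_gt0 => i; apply: fact_gt0.
have A0 := prod_gt0 (muln 3); have B0 := prod_gt0 (addn n).
move: tot ratio; rewrite prodf_div -!natr_prod.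
move: (\prod_(0 <= i < n.+1) (3 * i)`!)%N A0 => A A0.
move: (\prod_(0 <= i < n.+1) (n + i)`!)%N B0 => B B0.
move: #|DASASM_plus n| #|DASASM_minus n| => P M tot ratio.
(* [P = 0] would give [M = 0] by [ratio], and then [A = 0] by [tot]. *)
have P0 : (0 < P)%N by case: (posnP P) => // P0; nia.
have {tot}-> : A%:R / B%:R = P%:R + M%:R :> rat.
  by rewrite -tot natrM mulfK ?natrD // pnatr_eq0 -lt0n.
have {}ratio : n%:R * P%:R = (n + 1)%:R * M%:R :> rat by rewrite -!natrM ratio addn1.
have n1 : (n + 1)%:R != 0 :> rat by rewrite pnatr_eq0 addn1.
have n2 : (2 * n + 1)%:R != 0 :> rat by rewrite pnatr_eq0 addn1.
have {}P0 : P%:R != 0 :> rat by rewrite pnatr_eq0 -lt0n.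
split.
- apply: (mulfI n2); rewrite mulrA mulrCA divff // mulr1 mulrDr -ratio -mulrDl.
  by congr (_ * _); rewrite -natrD; congr (_ %:R); lia.
- apply: (mulfI n2); rewrite mulrA mulrCA divff // mulr1 mulrDr ratio -mulrDl.
  by congr (_ * _); rewrite -natrD; congr (_ %:R); lia.
- by apply/eqP; rewrite eqr_div // mulrC -ratio.
Qed.
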